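(* For every $\alpha\in(0,2)$, there exist a domain $\Omega\subset\mathbb C^2$ whose boundary $\partial\Omega$ is $Z_\alpha$-smooth and a closed set $F\subset\partial\Omega$ with $H^{1+\alpha}(F)<\infty$ such that $\partial\Omega\setminus F$ is locally pseudoconvex at each of its points, but $\Omega$ is not pseudoconvex. (That is, for domains in $\mathbb C^2$ with $Z_\alpha$-smooth boundary, the condition $H^{1+\alpha}(F)<\infty$ for closed $F\subset\partial\Omega$ is not sufficient to imply that $F$ is removable for pseudoconvexity.)
   Context: $H^s$ denotes $s$-dimensional Hausdorff measure. For an open set $U\subset\mathbb R^m$ and $0<\alpha<2$, the Zygmund class is $$Z_\alpha(U):=\{u\in\mathcal C^0(U):\ \exists M<\infty,\ \forall x,x+h,x-h\in U,\ |u(x+h)+u(x-h)-2u(x)|\le M\|h\|^\alpha\}.$$ (For $0<\alpha<1$, $Z_\alpha=\mathcal C^{0,\alpha}$; for $1<\alpha<2$, $Z_\alpha=\mathcal C^{1,\alpha-1}$.) The boundary of $\Omega$ is $Z_\alpha$-smooth if near each boundary point, in suitable Euclidean coordinates, $\Omega$ is the region lying on one side of the graph of a real-valued function of class $Z_\alpha$. ''$\partial\Omega\setminus F$ is locally pseudoconvex at each of its points'' means: for any $\zeta\in\partial\Omega\setminus F$ there exists $r>0$ such that $B(\zeta,r)\cap\Omega$ is pseudoconvex, where $B(\zeta,r)$ is the open Euclidean ball. A set $F\subset\partial\Omega$ is removable for pseudoconvexity (under some regularity assumption on $\Omega$) if local pseudoconvexity of $\partial\Omega\setminus F$ at each of its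 points implies that $\Omega$ is pseudoconvex. *)

(* Defs.v *)
From mathcomp Require Import all_boot all_order all_algebra.
From mathcomp Require Import complex.
From mathcomp Require Import all_classical all_reals all_analysis.

Set Implicit Arguments.
Unset Strict Implicit.
Unset Printing Implicit Defensive.

Import Order.TTheory GRing.Theory Num.Theory.
Import numFieldNormedType.Exports.

Local Open Scope classical_set_scope.
Local Open Scope ring_scope.

(* The topology on complex numbers comes from the [numFieldType] structure of
   [R[i]], through the alias [^o]; C^n carries the product topology. *)
Notation Cspace R n := 'rV[R[i]^o]_n.

Section Euclidean.
Context {R : realType}.

(* The library norm on matrices is the sup norm. *)
Definition enorm n (x : 'rV[R]_n) : R :=
  Num.sqrt (\sum_(k < n) x ord0 k ^+ 2).

Definition cenorm n (z : Cspace R n) : R :=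
  Num.sqrt (\sum_(k < n) ComplexField.Normc.normc (z ord0 k) ^+ 2).

Definition eball n (z : Cspace R n) (r : R) : set (Cspace R n) :=
  [set w | cenorm (w - z) < r].

Definition boundary (T : topologicalType) (A : set T) : set T :=
  closure A `\` interior A.

Definition domain n (Omega : set (Cspace R n)) : Prop :=
  [/\ open Omega, connected Omega & Omega !=set0].

End Euclidean.

Section Hausdorff.
Context {R : realType}.
Local Open Scope ereal_scope.

Definition diam n (A : set (Cspace R n)) : \bar R :=
  maxe 0 (ereal_sup [set (cenorm (x - y))%:E | x in A & y in A]).

(* [hausdorff s] is the [s]-dimensional Hausdorff outer measure, for [0 < s],
   without normalizing constant. For such [s], empty sets in a cover
   contribute [0 `^ s = 0], so finite covers are included. *)
Definition hausdorff_content n (s : R) (d : R) (A : set (Cspace R n)) : \bar R :=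
  ereal_inf [set \sum_(0 <= k <oo) diam (U k) `^ s |
    U in [set U : nat -> set (Cspace R n) |
      A `<=` \bigcup_k U k /\ forall k, diam (U k) <= d%:E]].

Definition hausdorff n (s : R) (A : set (Cspace R n)) : \bar R :=
  ereal_sup [set hausdorff_content s d A | d in [set d : R | (0 < d)%R]].

End Hausdorff.

Section Zygmund.
Context {R : realType}.

Definition zygmund m (alpha : R) (U : set 'rV[R]_m) (u : 'rV[R]_m -> R) : Prop :=
  {within U, continuous u} /\
  exists M : R, forall x h : 'rV[R]_m, U x -> U (x + h) -> U (x - h) ->
    `|u (x + h) + u (x - h) - 2 * u x| <= M * enorm h `^ alpha.

Definition euclidean_coordinates (Phi : Cspace R 2 -> 'rV[R]_(3 + 1)) : Prop :=
  bijective Phi /\ forall z w, enorm (Phi z - Phi w) = cenorm (z - w).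

(* In the coordinates [Phi], the first three components are the base variable
   and the last one is the height. *)
Definition zygmund_boundary (alpha : R) (Omega : set (Cspace R 2)) : Prop :=
  forall zeta, boundary Omega zeta ->
  exists (Phi : Cspace R 2 -> 'rV[R]_(3 + 1)) (V : set (Cspace R 2))
         (U : set 'rV[R]_3) (u : 'rV[R]_3 -> R),
    [/\ euclidean_coordinates Phi,
        open V /\ V zeta,
        open U /\ (forall z, V z -> U (lsubmx (Phi z))),
        zygmund alpha U u &
        forall z, V z ->
          (Omega z <-> rsubmx (Phi z) ord0 ord0 < u (lsubmx (Phi z)))].

End Zygmund.

Section Pseudoconvexity.
Context {R : realType}.

Definition expi (t : R) : R[i]^o := (cos t +i* sin t)%C.

(* Continuous plurisubharmonic functions: the sub-mean value inequality holds
   on every closed affine disc contained in [Omega]. *)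
Definition continuous_psh n (Omega : set (Cspace R n)) (phi : Cspace R n -> R) :
    Prop :=
  {within Omega, continuous phi} /\
  forall a b : Cspace R n,
    (forall t : R[i]^o, ComplexField.Normc.normc t <= 1 -> Omega (a + t *: b)) ->
    phi a <= (2 * pi)^-1 *
      \int[lebesgue_measure]_(t in `[0, 2 * pi]) phi (a + expi t *: b).

(* An open set is pseudoconvex when it has a continuous plurisubharmonic
   exhaustion function. *)
Definition pseudoconvex n (Omega : set (Cspace R n)) : Prop :=
  exists2 phi : Cspace R n -> R, continuous_psh Omega phi &
    forall c : R, compact [set z | Omega z /\ phi z <= c].

Definition locally_pseudoconvex_at n (Omega : set (Cspace R n))
    (zeta : Cspace R n) : Prop :=
  exists2 r : R, 0 < r & pseudoconvex (eball zeta r `&` Omega).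

End Pseudoconvexity.

(* Main.v *)
(* If [g >= 0] is continuous on the plane, the Hartogs domain [|w| < exp (g z)]
   is locally pseudoconvex at its boundary points over the set where [g] is
   superharmonic, but it is not pseudoconvex when [g] vanishes at some [z0] and
   is positive on a circle around [z0]. It therefore suffices to find such a [g]
   of class Z_alpha that is superharmonic off a set [E] of finite
   alpha-dimensional measure: [F] is the part of the boundary over [E], a circle
   bundle of finite (1 + alpha)-dimensional measure.

   For [alpha < 1], [g] is the Green function of the Julia set of a
   nonautonomous sequence of polynomials [A_k (z ^ n_k - 1) + 1] with
   [(n_k A_k) ^ alpha = n_k]. It is alpha-Hoelder, harmonic where it is positive,
   and its zero set is covered by [n_0 ... n_(m-1)] discs of radius
   [O (prod (n_j A_j) ^ -1)].

   For [alpha >= 1], [g z = V (log |z|) + log |z|], where [V] is convex, equal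
   to [|x|] off [-1, 1], and affine off a Cantor set of dimension [alpha - 1],
   so that [g] is harmonic off the circles over that Cantor set. *)

Require Import Defs.
From mathcomp Require Import all_boot all_order all_algebra.
From mathcomp Require Import complex.
From mathcomp Require Import all_classical all_reals all_analysis.
From mathcomp Require Import ring lra.

Set Implicit Arguments.
Unset Strict Implicit.
Unset Printing Implicit Defensive.

Import Order.TTheory GRing.Theory Num.Theory.
Import numFieldNormedType.Exports.

Local Open Scope classical_set_scope.
Local Open Scope ring_scope.

(** Finite measure at exactly the exponent [1 + alpha] is the delicate point: the right dimension is
    not enough, and neither the regularity of [g] nor the covering of its exceptional set may lose a
    logarithm. Both constructions therefore have an exactly critical ratio, so that passing to the
    next generation reproduces the same bound: lam^(alpha - 1) = 1/2 for the Cantor set, where the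
    scaling is exact, and (n_k A_k)^alpha = n_k for the polynomials, where it is only approximate.
    There the growth of A_k keeps the distortion at generation k below exp(c 2^(-k)), and the
    product of these factors converges. The second relation means A_k = n_k^((1 - alpha) / alpha),
    which grows with n_k only for alpha < 1. For alpha >= 1 whole circles may belong to the
    exceptional set; they account for one dimension and leave alpha - 1 to the Cantor set. In the
    variable log |z| affine pieces become harmonic, and the added log |z| cancels the logarithmic
    pole that |log |z|| would have at the origin. *)

Notation normc := ComplexField.Normc.normc.

(** * Topology of C and C^n through the real-valued modulus *)

Section ComplexTopology.
Context {R : realType}.
Local Notation C := R[i]^o.
Implicit Types z w : C.

Lemma normc_ge0 z : 0 <= normc z.
Proof. by case: z => a b /=; exact: sqrtr_ge0. Qed.

Lemma normcD z w : normc (z + w) <= normc z + normc w.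
Proof. exact: (@le_normcD R). Qed.

Lemma normc_opp z : normc (- z) = normc z.
Proof. exact: (@normcN R). Qed.

Lemma normcBC z w : normc (z - w) = normc (w - z).
Proof. by rewrite -normc_opp opprB. Qed.

Lemma normc_dist z w : `|normc z - normc w| <= normc (z - w).
Proof.
have h1 := normcD (z - w) w; have h2 := normcD (w - z) z.
rewrite !subrK in h1 h2; rewrite (normcBC w) in h2.
by rewrite ler_norml; apply/andP; split; lra.
Qed.

Lemma normc_zero : normc (0 : C) = 0. Proof. exact: ComplexField.Normc.normc0. Qed.

Lemma normc_one : normc (1 : C) = 1. Proof. exact: ComplexField.Normc.normc1. Qed.

Lemma normc_mul z w : normc (z * w) = normc z * normc w.
Proof. exact: ComplexField.Normc.normcM. Qed.

Lemma normcX z n : normc (z ^+ n) = normc z ^+ n.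
Proof. by elim: n => [|n IH]; rewrite ?expr0 ?normc_one // !exprS normc_mul IH. Qed.

Lemma normc_real (x : R) : normc (x%:C%C : C) = `|x|.
Proof. by rewrite /= expr0n addr0 sqrtr_sqr. Qed.

Lemma normc_eq0 z : (normc z == 0) = (z == 0).
Proof.
by apply/eqP/eqP => [/ComplexField.Normc.eq0_normc //|->]; exact: normc_zero.
Qed.

Lemma normc_gt0 z : (0 < normc z) = (z != 0).
Proof. by rewrite lt_def normc_ge0 andbT normc_eq0. Qed.

Lemma normcE z : normc z = Num.sqrt (complex.Re z ^+ 2 + complex.Im z ^+ 2).
Proof. by case: z. Qed.

Lemma sqr_normcE z : normc z ^+ 2 = complex.Re z ^+ 2 + complex.Im z ^+ 2.
Proof. by rewrite normcE sqr_sqrtr // addr_ge0 ?sqr_ge0. Qed.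

Lemma normr_Re_le z : `|complex.Re z| <= normc z.
Proof. by rewrite normcE -sqrtr_sqr ler_wsqrtr // lerDl sqr_ge0. Qed.

Lemma normr_Im_le z : `|complex.Im z| <= normc z.
Proof. by rewrite normcE -sqrtr_sqr ler_wsqrtr // lerDr sqr_ge0. Qed.

Lemma normc_le_ReIm z : normc z <= `|complex.Re z| + `|complex.Im z|.
Proof.
rewrite -(ger0_norm (addr_ge0 (normr_ge0 _) (normr_ge0 _))) -sqrtr_sqr normcE.
rewrite ler_wsqrtr // sqrrD !real_normK ?num_real // -addrA lerD2l lerDr.
by rewrite mulrn_wge0 // mulr_ge0.
Qed.

(** Balls of [R[i]^o] have radii in [R[i]]; positivity of such a radius forces its imaginary part to
    be 0, which reduces them to balls of real radius. *)
Lemma nbhs_cplxP z (A : set C) :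
  nbhs z A <-> exists2 e : R, 0 < e & forall w, normc (w - z) < e -> A w.
Proof.
split=> [/nbhs_ballP[e /= e0 eA]|[e e0 eA]].
  have : 0 < e by [].
  case: e eA {e0} => e e' eA; rewrite ltcE /= => /andP[/eqP e'0 e0].
  exists e => // w zw; apply: eA; rewrite -ball_normE /=.
  by rewrite normc_def ltcE /= e'0 eqxx /= -normcE normcBC.
apply/nbhs_ballP; exists (e%:C%C) => /=; first by rewrite ltcR.
move=> w; rewrite -ball_normE /= normc_def ltcR -normcE normcBC => ?; exact: eA.
Qed.

Lemma nbhs_cspaceP n (p : Cspace R n) (A : set (Cspace R n)) :
  nbhs p A <-> exists2 e : R, 0 < e &
    forall q : Cspace R n, (forall k, normc (q ord0 k - p ord0 k) < e) -> A q.
Proof.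
split=> [/nbhs_ballP[e /= e0 eA]|[e e0 eA]].
  have : 0 < e by [].
  case: e eA e0 => e e' eA e0'; rewrite ltcE /= => /andP[/eqP e'0 e0].
  exists e => // w zw; apply: eA; split=> // i j; rewrite ord1 -ball_normE /=.
  by rewrite normc_def ltcE /= e'0 eqxx /= -normcE normcBC.
apply/nbhs_ballP; exists (e%:C%C) => /=; first by rewrite ltcR.
move=> w [_ pw]; apply: eA => k; have := pw ord0 k.
by rewrite -ball_normE /= normc_def ltcR -normcE normcBC.
Qed.

Lemma near_cplx (T : Type) (F : set_system T) (FF : Filter F) (f : T -> C) (l : C) :
  (forall e : R, 0 < e -> \forall x \near F, normc (f x - l) < e) -> f @ F --> l.
Proof.
move=> H A /nbhs_cplxP[e e0 eA]; have := H _ e0; apply: filterS => x; exact: eA.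
Qed.

Lemma near_cspace (T : Type) (F : set_system T) (FF : Filter F) n
    (f : T -> Cspace R n) (l : Cspace R n) :
  (forall k (e : R), 0 < e -> \forall x \near F, normc (f x ord0 k - l ord0 k) < e) ->
  f @ F --> l.
Proof.
move=> H A /nbhs_cspaceP[e e0 eA].
have : \forall x \near F, forall k, normc (f x ord0 k - l ord0 k) < e.
  by apply: filter_forall => k; exact: H.
by apply: filterS => x; exact: eA.
Qed.

Lemma cspace_coord_continuous n k : continuous (fun p : Cspace R n => p ord0 k : C).
Proof.
move=> p; apply: (@near_cplx _ (nbhs p) (nbhs_filter p)) => e e0.
by apply/nbhs_cspaceP; exists e => // q; exact.
Qed.

Lemma lipschitz_cplx_continuous (f : C -> R) :
  (forall z w, `|f z - f w| <= normc (z - w)) -> continuous f.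
Proof.
move=> H z; apply/(cvgrPdist_lt (FF := nbhs_filter z)) => e e0.
apply/nbhs_cplxP; exists e => // w wz.
by apply: le_lt_trans (H _ _) _; rewrite normcBC.
Qed.

Lemma normc_continuous : continuous (fun z : C => normc z).
Proof. exact: lipschitz_cplx_continuous normc_dist. Qed.

Lemma normc_expi (t : R) : normc (expi t) = 1.
Proof. by rewrite /expi /= cos2Dsin2 sqrtr1. Qed.

Lemma lipschitz1_of_derive (f df : R -> R) :
  (forall x : R, is_derive x (1 : R) f (df x)) -> (forall x, `|df x| <= 1) ->
  forall s t, `|f s - f t| <= `|s - t|.
Proof.
move=> Hf Hdf s t.
wlog st : s t / s <= t => [H|].
  by case/orP: (le_total s t) => ?; [|rewrite distrC [leRHS]distrC]; exact: H.
have [|c _] := @MVT_segment _ f df s t st (fun x _ => Hf x).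
  apply: continuous_subspaceT => x; apply: differentiable_continuous.
  by apply/derivable1_diffP; have [] := Hf x.
by rewrite distrC => ->; rewrite normrM [`|s - t|]distrC ler_piMl.
Qed.

Lemma expi_lipschitz (s t : R) : normc (expi s - expi t) <= 2 * `|s - t|.
Proof.
apply: le_trans (normc_le_ReIm _) _; rewrite /expi /= mulrDl mul1r lerD //.
- apply: (lipschitz1_of_derive (df := fun x => - sin x)) => x.
  by rewrite normrN ler_norml sin_geN1 sin_le1.
- by apply: lipschitz1_of_derive => x; rewrite ler_norml cos_geN1 cos_le1.
Qed.

Lemma cspace_affE n (a b : Cspace R n) (t : C) k :
  (a + t *: b) ord0 k = a ord0 k + t * b ord0 k.
Proof. by rewrite mxE; congr (_ + _); rewrite mxE. Qed.

Lemma cspace_aff_dist n (a b : Cspace R n) (u v : C) k :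
  normc ((a + u *: b) ord0 k - (a + v *: b) ord0 k) =
  normc (u - v) * normc (b ord0 k).
Proof. by rewrite !cspace_affE opprD addrACA subrr add0r -mulrBl normc_mul. Qed.

Lemma circle_continuous n (a b : Cspace R n) :
  continuous (fun t : R => a + expi t *: b).
Proof.
move=> s; apply: near_cspace => k e e0.
have H0 : 0 < 2 * (normc (b ord0 k) + 1).
  by rewrite mulr_gt0 // ltr_wpDl // normc_ge0.
apply/nbhs_ballP; exists (e / (2 * (normc (b ord0 k) + 1))); first exact: divr_gt0.
move=> t; rewrite /ball /= => st.
rewrite (cspace_aff_dist a b (expi t) (expi s)).
apply: le_lt_trans (_ : 2 * `|s - t| * (normc (b ord0 k) + 1) < e).
  rewrite ler_pM ?normc_ge0 //; last by rewrite lerDl.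
  by rewrite distrC; exact: expi_lipschitz.
by rewrite mulrAC mulrC -ltr_pdivlMr.
Qed.

Lemma cbox_compact (M : R) :
  compact [set z : C | `|complex.Re z| <= M /\ `|complex.Im z| <= M].
Proof.
pose f (x : R * R) : C := (x.1 +i* x.2)%C.
have -> : [set z : C | `|complex.Re z| <= M /\ `|complex.Im z| <= M]
    = f @` ([set` `[- M, M]] `*` [set` `[- M, M]]).
  apply/seteqP; split=> z /=.
    move=> [h1 h2]; exists (complex.Re z, complex.Im z); last by case: z {h1 h2}.
    by rewrite /= !in_itv /= -!ler_norml.
  by case=> -[x y] /= []; rewrite !in_itv /= -!ler_norml => h1 h2 <-.
apply: continuous_compact; last by apply: compact_setX; exact: segment_compact.
apply: continuous_subspaceT => -[x y]; apply: near_cplx => e e0.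
have e20 : 0 < e / 2 by exact: divr_gt0.
have := nbhsx_ballx ((x, y) : R * R) _ e20; apply: filterS => u [/= h1 h2].
change (normc (f u - f (x, y)) < e).
apply: le_lt_trans (normc_le_ReIm _) _; rewrite (splitr e) ltrD //.
- by change (`|u.1 - x| < e / 2); rewrite distrC; exact: h1.
- by change (`|u.2 - y| < e / 2); rewrite distrC; exact: h2.
Qed.

Lemma cspace_box_compact n (M : R) :
  compact [set p : Cspace R n | forall k, normc (p ord0 k) <= M].
Proof.
have H := rV_compact (fun _ : 'I_n => @cbox_compact M).
apply: subclosed_compact H _; last first.
  move=> p pM k; split; apply: le_trans (pM k); [exact: normr_Re_le|exact: normr_Im_le].
have -> : [set p : Cspace R n | forall k, normc (p ord0 k) <= M] =
    \bigcap_(k in [set: 'I_n]) ((fun p : Cspace R n => normc (p ord0 k)) @^-1` [set x | x <= M]).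
  by apply/seteqP; split => [p pM k _|p pM k]; [exact: pM|exact: (pM k I)].
apply: closed_bigI => k _; apply: closed_comp => [p _|]; last exact: closed_le.
apply: (continuous_comp (f := fun p : Cspace R n => p ord0 k : C)).
  exact: cspace_coord_continuous.
exact: normc_continuous.
Qed.

End ComplexTopology.

(** * Means over circles *)

Section CircleMean.
Context {R : realType}.
Local Notation C := R[i]^o.
Local Notation mu := lebesgue_measure.
Implicit Types f g : R -> R.

Definition circle_mean f : R :=
  (2 * pi)^-1 * \int[mu]_(t in `[0, 2 * pi]) f t.

Lemma twopi_gt0 : 0 < 2 * pi :> R.
Proof. by rewrite mulr_gt0 ?pi_gt0. Qed.

Lemma continuous_segment_integrable f (a b : R) : continuous f ->
  mu.-integrable `[a, b] (EFin \o f).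
Proof.
move=> cf; apply: continuous_compact_integrable; first exact: segment_compact.
exact: continuous_subspaceT.
Qed.

Lemma le_circle_mean f g : continuous f -> continuous g ->
  (forall t, f t <= g t) -> circle_mean f <= circle_mean g.
Proof.
move=> cf cg fg; rewrite /circle_mean ler_pM2l ?invr_gt0 ?twopi_gt0 //.
by apply: le_Rintegral => //; exact: continuous_segment_integrable.
Qed.

Lemma Rintegral_cst_segment (c a b : R) : a <= b ->
  \int[mu]_(t in `[a, b]) c = c * (b - a).
Proof.
move=> ab; rewrite Rintegral_cst //; congr (_ * _).
transitivity (fine (lebesgue_measure ([set` `[a, b]] : set R))); first by [].
rewrite lebesgue_measure_itv /= lte_fin.
by move: ab; rewrite le_eqVlt => /predU1P[->|->//]; rewrite ltxx subrr.
Qed.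

Lemma circle_mean_cst (c : R) : circle_mean (fun=> c) = c.
Proof.
rewrite /circle_mean Rintegral_cst_segment ?(ltW twopi_gt0) // subr0 mulrC mulfK //.
by rewrite gt_eqF // twopi_gt0.
Qed.

Lemma circle_meanD f g : continuous f -> continuous g ->
  circle_mean (fun t => f t + g t) = circle_mean f + circle_mean g.
Proof.
move=> cf cg; rewrite /circle_mean -mulrDr RintegralD //;
  exact: continuous_segment_integrable.
Qed.

Lemma circle_meanZ (c : R) f : continuous f ->
  circle_mean (fun t => c * f t) = c * circle_mean f.
Proof.
move=> cf; rewrite /circle_mean RintegralZl //; first by rewrite mulrCA.
exact: continuous_segment_integrable.
Qed.

Lemma Rintegral_affine f (c d a b : R) : continuous f -> 0 < c -> a <= b ->
  \int[mu]_(t in `[c * a + d, c * b + d]) f t =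
  c * \int[mu]_(t in `[a, b]) f (c * t + d).
Proof.
move=> cf c0 ab.
pose F (t : R) : R := c * t + d.
have dF (x : R) : is_derive x (1 : R) F c.
  rewrite /F; apply: is_derive_eq; rewrite addr0 /=; exact: mulr1.
have F'E : derive1 F = cst c.
  by apply/funext => x; rewrite derive1E; apply: derive_val.
have cF : continuous F.
  move=> x; apply: differentiable_continuous.
  by apply/derivable1_diffP; have [] := dF x.
have H := @integration_by_substitution_increasing R F f a b ab.
rewrite /Rintegral -[X in fine X = _]/(\int[mu]_(x in `[F a, F b]) (f x)%:E)%E.
rewrite H.
- rewrite F'E.
  transitivity (\int[mu]_(t in `[a, b]) (c * f (c * t + d))).
    by apply: eq_Rintegral => t _; rewrite fctE /= mulrC.
  rewrite RintegralZl //; apply: continuous_segment_integrable => x.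
  by apply: (continuous_comp (f := F) (g := f)); [exact: cF|exact: cf].
- by move=> x y _ _ xy; rewrite /F ltrD2r ltr_pM2l.
- by move=> x _; rewrite F'E; exact: cst_continuous.
- by rewrite F'E; exact: is_cvg_cst.
- by rewrite F'E; exact: is_cvg_cst.
- split => [x _| |].
  + by have [] := dF x.
  + by apply: cvg_at_right_filter; exact: cF.
  + by apply: cvg_at_left_filter; exact: cF.
- exact: continuous_subspaceT.
Qed.

(** Pairing antipodal points serves both the midpoint criterion for subharmonicity and the angle
    doubling behind the mean value property of log |z|. *)
Lemma circle_mean_halves f : continuous f ->
  circle_mean f = (2 * pi)^-1 *
    \int[mu]_(t in `[0, pi]) (f t + f (t + pi)).
Proof.
move=> cf; rewrite /circle_mean; congr (_ * _).
rewrite RintegralD //; first last.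
- apply: continuous_segment_integrable => x.
  apply: (continuous_comp (f := fun t : R => t + pi) (g := f)); last exact: cf.
  by apply: cvgD; [exact: cvg_id|exact: cvg_cst].
- exact: continuous_segment_integrable.
have <- : \int[mu]_(t in `[pi, 2 * pi]) f t = \int[mu]_(t in `[0, pi]) f (t + pi).
  have := @Rintegral_affine f 1 pi 0 pi cf ltr01 (pi_ge0 R).
  rewrite !mul1r add0r -mulr2n -(mulr_natl pi) => ->.
  by apply: eq_Rintegral => t _; rewrite mul1r.
have pi2 : pi <= 2 * pi :> R by rewrite ler_peMl ?pi_ge0 // ler1n.
rewrite -[X in _ + X]Rintegral_itv_obnd_cbnd; last first.
  apply: (integrableS _ _ _ (continuous_segment_integrable pi (2 * pi) cf)) => //.
  by apply: subset_itv_oc_cc.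
rewrite -(@Rintegral_itvB _ f (BLeft 0) (BRight (2 * pi)) pi).
- by rewrite addrC subrK.
- exact: continuous_segment_integrable.
- by rewrite bnd_simp pi_ge0.
- by rewrite bnd_simp.
Qed.

Lemma circle_mean_ge_midpoint f (c : R) : continuous f ->
  (forall t, 2 * c <= f t + f (t + pi)) -> c <= circle_mean f.
Proof.
move=> cf H; rewrite circle_mean_halves // mulrC ler_pdivlMr ?twopi_gt0 //.
apply: le_trans (_ : \int[mu]_(t in `[0, pi]) (2 * c) <= _).
  by rewrite Rintegral_cst_segment ?pi_ge0 // subr0 mulrA (mulrC c).
apply: le_Rintegral => //.
  by apply: continuous_segment_integrable; exact: cst_continuous.
apply: continuous_segment_integrable => x.
apply: cvgD; first exact: cf.
apply: (continuous_comp (f := fun t : R => t + pi) (g := f)); last exact: cf.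
by apply: cvgD; [exact: cvg_id|exact: cvg_cst].
Qed.

Lemma circle_mean_double f g : continuous f -> continuous g ->
  (forall t, f t + f (t + pi) = g (2 * t)) -> circle_mean f = 2^-1 * circle_mean g.
Proof.
move=> cf cg H; rewrite circle_mean_halves // /circle_mean.
under eq_Rintegral do rewrite H.
have := @Rintegral_affine g 2 0 0 pi cg (ltr0n _ 2) (pi_ge0 R).
rewrite mulr0 !addr0 => ->; rewrite mulrCA mulKf ?pnatr_eq0 //; congr (_ * _).
by apply: eq_Rintegral => t _; rewrite addr0.
Qed.

End CircleMean.

(** * Mean value property of log |z| *)

Section LogMean.
Context {R : realType}.
Local Notation C := R[i]^o.

Lemma expiDpi (t : R) : expi (t + pi) = - expi t.
Proof. by rewrite /expi cosDpi sinDpi. Qed.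

Lemma expi_double (t : R) : expi (2 * t) = expi t * expi t.
Proof.
rewrite mulr_natl mulr2n /expi cosD sinD; congr Complex.
by rewrite addrC.
Qed.

Lemma cplx_circle_continuous (a b : C) : continuous (fun t : R => a + expi t * b : C).
Proof.
move=> s; apply: near_cplx => e e0.
have H0 : 0 < 2 * (normc b + 1) by rewrite mulr_gt0 // ltr_wpDl // normc_ge0.
apply/nbhs_ballP; exists (e / (2 * (normc b + 1))); first exact: divr_gt0.
move=> t; rewrite /ball /= => st.
rewrite opprD addrACA subrr add0r -mulrBl normc_mul.
apply: le_lt_trans (_ : 2 * `|s - t| * (normc b + 1) < e).
  rewrite ler_pM ?normc_ge0 //; last by rewrite lerDl.
  by rewrite distrC; exact: expi_lipschitz.
by rewrite mulrAC mulrC -ltr_pdivlMr.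
Qed.

Lemma normc_circle_ge (a b : C) (t : R) :
  normc a - normc b <= normc (a + expi t * b).
Proof.
have := normcD (a + expi t * b) (- (expi t * b)).
by rewrite addrK normc_opp normc_mul normc_expi mul1r lerBlDr.
Qed.

Lemma normc_circle_le (a b : C) (t : R) :
  normc (a + expi t * b) <= normc a + normc b.
Proof. by have := normcD a (expi t * b); rewrite normc_mul normc_expi mul1r. Qed.

Lemma ln_circle_continuous (a b : C) : normc b < normc a ->
  continuous (fun t : R => ln (normc (a + expi t * b))).
Proof.
move=> ba t.
apply: (continuous_comp (f := fun t : R => normc (a + expi t * b)) (g := @ln R)).
  apply: (continuous_comp (f := fun t : R => a + expi t * b : C)).
    exact: cplx_circle_continuous.
  exact: normc_continuous.
apply: continuous_ln; apply: lt_le_trans (normc_circle_ge a b t).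
by rewrite subr_gt0.
Qed.

Lemma circle_mean_ln1D_double (q : C) : normc q < 1 ->
  circle_mean (fun t : R => ln (normc (1 + expi t * q))) =
  2^-1 * circle_mean (fun t : R => ln (normc (1 + expi t * - (q * q)))).
Proof.
move=> q1; have q2 : normc (- (q * q)) < 1.
  by rewrite normc_opp normc_mul mulr_ilt1 ?normc_ge0.
have pos (p : C) t : normc p < 1 -> 0 < normc (1 + expi t * p).
  by move=> p1; apply: lt_le_trans (normc_circle_ge _ _ _); rewrite normc_one subr_gt0.
apply: (circle_mean_double (g := fun t => ln (normc (1 + expi t * - (q * q))))).
- by apply: ln_circle_continuous; rewrite normc_one.
- by apply: ln_circle_continuous; rewrite normc_one.
move=> t; rewrite -lnM ?posrE ?pos // -normc_mul expiDpi expi_double.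
by congr (ln (normc _)); rewrite mulrDr mulr1 mulrDl mul1r mulNr mulrN !mulrA; ring.
Qed.

Lemma circle_mean_ln1D (q : C) : normc q < 1 ->
  circle_mean (fun t : R => ln (normc (1 + expi t * q))) = 0.
Proof.
move=> q1; set r := normc q in q1.
pose K := - ln (1 - r).
have r0 : 0 <= r by exact: normc_ge0.
have K0 : 0 <= K by rewrite oppr_ge0 ln_le0 // lerBlDr lerDl.
(* The map sending [q] to [- (q * q)] preserves the disc of radius [r], so [n] applications of the
   halving identity reduce the mean to the crude bound [K], uniform on that disc. *)
have bound n (p : C) : normc p <= r ->
    `|circle_mean (fun t : R => ln (normc (1 + expi t * p)))| <= K * 2^-1 ^+ n.
  elim: n p => [|n IH] p pr; last first.
    rewrite circle_mean_ln1D_double ?(le_lt_trans pr) // normrM ger0_norm ?invr_ge0 //.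
    rewrite exprS mulrCA ler_pM2l ?invr_gt0 //; apply: IH.
    rewrite normc_opp normc_mul; apply: le_trans (_ : r * 1 <= _); last by rewrite mulr1.
    by rewrite ler_pM ?normc_ge0 // (le_trans pr) // ltW.
  have cf : continuous (fun t : R => ln (normc (1 + expi t * p))).
    by apply: ln_circle_continuous; rewrite normc_one (le_lt_trans pr).
  have lb t : 1 - r <= normc (1 + expi t * p).
    by apply: le_trans (normc_circle_ge _ _ _); rewrite normc_one lerB.
  have ub t : normc (1 + expi t * p) <= 1 + r.
    by apply: le_trans (normc_circle_le _ _ _) _; rewrite normc_one lerD.
  have p0 : 0 < 1 - r by rewrite subr_gt0.
  have pp t : 0 < normc (1 + expi t * p) by exact: lt_le_trans (lb t).
  rewrite expr0 mulr1 ler_norml; apply/andP; split.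
    rewrite -[leLHS]circle_mean_cst; apply: le_circle_mean => //.
      exact: cst_continuous.
    by move=> t; rewrite opprK ler_ln ?posrE.
  rewrite -[leRHS]circle_mean_cst; apply: le_circle_mean => //.
    exact: cst_continuous.
  (* The upper bound needs [1 + r <= (1 - r)^-1], that is [1 - r ^+ 2 <= 1]. *)
  move=> t; rewrite /K -lnV ?posrE // ler_ln ?posrE ?invr_gt0 //.
  apply: le_trans (ub t) _; rewrite -[leRHS]mul1r ler_pdivlMr //.
  by rewrite mulrC -subr_sqr expr1n lerBlDr lerDl sqr_ge0.
apply/eqP; rewrite -normr_le0; apply/ler_addgt0Pl => e e0; rewrite addr0.
have : (fun n => K * 2^-1 ^+ n) @ \oo --> (0 : R).
  have := @cvg_geometric R K 2^-1; apply; rewrite ger0_norm ?invr_ge0 //.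
  by rewrite invf_lt1 // ltr1n.
move=> /cvgrPdist_lt/(_ e e0)[n _ /(_ n (leqnn n))].
rewrite sub0r normrN ger0_norm; last by rewrite mulr_ge0 // exprn_ge0 // invr_ge0.
by move=> /ltW; apply: le_trans; exact: bound.
Qed.

(* Mean value property of [log |z|]: with [m q] the mean of [log |1 + q e^(it)|],
   pairing [t] with [t + pi] gives [m q = m (- q^2) / 2], whence [m q = 0]. *)
Lemma circle_mean_ln_normc (a b : C) : normc b < normc a ->
  circle_mean (fun t : R => ln (normc (a + expi t * b))) = ln (normc a).
Proof.
move=> ba.
have a0 : 0 < normc a by apply: le_lt_trans ba; exact: normc_ge0.
have a0' : a != 0 by rewrite -normc_gt0.
have q1 : normc (b / a) < 1.
  rewrite normc_mul ComplexField.Normc.normcV ltr_pdivrMr // mul1r //.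
have -> : (fun t : R => ln (normc (a + expi t * b))) =
    (fun t : R => ln (normc a) + ln (normc (1 + expi t * (b / a)))).
  apply/funext => t.
  rewrite -lnM ?posrE //; last first.
    apply: lt_le_trans (normc_circle_ge _ _ _); rewrite normc_one subr_gt0 //.
  by rewrite -normc_mul mulrDr mulr1 mulrCA (mulrC b) mulVKf.
rewrite circle_meanD ?circle_mean_cst ?circle_mean_ln1D ?addr0 //.
  exact: cst_continuous.
by apply: ln_circle_continuous; rewrite normc_one.
Qed.

End LogMean.

(** * Hartogs domains: topology, boundary, failure of pseudoconvexity *)

Section Hartogs.
Context {R : realType}.
Local Notation C := R[i]^o.
Local Notation C2 := (Cspace R 2).

Lemma normc_realB (s t : R) : normc (t%:C%C - s%:C%C : C) = `|t - s|.
Proof.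
rewrite (_ : t%:C%C - s%:C%C = (t - s)%:C%C) ?normc_real //.
by apply/eqP; rewrite eq_complex /= subrr !eqxx.
Qed.

Definition cpair (z w : C) : C2 := \row_k (if k == ord0 then z else w).

Lemma cpair0 z w : cpair z w ord0 ord0 = z. Proof. by rewrite mxE. Qed.

Lemma cpair1 z w : cpair z w ord0 ord_max = w. Proof. by rewrite mxE. Qed.

Lemma ord2P (k : 'I_2) : k = ord0 \/ k = ord_max.
Proof. by case: k => [[|[|//]]] ?; [left|right]; apply: val_inj. Qed.

Lemma cpair_eta (p : C2) : cpair (p ord0 ord0) (p ord0 ord_max) = p.
Proof. by apply/rowP => k; have [->|->] := ord2P k; rewrite ?cpair0 ?cpair1. Qed.

Lemma cenorm2E (p : C2) :
  cenorm p = Num.sqrt (normc (p ord0 ord0) ^+ 2 + normc (p ord0 ord_max) ^+ 2).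
Proof.
rewrite /cenorm big_ord_recl big_ord1; congr (Num.sqrt (_ + _ ^+ 2)).
by congr (normc (p _ _)); exact: val_inj.
Qed.

Lemma sqr_cenorm2 (p : C2) :
  cenorm p ^+ 2 = normc (p ord0 ord0) ^+ 2 + normc (p ord0 ord_max) ^+ 2.
Proof. by rewrite cenorm2E sqr_sqrtr // addr_ge0 ?sqr_ge0. Qed.

Lemma cenorm_ge0 (p : C2) : 0 <= cenorm p. Proof. exact: sqrtr_ge0. Qed.

Lemma normc_coord_le (p : C2) k : normc (p ord0 k) <= cenorm p.
Proof.
rewrite -[leLHS]ger0_norm ?normc_ge0 // -sqrtr_sqr cenorm2E ler_wsqrtr //.
by have [->|->] := ord2P k; rewrite ?lerDl ?lerDr sqr_ge0.
Qed.

Lemma cenorm_le_coords (p : C2) :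
  cenorm p <= normc (p ord0 ord0) + normc (p ord0 ord_max).
Proof.
have h0 := normc_ge0 (p ord0 ord0); have h1 := normc_ge0 (p ord0 ord_max).
rewrite -(ger0_norm (addr_ge0 h0 h1)) -sqrtr_sqr cenorm2E ler_wsqrtr //.
by rewrite sqrrD -addrA lerD2l lerDr mulrn_wge0 // mulr_ge0.
Qed.

Definition hartogs (g : C -> R) : set C2 :=
  [set p | normc (p ord0 ord_max) < expR (g (p ord0 ord0))].

Lemma normc_coord_continuous n k :
  continuous (fun p : Cspace R n => normc (p ord0 k)).
Proof.
move=> p; apply: (continuous_comp (f := fun p : Cspace R n => p ord0 k : C)).
  exact: cspace_coord_continuous.
exact: normc_continuous.
Qed.

Section Fixed_g.
Variable g : C -> R.
Hypothesis cg : continuous g.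

Lemma expR_base_continuous : continuous (fun p : C2 => expR (g (p ord0 ord0))).
Proof.
move=> p; apply: (continuous_comp (f := fun p : C2 => g (p ord0 ord0)) (g := @expR R)).
  apply: (continuous_comp (f := fun p : C2 => p ord0 ord0 : C)); last exact: cg.
  exact: cspace_coord_continuous.
exact: continuous_expR.
Qed.

Lemma hartogs_gap_continuous :
  continuous (fun p : C2 => expR (g (p ord0 ord0)) - normc (p ord0 ord_max)).
Proof.
move=> p; have h1 := @expR_base_continuous p.
have h2 := @normc_coord_continuous 2 ord_max p; exact: (cvgB h1 h2).
Qed.

Lemma hartogs_open : open (hartogs g).
Proof.
rewrite (_ : hartogs g = (fun p : C2 => expR (g (p ord0 ord0)) -
   normc (p ord0 ord_max)) @^-1` [set x | 0 < x]).
  apply: open_comp; last exact: open_gt.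
  by move=> p _; exact: hartogs_gap_continuous.
by apply/seteqP; split=> p /=; rewrite /hartogs /= subr_gt0.
Qed.

Lemma segment_continuous n (a b : Cspace R n) :
  continuous (fun t : R => a + (t%:C%C : C) *: b).
Proof.
move=> s; apply: near_cspace => k e e0.
have H0 : 0 < normc (b ord0 k) + 1 by rewrite ltr_wpDl // normc_ge0.
apply/nbhs_ballP; exists (e / (normc (b ord0 k) + 1)); first exact: divr_gt0.
move=> t; rewrite /ball /= ltr_pdivlMr // => st.
rewrite (cspace_aff_dist a b (t%:C%C) (s%:C%C)).
apply: le_lt_trans st; rewrite ler_pM ?normc_ge0 ?lerDl //.
by rewrite normc_realB distrC.
Qed.

(** Each point is joined to [0] by shrinking its second coordinate to 0 and then moving inside the
    line where that coordinate vanishes, which lies in the domain. *)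
Lemma hartogs_connected : connected (hartogs g).
Proof.
pose I01 : set R := [set` `[0, 1]].
pose A (p : C2) :=
  (fun t : R => cpair (p ord0 ord0) 0 + (t%:C%C : C) *: cpair 0 (p ord0 ord_max)) @` I01.
pose B (p : C2) := (fun t : R => 0 + (t%:C%C : C) *: cpair (p ord0 ord0) 0) @` I01.
have cA p : connected (A p).
  apply: connected_continuous_connected; first exact: segment_connected.
  by apply: continuous_subspaceT; exact: segment_continuous.
have cB p : connected (B p).
  apply: connected_continuous_connected; first exact: segment_connected.
  by apply: continuous_subspaceT; exact: segment_continuous.
have in0 : I01 0 by rewrite /I01 /= in_itv /= lexx ler01.
have in1 : I01 1 by rewrite /I01 /= in_itv /= lexx ler01.
have -> : hartogs g = \bigcup_(p in hartogs g) (A p `|` B p).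
  apply/seteqP; split=> p.
    move=> Hp; exists p => //; left; exists 1 => //.
    rewrite -[RHS]cpair_eta; apply/rowP => k.
    rewrite cspace_affE mul1r; have [->|->] := ord2P k.
      by rewrite !cpair0 addr0.
    by rewrite !cpair1 add0r.
  move=> [q Hq [[t]|[t]]]; rewrite /I01 /= in_itv /= => /andP[t0 t1] <-; rewrite /hartogs /=.
    rewrite !cspace_affE !cpair0 !cpair1 mulr0 addr0 add0r normc_mul normc_real ger0_norm //.
    apply: le_lt_trans Hq; rewrite -[leRHS]mul1r ler_pM ?normc_ge0 //.
  by rewrite !cspace_affE !cpair0 !cpair1 mulr0 mxE addr0 normc_zero expR_gt0.
apply: bigcup_connected.
  exists 0 => p _; right; exists 0 => //.
  by apply/rowP => k; rewrite cspace_affE mul0r addr0.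
move=> p _; apply: (connectedU _ (cA p) (cB p)).
exists (cpair (p ord0 ord0) 0); split.
  by exists 0 => //; apply/rowP => k; rewrite cspace_affE mul0r addr0.
by exists 1 => //; apply/rowP => k; rewrite cspace_affE mul1r mxE add0r.
Qed.

Lemma hartogs_domain : domain (hartogs g).
Proof.
split; [exact: hartogs_open|exact: hartogs_connected|].
by exists 0; rewrite /hartogs /= !mxE normc_zero expR_gt0.
Qed.

Lemma boundary_hartogs (p : C2) :
  boundary (hartogs g) p <-> normc (p ord0 ord_max) = expR (g (p ord0 ord0)).
Proof.
rewrite /boundary (interior_id (hartogs g)).1; last exact: hartogs_open.
split=> [[clp np]|pE].
  apply/eqP; rewrite eq_le; apply/andP; split; last by rewrite leNgt; exact/negP.
  have cl : closed ((fun p : C2 => expR (g (p ord0 ord0)) -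
      normc (p ord0 ord_max)) @^-1` [set x | 0 <= x]).
    by apply: closed_comp; [move=> q _; exact: hartogs_gap_continuous|exact: closed_ge].
  rewrite -subr_ge0; apply: cl; move: clp; apply: closureS => q /=.
  by rewrite /hartogs /= subr_ge0 => /ltW.
split; last by rewrite /hartogs /= pE ltxx.
move=> U /nbhs_cspaceP[e e0 eU].
have w0 : 0 < normc (p ord0 ord_max) by rewrite pE expR_gt0.
(* Scaling the second coordinate by [1 - d] enters the domain; this [d] keeps the factor nonnegative
   and the displacement below [e]. *)
pose d := Num.min 1 (e / (2 * normc (p ord0 ord_max))).
have d0 : 0 < d by rewrite lt_min ltr01 divr_gt0 // mulr_gt0.
have d1 : d <= 1 by rewrite ge_min lexx.
have de : d * normc (p ord0 ord_max) < e.
  apply: le_lt_trans (_ : e / 2 < e); last by rewrite ltr_pdivrMr // ltr_pMr // ltr1n.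
  rewrite -ler_pdivlMr // -mulrA -invfM mulrC; rewrite /d ge_min; apply/orP; right.
  by rewrite mulrC.
exists (cpair (p ord0 ord0) ((1 - d)%:C%C * p ord0 ord_max)); split.
  rewrite /hartogs /= cpair0 cpair1 -pE normc_mul normc_real ger0_norm ?subr_ge0 //.
  by rewrite gtr_pMl // ltrBlDr ltrDl.
apply: eU => k; have [->|->] := ord2P k.
  by rewrite cpair0 subrr normc_zero.
rewrite cpair1 -{2}[p ord0 ord_max]mul1r -mulrBl normc_mul normc_realB.
by rewrite addrAC subrr add0r normrN ger0_norm // ltW.
Qed.

(* The discs [{|z - z0| <= rho} x {w}], [0 <= w < 1], lie in the domain and have
   boundary circles in the fixed compact [S], whereas their centres tend to the
   boundary point [(z0, 1)]. *)
Lemma hartogs_not_pseudoconvex (z0 : C) (rho : R) :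
  (forall z, 0 <= g z) -> 0 < rho -> g z0 = 0 ->
  (forall z, normc (z - z0) = rho -> 0 < g z) ->
  ~ pseudoconvex (hartogs g).
Proof.
move=> g0 rho0 gz0 grho [phi [cphi sub] cpt].
pose S := [set p : C2 | normc (p ord0 ord0 - z0) = rho /\ normc (p ord0 ord_max) <= 1].
have SO : S `<=` hartogs g.
  move=> p [h1 h2]; apply: le_lt_trans h2 _.
  by rewrite -expR0 ltr_expR grho.
have csub : continuous (fun p : C2 => normc (p ord0 ord0 - z0)).
  move=> p; apply: (continuous_comp (f := fun p : C2 => p ord0 ord0 : C)
    (g := fun z : C => normc (z - z0))); first exact: cspace_coord_continuous.
  apply: lipschitz_cplx_continuous => z w; apply: le_trans (normc_dist _ _) _.
  by rewrite opprB addrA subrK.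
have cS : compact S.
  apply: (subclosed_compact _ (@cspace_box_compact R 2 (normc z0 + rho + 1))).
    rewrite (_ : S = (fun p : C2 => normc (p ord0 ord0 - z0)) @^-1` [set x | x = rho]
      `&` (fun p : C2 => normc (p ord0 ord_max)) @^-1` [set x | x <= 1]) //.
    apply: closedI; apply: closed_comp.
    - by move=> p _; exact: csub.
    - exact: closed_eq.
    - by move=> p _; exact: normc_coord_continuous.
    - exact: closed_le.
  move=> p [h1 h2] k; have [->|->] := ord2P k.
    rewrite -[p ord0 ord0](subrK z0) (le_trans (normcD _ _)) // h1.
    by rewrite addrC lerDl.
  by rewrite (le_trans h2) // lerDr addr_ge0 ?normc_ge0 // ltW.
have [M SM] : exists M, forall p, S p -> phi p <= M.
  have := continuous_compact (continuous_subspaceW SO cphi) cS.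
  move=> /compact_bounded[N [_ HN]]; exists (N + 1) => p Sp.
  apply: le_trans (ler_norm _) _; apply: HN; first by rewrite ltrDl.
  by exists p.
pose L := [set p | hartogs g p /\ phi p <= M] `&`
  (fun p : C2 => normc (p ord0 ord0 - z0)) @^-1` [set x | x <= 0].
have cL : compact L.
  rewrite /L; apply: compact_closedI; first exact: cpt.
  by apply: closed_comp; [move=> p _; exact: csub|exact: closed_le].
have inL (s : R) : 0 <= s -> s < 1 -> L (cpair z0 s%:C%C).
  move=> s0 s1; split; last by rewrite /= cpair0 subrr normc_zero.
  have ok (z : C) : hartogs g (cpair z s%:C%C).
    rewrite /hartogs /= cpair0 cpair1 normc_real ger0_norm //.
    by apply: lt_le_trans s1 _; rewrite -expR0 ler_expR.
  split=> //.
  have aff (t : C) : cpair z0 s%:C%C + t *: cpair rho%:C%C 0 =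
      cpair (z0 + t * rho%:C%C) s%:C%C.
    apply/rowP => k; rewrite cspace_affE; have [->|->] := ord2P k.
      by rewrite !cpair0.
    by rewrite !cpair1 mulr0 addr0.
  apply: le_trans (sub _ (cpair rho%:C%C 0) _) _.
    by move=> t _; rewrite aff.
  rewrite -[leRHS](circle_mean_cst M); apply: le_circle_mean.
  - move=> t; have cphi' : {in hartogs g, continuous phi}.
      by rewrite -continuous_open_subspace //; exact: hartogs_open.
    apply: (continuous_comp (f := fun t : R => _) (g := phi)).
      exact: circle_continuous.
    by apply: cphi'; rewrite inE aff; exact: ok.
  - exact: cst_continuous.
  move=> t; apply: SM; rewrite aff; split.
    by rewrite cpair0 addrAC subrr add0r normc_mul normc_expi mul1r normc_real ger0_norm // ltW.
  by rewrite cpair1 normc_real ger0_norm // ltW.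
(* The moduli of the second coordinate on [L] form a compact set containing [0, 1), hence also 1,
   whereas the fibre of the domain over [z0] is the open unit disc. *)
have cimg : compact ((fun p : C2 => normc (p ord0 ord_max)) @` L).
  apply: continuous_compact => //; apply: continuous_subspaceT.
  exact: normc_coord_continuous.
have [p Lp p1] : ((fun p : C2 => normc (p ord0 ord_max)) @` L) 1.
  apply: (compact_closed (@norm_hausdorff _ R^o) cimg).
  move=> U /nbhs_ballP[e /= e0 eU].
  pose s := Num.max 0 (1 - e / 2).
  have e2 : 0 < e / 2 by rewrite divr_gt0.
  have s0 : 0 <= s by rewrite le_max lexx.
  have s1 : s < 1 by rewrite gt_max ltr01 ltrBlDr ltrDl.
  exists s; split.
    exists (cpair z0 s%:C%C); first exact: inL.
    by rewrite /= cpair1 normc_real ger0_norm.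
  apply: eU; rewrite /ball /= ger0_norm ?subr_ge0; last exact: ltW.
  have : 1 - e / 2 <= s by rewrite le_max lexx orbT.
  by move: e0; lra.
have [[Op _] /= h] := Lp.
have h0 : p ord0 ord0 = z0.
  apply/eqP; rewrite -subr_eq0 -normc_eq0 eq_le h normc_ge0 //.
by move: Op; rewrite /hartogs /= p1 h0 gz0 expR0 ltxx.
Qed.

End Fixed_g.
End Hartogs.

(** * Upper bounds for Hausdorff measure *)

Section HausdorffBound.
Context {R : realType}.
Local Notation C := R[i]^o.
Local Notation C2 := (Cspace R 2).

Lemma diam_ge0 (A : set C2) : (0 <= diam A)%E.
Proof. by rewrite /diam le_max lexx. Qed.

Lemma diam_set0 : diam (set0 : set C2) = 0%E.
Proof.
rewrite /diam (_ : [set _ | _ in _ & _ in _] = set0) ?ereal_sup0 ?max_l ?leNye //.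
by apply/seteqP; split=> x // -[].
Qed.

Definition polydisc (c : C2) (r : R) : set C2 :=
  [set q | forall k, normc (q ord0 k - c ord0 k) <= r].

Lemma diam_polydisc (c : C2) (r : R) : 0 <= r ->
  (diam (polydisc c r) <= (4 * r)%:E)%E.
Proof.
move=> r0; rewrite /diam ge_max; apply/andP; split; first by rewrite lee_fin mulr_ge0.
apply: ge_ereal_sup => _ [x xc [y yc <-]]; rewrite lee_fin.
apply: le_trans (cenorm_le_coords _) _.
have H k : normc ((x - y) ord0 k) <= 2 * r.
  rewrite mxE [X in _ + X]mxE -(subrKA (c ord0 k)) mulr_natl mulr2n.
  apply: le_trans (normcD _ _) _; rewrite lerD ?xc //.
  by rewrite normcBC yc.
by rewrite (_ : 4 * r = 2 * r + 2 * r) ?lerD //; ring.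
Qed.

(** Finite covers by polydiscs of one common radius suffice. They are padded with empty sets, whose
    terms vanish because [0 < s]; the diameter bound [4 * r] costs the factor 4^s. *)
Lemma hausdorff_lty (s K : R) (A : set C2) : 0 < s ->
  (forall d : R, 0 < d -> exists (r : R) (l : seq C2),
     [/\ 0 < r <= d, (size l)%:R * r `^ s <= K &
         forall q, A q -> exists2 c, c \in l & polydisc c r q]) ->
  (hausdorff s A < +oo)%E.
Proof.
move=> s0 H; apply: (@le_lt_trans _ _ (K * 4 `^ s)%:E); last exact: ltry.
apply: ge_ereal_sup => _ [d d0 <-].
have d40 : 0 < d / 4 by rewrite divr_gt0.
have [r [l [/andP[r0 rd] lK cov]]] := H _ d40.
pose U (k : nat) := if (k < size l)%N then polydisc (nth 0 l k) r else set0.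
have Ud k : (diam (U k) <= (4 * r)%:E)%E.
  rewrite /U; case: ifP => _; first by apply: diam_polydisc; exact: ltW.
  by rewrite diam_set0 lee_fin mulr_ge0 // ltW.
apply: (@le_trans _ _ (\sum_(0 <= k <oo) diam (U k) `^ s)%E).
  apply: ereal_inf_lbound; exists U => //; split.
    move=> q /cov[c cl qc]; exists (index c l) => //.
    by rewrite /U index_mem cl nth_index.
  move=> k; apply: le_trans (Ud k) _; rewrite lee_fin.
  by rewrite mulrC -ler_pdivlMr.
apply: lime_le; first by apply: is_cvg_nneseries => n _ _; exact: poweR_ge0.
apply: nearW => n.
have pw : (4 * r) `^ s = 4 `^ s * r `^ s by rewrite powRM // ltW.
suff : (\sum_(0 <= k < n) diam (U k) `^ s <= ((minn n (size l))%:R * (4 * r) `^ s)%:E)%E.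
  move=> /le_trans; apply; rewrite lee_fin pw mulrCA [leRHS]mulrC.
  rewrite ler_wpM2l ?powR_ge0 //; apply: le_trans lK.
  by rewrite ler_wpM2r ?powR_ge0 // ler_nat geq_minr.
elim: n => [|n IH]; first by rewrite big_nil min0n mul0r.
rewrite big_nat_recr //=; apply: le_trans (leeD IH (lexx _)) _.
have [nl|ln] := ltnP n (size l).
  rewrite (minn_idPl nl) -[n.+1%:R]natr1 (mulrDl _ 1 ((4 * r) `^ s)) mul1r EFinD leeD //.
  rewrite -poweR_EFin; apply: gt0_ler_poweR.
  - exact: ltW.
  - by rewrite in_itv /= diam_ge0 leey.
  - by rewrite in_itv /= leey lee_fin mulr_ge0 // ltW.
  - exact: Ud.
rewrite (minn_idPr (leqW ln)) /U ltnNge ln /= diam_set0.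
by rewrite poweR0r ?gt_eqF // adde0.
Qed.

Lemma unit_expi (u : C) : normc u = 1 -> exists2 t : R, `|t| <= pi & u = expi t.
Proof.
move=> u1; have := congr1 (fun x => x ^+ 2) u1; rewrite sqr_normcE expr1n => xy.
case: u xy u1 => x y /= xy _.
have x1 : -1 <= x <= 1.
  by have h := sqr_ge0 y; apply/andP; split; nra.
have sE : sin (acos x) = `|y|.
  rewrite sin_acos // (_ : 1 - x ^+ 2 = y ^+ 2) ?sqrtr_sqr //.
  by rewrite -xy addrAC subrr add0r.
have cE : cos (acos x) = x by rewrite acosK.
have aP : 0 <= acos x <= pi by rewrite acos_ge0 // acos_lepi.
have [y0|y0] := leP 0 y.
  exists (acos x); first by case/andP: aP => ? ?; rewrite ger0_norm.
  by rewrite /expi cE sE ger0_norm.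
exists (- acos x); first by case/andP: aP => ? ?; rewrite normrN ger0_norm.
by rewrite /expi cosN sinN cE sE ltr0_norm // opprK.
Qed.

(** Arguments in steps of [e / 2] over [-4, 4], which contains [-pi, pi], give at most [16 / e + 1]
    points, and [e <= 1] turns this into [17 / e]. The step fits the Lipschitz constant 2 of
    [expi]. *)
Lemma circle_cover (e : R) : 0 < e <= 1 -> exists l : seq C,
  (size l)%:R * e <= 17 /\
  forall u : C, normc u = 1 -> exists w, [/\ w \in l, normc w = 1 & normc (u - w) <= e].
Proof.
move=> /andP[e0 e1]; pose n := Num.truncn (16 / e).
pose f (j : nat) : C := expi (j%:R * (e / 2) - 4).
have e20 : 0 < e / 2 by rewrite divr_gt0.
have n0 : 0 <= 16 / e by rewrite divr_ge0 // ltW.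
exists [seq f j | j <- iota 0 n.+1]; split.
  rewrite size_map size_iota -natr1 mulrDl mul1r.
  have : n%:R * e <= 16 by rewrite -ler_pdivlMr // truncn_le.
  by lra.
move=> u /unit_expi[t tpi ->]; have t4 : -4 <= t <= 4.
  rewrite -ler_norml (le_trans tpi) //; have := @pihalf_lt2 R; rewrite ltr_pdivrMr // => /ltW; lra.
case/andP: t4 => t4 t4'.
have q0 : 0 <= (t + 4) / (e / 2) by rewrite divr_ge0 ?(ltW e20) //; lra.
pose j := Num.truncn ((t + 4) / (e / 2)).
have /andP[j1 j2] := truncn_itv q0; rewrite -/j in j1 j2.
exists (f j); split; last 1 first.
- apply: le_trans (expi_lipschitz _ _) _.
  rewrite ler_pdivlMr // in j1; rewrite ltr_pdivrMr // in j2.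
  have j3 : j.+1%:R = j%:R + 1 :> R by rewrite natr1.
  rewrite j3 mulrDl mul1r in j2.
  rewrite mulrC -ler_pdivlMr // ler_norml; apply/andP; split; lra.
- rewrite map_f // mem_iota /= add0n ltnS; apply: le_truncn.
  rewrite ler_pdivrMr // (_ : 16 / e * (e / 2) = 8); first lra.
  by field; rewrite gt_eqF.
- exact: normc_expi.
Qed.

(** Each disc of the cover of [E] is multiplied by an [r]-net of the fibre circle with about
    [17 / r] points, which raises the exponent by 1. The cover records an approximate fibre radius
    too: Hoelder continuity of [g] with exponent below 1 would not determine that radius to within
    [r]. *)
Lemma hausdorff_graph_lty (alpha B K : R) (g : C -> R) (E : set C) :
  0 < alpha -> (forall z, E z -> expR (g z) <= B) ->
  (forall d : R, 0 < d -> exists (r : R) (l : seq (C * R)),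
     [/\ 0 < r <= d, (size l)%:R * r `^ alpha <= K &
         forall z, E z -> exists2 c, c \in l &
           normc (z - c.1) <= r /\ `|expR (g z) - c.2| <= r]) ->
  (hausdorff (1 + alpha)
    [set p : C2 | E (p ord0 ord0) /\ normc (p ord0 ord_max) = expR (g (p ord0 ord0))]
     < +oo)%E.
Proof.
move=> a0 EB H; have [[z0 Ez0]|nE] := pselect (exists z, E z); last first.
  apply: (@hausdorff_lty _ 0); first by rewrite addr_gt0.
  move=> d d0; exists d, [::]; split; rewrite ?d0 ?lexx ?mul0r //.
  by move=> q [Eq _]; case: nE; exists (q ord0 ord0).
have B0 : 0 <= B by apply: le_trans (EB _ Ez0); exact: expR_ge0.
have B1 : 0 < 1 + B by rewrite ltr_wpDr.
apply: (@hausdorff_lty _ ((1 + B) `^ (1 + alpha) * (K * 17))); first by rewrite addr_gt0.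
move=> d d0; pose d' := Num.min 1 (d / (1 + B)).
have d'0 : 0 < d' by rewrite lt_min ltr01 divr_gt0.
have [r [l [/andP[r0 rd'] lK cov]]] := H _ d'0.
have r1 : r <= 1 by apply: le_trans rd' _; rewrite ge_min lexx.
have rd : r <= d / (1 + B) by apply: le_trans rd' _; rewrite ge_min lexx orbT.
have [lc [lc17 ccov]] := @circle_cover r (introT andP (conj r0 r1)).
exists ((1 + B) * r), [seq cpair c.1 (c.2%:C%C * w) | c <- l, w <- lc]; split.
- by rewrite mulr_gt0 //= mulrC -ler_pdivlMr.
- rewrite size_allpairs powRM ?(ltW r0) ?(ltW B1) // natrM mulrCA ler_wpM2l ?powR_ge0 //.
  rewrite powRD ?gt_eqF ?addr_gt0 // powRr1 ?(ltW r0) //.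
  rewrite [leLHS](_ : _ = ((size l)%:R * r `^ alpha) * ((size lc)%:R * r)); last by ring.
  by rewrite ler_pM // mulr_ge0 // ?powR_ge0 // ltW.
move=> q [Eq qE]; have [c cl [cz cr]] := cov _ Eq.
set w := q ord0 ord_max in qE.
have w0 : 0 < normc w by rewrite qE expR_gt0.
pose u : C := (normc w)^-1%:C%C * w.
have u1 : normc u = 1.
  by rewrite normc_mul normc_real ger0_norm ?invr_ge0 ?normc_ge0 // mulVf // gt_eqF.
have wu : w = (normc w)%:C%C * u.
  rewrite /u mulrA -rmorphM mulfV ?gt_eqF // rmorph1 mul1r //.
have [w' [w'lc w'1 uw']] := ccov _ u1.
exists (cpair c.1 (c.2%:C%C * w')); first by apply/allpairsP; exists (c, w').
have rB : r <= (1 + B) * r by rewrite mulrDl mul1r lerDl mulr_ge0 // ltW.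
move=> k; have [->|->] := ord2P k.
  by rewrite cpair0; exact: le_trans cz rB.
rewrite cpair1 -/w wu.
(* Error in the argument plus error in the fibre radius: at most [B * r] and [r], whence the radius
   [(1 + B) * r]. *)
rewrite [X in normc X](_ : _ = (normc w)%:C%C * (u - w') +
  ((normc w)%:C%C - c.2%:C%C) * w'); last by ring.
apply: le_trans (normcD _ _) _.
rewrite !normc_mul normc_realB w'1 mulr1 normc_real ger0_norm ?normc_ge0 //.
rewrite mulrDl mul1r addrC lerD //; first by rewrite qE.
by rewrite ler_pM ?normc_ge0 // qE; exact: EB.
Qed.

End HausdorffBound.

(** * Local pseudoconvexity over the superharmonic set *)

Section LocalPseudoconvexity.
Context {R : realType}.
Local Notation C := R[i]^o.
Local Notation C2 := (Cspace R 2).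

(** Jensen's inequality for the convex increasing function 1 / (c - x): [L] is its tangent at [x0],
    with slope [k], and the mean of [X] enters only through [L]. *)
Lemma circle_mean_inv (c x0 : R) (X : R -> R) : continuous X ->
  (forall t, X t < c) -> x0 < c -> x0 <= circle_mean X ->
  (c - x0)^-1 <= circle_mean (fun t => (c - X t)^-1).
Proof.
move=> cX Xc x0c x0X.
have d0 : 0 < c - x0 by rewrite subr_gt0.
pose k := (c - x0) ^- 2.
have k0 : 0 < k by rewrite invr_gt0 exprn_gt0.
have cinv : continuous (fun t => (c - X t)^-1).
  move=> t; apply: cvgV; first by rewrite gt_eqF // subr_gt0.
  by apply: cvgB; [exact: cvg_cst|exact: cX].
have ckX : continuous (fun t => k * X t).
  by move=> t; apply: cvgM; [exact: cvg_cst|exact: cX].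
pose L t := ((c - x0)^-1 - k * x0) + k * X t.
have cL : continuous L.
  by move=> t; apply: cvgD; [exact: cvg_cst|exact: ckX].
apply: le_trans (_ : circle_mean L <= _).
  rewrite /L circle_meanD ?circle_mean_cst ?circle_meanZ //; last exact: cst_continuous.
  by rewrite -addrA lerDl addrC subr_ge0 ler_pM2l.
apply: le_circle_mean => // t; rewrite /L.
have dt : 0 < c - X t by rewrite subr_gt0.
rewrite -subr_ge0.
rewrite (_ : _ - _ = (X t - x0) ^+ 2 * ((c - X t)^-1 * k)).
  by rewrite mulr_ge0 ?sqr_ge0 // mulr_ge0 // ltW // invr_gt0.
by rewrite /k; field; rewrite !gt_eqF.
Qed.

Lemma normc_parallelogram (u v : C) :
  normc (u + v) ^+ 2 + normc (u - v) ^+ 2 = 2 * normc u ^+ 2 + 2 * normc v ^+ 2.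
Proof. by rewrite !sqr_normcE; case: u => a b; case: v => x y /=; ring. Qed.

Lemma sqr_cenorm_midpoint (a b zeta : C2) (u : C) :
  2 * cenorm (a - zeta) ^+ 2 <=
  cenorm (a + u *: b - zeta) ^+ 2 + cenorm (a + (- u) *: b - zeta) ^+ 2.
Proof.
have coordS (p : C2) k : (p - zeta) ord0 k = p ord0 k - zeta ord0 k.
  by rewrite mxE; congr (_ + _); rewrite mxE.
have S (v : C) k : (a + v *: b - zeta) ord0 k =
    (a ord0 k - zeta ord0 k) + v * b ord0 k.
  by rewrite coordS cspace_affE addrAC.
rewrite !sqr_cenorm2 !S !coordS !mulNr addrACA !normc_parallelogram mulrDr.
by rewrite lerD // lerDl mulr_ge0 // sqr_ge0.
Qed.

Lemma sqr_cenorm_sub_continuous (zeta : C2) :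
  continuous (fun p : C2 => cenorm (p - zeta) ^+ 2).
Proof.
have ck k : continuous (fun p : C2 => normc (p ord0 k - zeta ord0 k) ^+ 2).
  move=> p.
  apply: (continuous_comp (f := fun p : C2 => normc (p ord0 k - zeta ord0 k))
    (g := fun x : R => x ^+ 2)); last exact: exprn_continuous.
  apply: (continuous_comp (f := fun p : C2 => p ord0 k : C)
    (g := fun z : C => normc (z - zeta ord0 k))); first exact: cspace_coord_continuous.
  apply: lipschitz_cplx_continuous => z w; apply: le_trans (normc_dist _ _) _.
  by rewrite opprB addrA subrK.
rewrite (_ : (fun p : C2 => _) = (fun p : C2 => normc (p ord0 ord0 - zeta ord0 ord0) ^+ 2
    + normc (p ord0 ord_max - zeta ord0 ord_max) ^+ 2)); last first.
  apply/funext => p; rewrite sqr_cenorm2.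
  by congr (normc _ ^+ 2 + normc _ ^+ 2); rewrite mxE; congr (_ + _); rewrite mxE.
by move=> p; have h0 := @ck ord0 p; have h1 := @ck ord_max p; exact: (cvgD h0 h1).
Qed.

(** Discs are parametrised as in [continuous_psh], so that the first coordinate of an affine disc of
    C^2, possibly constant, is again one of them. *)
Definition superharmonic_near (g : C -> R) (z0 : C) := exists2 r : R, 0 < r &
  forall a b : C, (forall t : C, normc t <= 1 -> normc (a + t * b - z0) < r) ->
  circle_mean (fun t => g (a + expi t * b)) <= g a.

(** In a ball that avoids w = 0 the domain is defined by [Y < 0] with Y = log |w| - g, which is
    plurisubharmonic because log |w| is pluriharmonic and -g is subharmonic. By [circle_mean_inv]
    both 1 / (-Y) and 1 / (r^2 - |p - zeta|^2) are plurisubharmonic; their maximum blows up at both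
    kinds of boundary points. The radius is at most the modulus of the second coordinate of [zeta]
    to stay off w = 0. *)
Lemma hartogs_locally_pseudoconvex (g : C -> R) (zeta : C2) : continuous g ->
  normc (zeta ord0 ord_max) = expR (g (zeta ord0 ord0)) ->
  superharmonic_near g (zeta ord0 ord0) ->
  locally_pseudoconvex_at (hartogs g) zeta.
Proof.
move=> cg zetaE [r0 r00 sup].
have w0 : 0 < normc (zeta ord0 ord_max) by rewrite zetaE expR_gt0.
pose r := Num.min r0 (normc (zeta ord0 ord_max)).
have rP : 0 < r by rewrite lt_min r00.
have rr0 : r <= r0 by rewrite ge_min lexx.
have rw : r <= normc (zeta ord0 ord_max) by rewrite ge_min lexx orbT.
have ballP (p : C2) : eball zeta r p <-> cenorm (p - zeta) ^+ 2 < r ^+ 2.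
  by rewrite /eball /= ltr_pXn2r // nnegrE ?cenorm_ge0 // ltW.
have coordS (p : C2) k : (p - zeta) ord0 k = p ord0 k - zeta ord0 k.
  by rewrite mxE; congr (_ + _); rewrite mxE.
have ball_k (p : C2) k : eball zeta r p -> normc (p ord0 k - zeta ord0 k) < r.
  by rewrite -coordS; apply: le_lt_trans; exact: normc_coord_le.
have nz (p : C2) : eball zeta r p -> 0 < normc (p ord0 ord_max).
  move=> /(ball_k _ ord_max)/lt_le_trans/(_ rw); rewrite normcBC => h.
  have := normcD (zeta ord0 ord_max - p ord0 ord_max) (p ord0 ord_max).
  by rewrite subrK; move: h; lra.
have oball : open (eball zeta r).
  rewrite (_ : eball zeta r = (fun p : C2 => cenorm (p - zeta) ^+ 2) @^-1` [set x | x < r ^+ 2]).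
    apply: open_comp; last exact: open_lt.
    by move=> p _; exact: sqr_cenorm_sub_continuous.
  by apply/seteqP; split => p /ballP.
pose X (p : C2) := cenorm (p - zeta) ^+ 2.
pose Y (p : C2) := ln (normc (p ord0 ord_max)) - g (p ord0 ord0).
have YP (p : C2) : eball zeta r p -> (hartogs g p <-> Y p < 0).
  move=> bp; rewrite subr_lt0 -ltr_expR lnK // posrE; exact: nz.
have cX : continuous X by exact: sqr_cenorm_sub_continuous.
have cY (p : C2) : eball zeta r p -> Y x @[x --> p] --> Y p.
  move=> bp.
  have h0 : ln (normc (q ord0 ord_max)) @[q --> p] --> ln (normc (p ord0 ord_max)).
    apply: (continuous_comp (f := fun p : C2 => normc (p ord0 ord_max)) (g := @ln R)).
      exact: normc_coord_continuous.
    by apply: continuous_ln; exact: nz.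
  have h1 : g (q ord0 ord0) @[q --> p] --> g (p ord0 ord0).
    apply: (continuous_comp (f := fun p : C2 => p ord0 ord0 : C)); last exact: cg.
    exact: cspace_coord_continuous.
  exact: (cvgB h0 h1).
pose D := eball zeta r `&` hartogs g.
have oD : open D by apply: openI => //; exact: hartogs_open.
pose phi (p : C2) := Num.max (r ^+ 2 - X p)^-1 (0 - Y p)^-1.
have cphi : {in D, continuous phi}.
  move=> p; rewrite inE => -[bp hp].
  have h1 : (r ^+ 2 - X q)^-1 @[q --> p] --> (r ^+ 2 - X p)^-1.
    apply: (cvgV (FF := nbhs_filter p)); first by rewrite gt_eqF // subr_gt0; exact/ballP.
    by have h := @cX p; exact: (cvgB (cvg_cst (r ^+ 2)) h).
  have h2 : (0 - Y q)^-1 @[q --> p] --> (0 - Y p)^-1.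
    apply: (cvgV (FF := nbhs_filter p)); first by rewrite gt_eqF // subr_gt0; exact/YP.
    by have h := cY p bp; exact: (cvgB (cvg_cst 0) h).
  exact: (continuous_max (f := fun q => (r ^+ 2 - X q)^-1) (g := fun q => (0 - Y q)^-1) h1 h2).
exists r => //; exists phi.
  split; first by rewrite continuous_open_subspace.
  move=> a b ab; rewrite -/(circle_mean (fun t => phi (a + expi t *: b))).
  have Da : D a by rewrite -[a]addr0 -(scale0r b); apply: ab; rewrite normc_zero.
  have De (t : R) : D (a + expi t *: b) by apply: ab; rewrite normc_expi.
  have cb t : (a + expi s *: b) @[s --> t] --> (a + expi t *: b).
    exact: circle_continuous.
  have cphit : continuous (fun t : R => phi (a + expi t *: b)).
    move=> t; apply: (continuous_comp (f := fun t : R => a + expi t *: b) (g := phi)).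
      exact: cb.
    by apply: cphi; rewrite inE.
  have cXt : continuous (fun t : R => X (a + expi t *: b)).
    move=> t; apply: (continuous_comp (f := fun t : R => a + expi t *: b) (g := X)).
      exact: cb.
    exact: cX.
  have cYt : continuous (fun t : R => Y (a + expi t *: b)).
    move=> t; apply: (continuous_comp (f := fun t : R => a + expi t *: b) (g := Y)).
      exact: cb.
    by apply: cY; case: (De t).
  have X1 t : X (a + expi t *: b) < r ^+ 2 by case: (De t) => /ballP.
  have Y1 t : Y (a + expi t *: b) < 0 by case: (De t) => bt /(YP _ bt).
  have X0 : X a < r ^+ 2 by case: Da => /ballP.
  have Y0 : Y a < 0 by case: Da => ba /(YP _ ba).
  have XM : X a <= circle_mean (fun t : R => X (a + expi t *: b)).
    apply: circle_mean_ge_midpoint; first exact: cXt.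
    by move=> t; rewrite /X (expiDpi t); exact: sqr_cenorm_midpoint.
  have YM : Y a <= circle_mean (fun t : R => Y (a + expi t *: b)).
    (* Otherwise the second coordinate would vanish at a parameter of modulus at most 1, that is at
       a point of the ball. With the strict inequality log |w| has the mean value property on the
       disc. *)
    have ba1 : normc (b ord0 ord_max) < normc (a ord0 ord_max).
      rewrite ltNge; apply/negP => le.
      have b0 : b ord0 ord_max != 0.
        rewrite -normc_gt0; apply: lt_le_trans le; by case: Da => /nz.
      pose t := - (a ord0 ord_max / b ord0 ord_max).
      have t1 : normc t <= 1.
        by rewrite normc_opp normc_mul ComplexField.Normc.normcV ler_pdivrMr ?mul1r // normc_gt0.
      have [/nz + _] := ab t t1; rewrite cspace_affE mulNr divfK // subrr normc_zero.
      by rewrite ltxx.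
    have c1 : continuous (fun t : R => ln (normc (a ord0 ord_max + expi t * b ord0 ord_max))).
      exact: ln_circle_continuous.
    have c2 : continuous (fun t : R => g (a ord0 ord0 + expi t * b ord0 ord0)).
      move=> t.
      apply: (continuous_comp (f := fun t : R => (a ord0 ord0 + expi t * b ord0 ord0 : C))).
        exact: cplx_circle_continuous.
      exact: cg.
    rewrite (_ : (fun t : R => _) = (fun t => ln (normc (a ord0 ord_max + expi t * b ord0 ord_max))
        + (-1) * g (a ord0 ord0 + expi t * b ord0 ord0))); last first.
      by apply/funext => t; rewrite /Y !cspace_affE mulN1r.
    rewrite circle_meanD //; last first.
      by move=> t; apply: cvgM; [exact: cvg_cst|exact: c2].
    rewrite circle_meanZ // circle_mean_ln_normc // mulN1r lerD2l lerN2.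
    apply: sup => t t1; rewrite -cspace_affE; apply: lt_le_trans rr0.
    by apply: ball_k; case: (ab t t1).
  rewrite {1}/phi ge_max; apply/andP; split.
    apply: le_trans (circle_mean_inv cXt X1 X0 XM) _.
    apply: le_circle_mean => //.
      move=> t; apply: cvgV; first by rewrite gt_eqF // subr_gt0.
      by apply: cvgB; [exact: cvg_cst|exact: cXt].
    by move=> t; rewrite /phi le_max lexx.
  apply: le_trans (circle_mean_inv cYt Y1 Y0 YM) _.
  apply: le_circle_mean => //.
    move=> t; apply: cvgV; first by rewrite gt_eqF // subr_gt0.
    by apply: cvgB; [exact: cvg_cst|exact: cYt].
  by move=> t; rewrite /phi le_max lexx orbT.
move=> c; have [c0|c0] := leP c 0.
  rewrite (_ : [set _ | _] = set0); first exact: compact0.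
  apply/seteqP; split => // p [[/ballP bp _]].
  rewrite /phi ge_max => /andP[h _].
  have : 0 < (r ^+ 2 - X p)^-1 by rewrite invr_gt0 subr_gt0.
  by rewrite ltNge (le_trans h).
(* The sublevel set is described by inequalities between functions continuous on all of C^2, without
   [ln], hence it is closed there and not merely relatively closed in the domain. *)
have -> : [set p : C2 | (eball zeta r `&` hartogs g) p /\ phi p <= c] =
    X @^-1` [set x | x <= r ^+ 2 - c^-1] `&`
    (fun p : C2 => expR (g (p ord0 ord0)) - normc (p ord0 ord_max) * expR c^-1) @^-1`
      [set x | 0 <= x].
  have ic0 : 0 < c^-1 by rewrite invr_gt0.
  have key (p : C2) : eball zeta r p ->
      (Y p <= - c^-1) = (normc (p ord0 ord_max) * expR c^-1 <= expR (g (p ord0 ord0))).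
    move=> bp; rewrite lerBlDr -ler_expR lnK ?posrE ?nz // addrC expRB -expRN.
    by rewrite -ler_pdivlMr ?expR_gt0 // -expRN.
  apply/seteqP; split => p.
    move=> [[bp hp]]; rewrite /phi ge_max => /andP[h1 h2].
    have Xp : 0 < r ^+ 2 - X p by rewrite subr_gt0; exact/ballP.
    have Yp : 0 < 0 - Y p by rewrite subr_gt0; exact/YP.
    split=> /=.
      by rewrite lerBrDr addrC -lerBrDr -[leRHS]invrK lef_pV2 // posrE ?invr_gt0.
    rewrite subr_ge0 -key //.
    by rewrite lerNr -[leRHS]sub0r -[leRHS]invrK lef_pV2 // posrE ?invr_gt0.
  move=> [/= h1 h2].
  have Xp : c^-1 <= r ^+ 2 - X p by rewrite lerBrDr addrC -lerBrDr.
  have bp : eball zeta r p.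
    by apply/ballP; rewrite -subr_gt0; exact: lt_le_trans Xp.
  have Yp : c^-1 <= 0 - Y p by rewrite sub0r -lerNr key // -subr_ge0.
  have hp : hartogs g p by apply/YP => //; rewrite -subr_gt0; exact: lt_le_trans Yp.
  split=> //; rewrite /phi ge_max; apply/andP; split.
    by rewrite -[leRHS]invrK lef_pV2 // posrE ?(lt_le_trans ic0).
  by rewrite -[leRHS]invrK lef_pV2 // posrE ?(lt_le_trans ic0).
apply: (subclosed_compact _ (@cspace_box_compact R 2
   (normc (zeta ord0 ord0) + normc (zeta ord0 ord_max) + r))).
  apply: closedI; apply: closed_comp.
  - by move=> p _; exact: cX.
  - exact: closed_le.
  - move=> p _; have h0 := @expR_base_continuous _ g cg p.
    have h1 := @normc_coord_continuous R 2 ord_max p.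
    exact: (cvgB h0 (cvgM h1 (cvg_cst _))).
  - exact: closed_ge.
move=> p [/= h1 _] k.
have bp : eball zeta r p.
  by apply/ballP; apply: le_lt_trans h1 _; rewrite ltrBlDr ltrDl invr_gt0.
rewrite -[p ord0 k](subrK (zeta ord0 k)) (le_trans (normcD _ _)) // addrC.
rewrite lerD //; last by apply: ltW; exact: ball_k.
by have [->|->] := ord2P k; rewrite ?lerDl ?lerDr normc_ge0.
Qed.

End LocalPseudoconvexity.

(** * Stability of Zygmund classes under composition *)

Section ZygmundClass.
Context {R : realType}.
Variables (T : zmodType) (N : T -> R).
Hypothesis N_ge0 : forall h, 0 <= N h.
Hypothesis NN : forall h, N (- h) = N h.
Implicit Types (s M : R) (S : set T) (f : T -> R).

(* The bound on the first differences, automatic up to constants in the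
   Zygmund class for [0 < s < 2], makes the class stable under composition
   with C^{1,1} functions. *)
Definition zclass s S f := exists2 M, 0 <= M & forall x h, S x -> S (x + h) -> S (x - h) ->
  `|f (x + h) - f x| <= M * N h `^ (s / 2) /\
  `|f (x + h) + f (x - h) - 2 * f x| <= M * N h `^ s.

Lemma sqr_powR_half (x s : R) : (x `^ (s / 2)) ^+ 2 = x `^ s.
Proof. by rewrite -powR_mulrn ?powR_ge0 // -powRrM divfK // pnatr_eq0. Qed.

Lemma zclassD s S f g : zclass s S f -> zclass s S g -> zclass s S (fun x => f x + g x).
Proof.
move=> [M M0 HM] [K K0 HK]; exists (M + K); first exact: addr_ge0.
move=> x h Sx Sp Sm; have [f1 f2] := HM _ _ Sx Sp Sm; have [g1 g2] := HK _ _ Sx Sp Sm.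
rewrite !mulrDl; split.
  rewrite (_ : _ - _ = (f (x + h) - f x) + (g (x + h) - g x)); last by ring.
  by rewrite (le_trans (ler_normD _ _)) // lerD.
rewrite (_ : _ - _ = (f (x + h) + f (x - h) - 2 * f x) +
  (g (x + h) + g (x - h) - 2 * g x)); last by ring.
by rewrite (le_trans (ler_normD _ _)) // lerD.
Qed.

Lemma zclass_sub s S S' f : S' `<=` S -> zclass s S f -> zclass s S' f.
Proof.
by move=> SS [M M0 HM]; exists M => // x h ? ? ?; apply: HM; exact: SS.
Qed.

Lemma zclass_eq s S f g : {in S, f =1 g} -> zclass s S f -> zclass s S g.
Proof.
move=> fg [M M0 HM]; exists M => // x h Sx Sp Sm.
by rewrite -!fg ?inE //; exact: HM.
Qed.

(** The second difference of [psi] after [f] is psi'(f x) times that of [f], plus two Taylor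
    remainders. These are quadratic in first differences of [f], which are of order |h|^(s/2), so
    they too are of order |h|^s. *)
Lemma zclass_comp s S f (J : set R) (psi psi' : R -> R) (K : R) : 0 <= K ->
  zclass s S f -> (forall x, S x -> J (f x)) ->
  (forall a b, J a -> J b -> [/\ `|psi' a| <= K, `|psi b - psi a| <= K * `|b - a| &
     `|psi b - psi a - psi' a * (b - a)| <= K * (b - a) ^+ 2]) ->
  zclass s S (fun x => psi (f x)).
Proof.
move=> K0 [M M0 HM] SJ HJ; exists (K * M + 2 * (K * M ^+ 2)).
  by rewrite addr_ge0 ?mulr_ge0 ?sqr_ge0.
move=> x h Sx Sp Sm.
have [f1 f2] := HM _ _ Sx Sp Sm.
have [f3 _] : `|f (x - h) - f x| <= M * N h `^ (s / 2) /\ True.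
  by split=> //; have := HM x (- h) Sx Sm; rewrite opprK NN => /(_ Sp)[].
have [k1 k2 k3] := HJ _ _ (SJ _ Sx) (SJ _ Sp).
have [_ _ k4] := HJ _ _ (SJ _ Sx) (SJ _ Sm).
have sq y : `|f y - f x| <= M * N h `^ (s / 2) -> (f y - f x) ^+ 2 <= M ^+ 2 * N h `^ s.
  move=> hy; rewrite -sqr_powR_half -exprMn -real_normK ?num_real //.
  by rewrite ler_pXn2r // nnegrE mulr_ge0 ?powR_ge0.
split.
  apply: le_trans k2 _; rewrite (mulrDl (K * M)).
  apply: le_trans (_ : K * (M * N h `^ (s / 2)) <= _); first by rewrite ler_wpM2l.
  by rewrite [leLHS]mulrA lerDl !mulr_ge0 ?sqr_ge0 ?powR_ge0.
rewrite (_ : _ - _ = psi' (f x) * (f (x + h) + f (x - h) - 2 * f x) +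
  (psi (f (x + h)) - psi (f x) - psi' (f x) * (f (x + h) - f x)) +
  (psi (f (x - h)) - psi (f x) - psi' (f x) * (f (x - h) - f x))); last by ring.
rewrite (_ : _ * N h `^ s = K * (M * N h `^ s) + K * (M ^+ 2 * N h `^ s) +
  K * (M ^+ 2 * N h `^ s)); last by ring.
rewrite (le_trans (ler_normD _ _)) // lerD //; last first.
  by apply: le_trans k4 _; rewrite ler_wpM2l // sq.
rewrite (le_trans (ler_normD _ _)) // lerD //; last first.
  by apply: le_trans k3 _; rewrite ler_wpM2l // sq.
by rewrite normrM ler_pM.
Qed.

Lemma powR_le_1 (x p q : R) : 0 <= x <= 1 -> 0 < p -> p <= q -> x `^ q <= x `^ p.
Proof.
move=> /andP[x0 x1] p0 pq.
move: x0; rewrite le_eqVlt => /predU1P[<-|x0].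
  by rewrite !powR0 ?gt_eqF // (lt_le_trans p0).
by apply: ger_powR; rewrite // x0.
Qed.

Lemma zclass2_le s S f : 0 < s <= 2 -> (forall x h, S x -> S (x + h) -> N h <= 1) ->
  zclass 2 S f -> zclass s S f.
Proof.
move=> /andP[s0 s2] N1 [M M0 HM]; exists M => // x h Sx Sp Sm.
have N01 : 0 <= N h <= 1 by rewrite N_ge0 (N1 _ _ Sx Sp).
have [f1 f2] := HM _ _ Sx Sp Sm; split.
  apply: le_trans f1 _; rewrite ler_wpM2l // powR_le_1 ?divr_gt0 //.
  by rewrite ler_pM2r ?invr_gt0.
by apply: le_trans f2 _; rewrite ler_wpM2l // powR_le_1.
Qed.

Lemma zclass_linear S f : (forall x y, f (x + y) = f x + f y) ->
  (forall h, `|f h| <= N h) -> zclass 2 S f.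
Proof.
move=> fD fN; exists 1 => // x h _ _ _; rewrite divff ?pnatr_eq0 // powRr1 // !mul1r.
rewrite fD addrAC subrr add0r; split=> //.
have f0 : f 0 = 0 by apply: (addrI (f 0)); rewrite -fD !addr0.
have fN' : f (- h) = - f h by apply: (addrI (f h)); rewrite -fD !subrr.
rewrite fD fN' (_ : _ - _ = 0) ?normr0 ?powR_ge0 //; by ring.
Qed.

(** Here the outer function is the rough one. Write the two outer values of [f] as [m + d] and
    [m - d]: the second difference of [V] at [m] with step [d] is controlled because [d] is of order
    |h|, and [m] differs from [f x] by half the second difference of [f], which the Lipschitz bound
    on [V] absorbs. *)
Lemma zclass_outer s S f (V : R -> R) (K : R) : 0 < s <= 2 -> 0 <= K ->
  (forall x h, S x -> S (x + h) -> N h <= 1) -> zclass 2 S f ->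
  (forall a b, `|V a - V b| <= `|a - b|) ->
  (forall m d, `|V (m + d) + V (m - d) - 2 * V m| <= K * `|d| `^ s) ->
  zclass s S (fun x => V (f x)).
Proof.
move=> s02 K0 N1 fz VL V2; have [M M0 HM] := fz.
have [M' M'0 HM'] := zclass2_le s02 N1 fz.
have /andP[s0 s2] := s02.
exists (M' + K * M `^ s); first by rewrite addr_ge0 // mulr_ge0 ?powR_ge0.
move=> x h Sx Sp Sm.
have [f1 _] := HM _ _ Sx Sp Sm.
have [f3 _] : `|f (x - h) - f x| <= M * N h `^ (2 / 2) /\ True.
  by split=> //; have := HM x (- h) Sx Sm; rewrite opprK NN => /(_ Sp)[].
have [g1 g2] := HM' _ _ Sx Sp Sm.
rewrite divff ?pnatr_eq0 // powRr1 // in f1 f3.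
split.
  apply: le_trans (VL _ _) _; apply: le_trans g1 _; rewrite ler_wpM2r ?powR_ge0 //.
  by rewrite lerDl mulr_ge0 ?powR_ge0.
pose m := (f (x + h) + f (x - h)) / 2.
pose d := (f (x + h) - f (x - h)) / 2.
have -> : f (x + h) = m + d by rewrite /m /d; field.
have -> : f (x - h) = m - d by rewrite /m /d; field.
have dN : `|d| <= M * N h.
  rewrite /d normrM (ger0_norm (_ : 0 <= 2^-1)) ?invr_ge0 //.
  rewrite ler_pdivrMr // (_ : _ - _ = (f (x + h) - f x) + - (f (x - h) - f x)); last by ring.
  apply: le_trans (ler_normD _ _) _; rewrite normrN mulrDr mulr1 lerD //.
rewrite (_ : _ - _ = 2 * (V m - V (f x)) + (V (m + d) + V (m - d) - 2 * V m)); last by ring.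
apply: le_trans (ler_normD _ _) _; rewrite (mulrDl M') lerD //.
  rewrite normrM ger0_norm //; apply: le_trans (ler_wpM2l _ (VL _ _)) _ => //.
  apply: le_trans g2; rewrite -[X in X * _](ger0_norm (_ : 0 <= 2 :> R)) // -normrM.
  by rewrite /m mulrBr mulrCA mulfV ?mulr1.
apply: le_trans (V2 _ _) _; rewrite -mulrA ler_wpM2l // -powRM //.
by apply: ge0_ler_powR; rewrite ?nnegrE ?mulr_ge0 // ltW.
Qed.

End ZygmundClass.

(** * First-order Taylor bounds for the outer functions of the compositions *)

Section SmoothFunctions.
Context {R : realType}.
Implicit Types a b : R.

(** Concavity gives tangent inequalities at both endpoints; the two tangent estimates differ by (b -
    a)^2 / (a b), which bounds the remainder. Since [c <= 1], one power of [c^-1] dominates all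
    constants. *)
Lemma ln_C11 (c : R) a b : 0 < c <= 1 -> c <= a -> c <= b ->
  [/\ `|a^-1| <= c ^- 2, `|ln b - ln a| <= c ^- 2 * `|b - a| &
     `|ln b - ln a - a^-1 * (b - a)| <= c ^- 2 * (b - a) ^+ 2].
Proof.
move=> /andP[c0 c1] ca cb.
have a0 : 0 < a by exact: lt_le_trans ca.
have b0 : 0 < b by exact: lt_le_trans cb.
have up (x y : R) : 0 < x -> 0 < y -> ln y - ln x <= (y - x) / x.
  move=> x0 y0; rewrite -ln_div ?posrE //.
  rewrite (_ : y / x = 1 + (y - x) / x); last by field; rewrite gt_eqF.
  by apply: le_ln1Dx; rewrite ltr_pdivlMr //; lra.
have u1 := up a b a0 b0; have u2 := up b a b0 a0.
have ia : a^-1 <= c^-1 by rewrite lef_pV2 ?posrE.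
have ib : b^-1 <= c^-1 by rewrite lef_pV2 ?posrE.
have ic : 1 <= c^-1 by rewrite invf_ge1.
have ia0 : 0 < a^-1 by rewrite invr_gt0.
have ib0 : 0 < b^-1 by rewrite invr_gt0.
have ic2 : c^-1 <= c ^- 2 by rewrite -exprVn expr2 ler_peMr // ltW // invr_gt0.
have ic20 : 0 <= c ^- 2 by rewrite invr_ge0 exprn_ge0 // ltW.
split.
- by rewrite ger0_norm ?(ltW ia0) // (le_trans ia).
- rewrite ler_norml; apply/andP; split.
    rewrite lerNl opprB; apply: le_trans u2 _.
    apply: le_trans (ler_norm _) _; rewrite normrM distrC mulrC ler_wpM2r //.
    by rewrite ger0_norm ?(ltW ib0) // (le_trans ib).
  apply: le_trans u1 _; apply: le_trans (ler_norm _) _; rewrite normrM mulrC ler_wpM2r //.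
  by rewrite ger0_norm ?(ltW ia0) // (le_trans ia).
- have e : (b - a) / a - (b - a) / b = (b - a) ^+ 2 * (a^-1 * b^-1).
    by field; rewrite !gt_eqF.
  rewrite ler0_norm; last by rewrite subr_le0 mulrC.
  have le1 : - (ln b - ln a - a^-1 * (b - a)) <= (b - a) / a - (b - a) / b.
    rewrite (_ : (b - a) / a = a^-1 * (b - a)); last by rewrite mulrC.
    by rewrite (_ : (b - a) / b = - ((a - b) / b)); [lra|rewrite -mulNr opprB].
  apply: le_trans le1 _; rewrite e mulrC ler_wpM2r ?sqr_ge0 // -exprVn expr2.
  by rewrite ler_pM // ltW.
Qed.

(** With p and q the two square roots, q - p = (b - a) / (p + q), and the remainder is exactly -(b -
    a)^2 / (2 p (p + q)^2). *)
Lemma sqrt_C11 (c : R) a b : 0 < c <= 1 -> c ^+ 2 <= a -> c ^+ 2 <= b ->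
  [/\ `|(2 * Num.sqrt a)^-1| <= c ^- 3, `|Num.sqrt b - Num.sqrt a| <= c ^- 3 * `|b - a| &
     `|Num.sqrt b - Num.sqrt a - (2 * Num.sqrt a)^-1 * (b - a)| <= c ^- 3 * (b - a) ^+ 2].
Proof.
move=> /andP[c0 c1] ca cb.
have c20 : 0 < c ^+ 2 by rewrite exprn_gt0.
have a0 : 0 <= a by apply: ltW; exact: lt_le_trans ca.
have b0 : 0 <= b by apply: ltW; exact: lt_le_trans cb.
set p := Num.sqrt a; set q := Num.sqrt b.
have pE : a = p ^+ 2 by rewrite sqr_sqrtr.
have qE : b = q ^+ 2 by rewrite sqr_sqrtr.
have cp : c <= p by rewrite -(ler_pXn2r (_ : 0 < 2)%N) ?nnegrE ?sqrtr_ge0 ?(ltW c0) // -pE.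
have cq : c <= q by rewrite -(ler_pXn2r (_ : 0 < 2)%N) ?nnegrE ?sqrtr_ge0 ?(ltW c0) // -qE.
have p0 : 0 < p by exact: lt_le_trans cp.
have q0 : 0 < q by exact: lt_le_trans cq.
have ip : p^-1 <= c^-1 by rewrite lef_pV2 ?posrE.
have ic : 1 <= c^-1 by rewrite invf_ge1.
have ic0 : 0 < c^-1 by rewrite invr_gt0.
have ipq : (p + q)^-1 <= c^-1.
  by rewrite lef_pV2 ?posrE ?addr_gt0 // (le_trans cp) // lerDl ltW.
have ic3 : c^-1 <= c ^- 3.
  by rewrite -exprVn exprS ler_peMr ?(ltW ic0) // exprn_ege1.
have i2p : (2 * p)^-1 <= c^-1.
  rewrite lef_pV2 ?posrE ?mulr_gt0 // (le_trans cp) // ler_peMl ?(ltW p0) //.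
  by rewrite ler1n.
have i2p0 : 0 < (2 * p)^-1 by rewrite invr_gt0 mulr_gt0.
have ipq0 : 0 < (p + q)^-1 by rewrite invr_gt0 addr_gt0.
have qp : q - p = (b - a) * (p + q)^-1.
  by rewrite qE pE; field; rewrite gt_eqF // addr_gt0.
split.
- by rewrite ger0_norm ?(ltW i2p0) // (le_trans i2p).
- rewrite qp normrM mulrC ler_wpM2r // ger0_norm ?(ltW ipq0) //.
  by rewrite (le_trans ipq).
- have -> : q - p - (2 * p)^-1 * (b - a) = - ((2 * p)^-1 * ((p + q)^-1 * (p + q)^-1)) * (b - a) ^+ 2.
    rewrite qE pE; field.
    by rewrite !gt_eqF // addr_gt0.
  rewrite normrM normrN [X in _ * X]ger0_norm ?sqr_ge0 // ler_wpM2r ?sqr_ge0 //.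
  rewrite ger0_norm; last by rewrite !mulr_ge0 // ltW.
  rewrite -exprVn exprS expr2; apply: ler_pM => //; first exact: ltW.
    by rewrite mulr_ge0 // ltW.
  by apply: ler_pM => //; exact: ltW.
Qed.

(** Convexity, used at both endpoints, places the remainder between 0 and twice the product of the
    two increments. *)
Lemma exp2_C11 (G : R) a b : a <= G -> b <= G ->
  [/\ `|2 * expR (2 * a)| <= 4 * expR (2 * G),
      `|expR (2 * b) - expR (2 * a)| <= 4 * expR (2 * G) * `|b - a| &
     `|expR (2 * b) - expR (2 * a) - 2 * expR (2 * a) * (b - a)| <=
       4 * expR (2 * G) * (b - a) ^+ 2].
Proof.
move=> aG bG.
have E0 := expR_gt0 (2 * G).
have ea : expR (2 * a) <= expR (2 * G) by rewrite ler_expR ler_pM2l.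
have eb : expR (2 * b) <= expR (2 * G) by rewrite ler_expR ler_pM2l.
have ea0 := expR_gt0 (2 * a); have eb0 := expR_gt0 (2 * b).
have up (x y : R) : expR (2 * y) - expR (2 * x) <= 2 * expR (2 * y) * (y - x).
  have := expR_ge1Dx (2 * x - 2 * y); rewrite expRB ler_pdivlMr ?expR_gt0 //; lra.
have u1 := up a b; have u2 := up b a.
set A := expR (2 * a) in ea ea0 u1 u2 *; set B := expR (2 * b) in eb eb0 u1 u2 *.
set E := expR (2 * G) in E0 ea eb *.
split.
- by rewrite ger0_norm; lra.
- have [ab|ba] := leP a b.
    rewrite (ger0_norm (_ : 0 <= b - a)) ?subr_ge0 // ger0_norm; last first.
      by rewrite subr_ge0 ler_expR ler_pM2l.
    by nra.
  rewrite (ler0_norm (_ : b - a <= 0)) ?subr_le0 ?(ltW ba) // ler0_norm; last first.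
    by rewrite subr_le0 ler_expR ler_pM2l // ltW.
  by nra.
- rewrite ger0_norm; last by lra.
  apply: le_trans (_ : 2 * (B - A) * (b - a) <= _); first lra.
  have [ab|ba] := leP a b.
    have : B - A <= 2 * E * (b - a) by nra.
    by nra.
  have : A - B <= 2 * E * (a - b) by nra.
  by nra.
Qed.

Lemma nsqr_C11 a b : `|a| <= 1 -> `|b| <= 1 ->
  [/\ `|- (2 * a)| <= 2, `|- b ^+ 2 - - a ^+ 2| <= 2 * `|b - a| &
     `|- b ^+ 2 - - a ^+ 2 - - (2 * a) * (b - a)| <= 2 * (b - a) ^+ 2].
Proof.
move=> a1 b1; split.
- by rewrite normrN normrM ger0_norm //; lra.
- rewrite (_ : - b ^+ 2 - - a ^+ 2 = - (a + b) * (b - a)); last by ring.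
  rewrite normrM normrN ler_wpM2r // (le_trans (ler_normD _ _)) //; lra.
- rewrite (_ : - b ^+ 2 - - a ^+ 2 - - (2 * a) * (b - a) = - (b - a) ^+ 2); last by ring.
  by rewrite normrN ger0_norm ?sqr_ge0 // ler_peMl ?sqr_ge0 // ler1n.
Qed.

End SmoothFunctions.

(** * The boundary of a Hartogs domain as a Zygmund graph *)

Section HartogsBoundary.
Context {R : realType}.
Local Notation C := R[i]^o.
Local Notation C2 := (Cspace R 2).

Definition i0 : 'I_3 := @Ordinal 3 0 isT.
Definition i1 : 'I_3 := @Ordinal 3 1 isT.
Definition i2 : 'I_3 := @Ordinal 3 2 isT.

Lemma ord3P (k : 'I_3) : [\/ k = i0, k = i1 | k = i2].
Proof.
by case: k => [[|[|[|//]]] ?]; [constructor 1|constructor 2|constructor 3]; exact: val_inj.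
Qed.

Lemma sum3E (F : 'I_3 -> R) : \sum_(k < 3) F k = F i0 + F i1 + F i2.
Proof.
rewrite !big_ord_recl big_ord0 addr0 addrA.
by congr (F _ + F _ + F _); exact: val_inj.
Qed.

Lemma enorm_ge0 n (x : 'rV[R]_n) : 0 <= enorm x. Proof. exact: sqrtr_ge0. Qed.

Lemma enormN n (x : 'rV[R]_n) : enorm (- x) = enorm x.
Proof.
by rewrite /enorm; congr Num.sqrt; apply: eq_bigr => k _; rewrite mxE sqrrN.
Qed.

Lemma enorm3E (x : 'rV[R]_3) :
  enorm x = Num.sqrt (x ord0 i0 ^+ 2 + x ord0 i1 ^+ 2 + x ord0 i2 ^+ 2).
Proof. by rewrite /enorm sum3E. Qed.

Definition base_point (x : 'rV[R]_3) : C := (x ord0 i0 +i* x ord0 i1)%C.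

Lemma base_pointD x y : base_point (x + y) = base_point x + base_point y.
Proof. by rewrite /base_point !mxE. Qed.

Lemma base_pointB x y : base_point (x - y) = base_point x - base_point y.
Proof. by rewrite /base_point !mxE. Qed.

Lemma normc_base_point x : normc (base_point x) <= enorm x.
Proof. by rewrite enorm3E /= ler_wsqrtr // lerDl sqr_ge0. Qed.

Lemma coord2_le (x : 'rV[R]_3) : `|x ord0 i2| <= enorm x.
Proof. by rewrite enorm3E -sqrtr_sqr ler_wsqrtr // lerDr addr_ge0 ?sqr_ge0. Qed.

Lemma enorm3_le (x : 'rV[R]_3) : enorm x <= normc (base_point x) + `|x ord0 i2|.
Proof.
have h0 := normc_ge0 (base_point x); have h1 := normr_ge0 (x ord0 i2).
rewrite -[leRHS](ger0_norm (addr_ge0 h0 h1)) -sqrtr_sqr enorm3E ler_wsqrtr //.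
have m := mulr_ge0 h0 h1.
have E : normc (base_point x) ^+ 2 = x ord0 i0 ^+ 2 + x ord0 i1 ^+ 2 := sqr_normcE _.
by rewrite sqrrD E real_normK ?num_real //; lra.
Qed.

Lemma base_point_continuous : continuous base_point.
Proof.
move=> x; apply: (@near_cplx R _ (nbhs x) (nbhs_filter x)) => e e0.
have e2 : 0 < e / 2 by rewrite divr_gt0.
have H (k : 'I_3) : nbhs x (fun y : 'rV[R]_3 => `|y ord0 k - x ord0 k| < e / 2).
  have h := @coord_continuous R 1 3 ord0 k x.
  have /(cvgrPdist_lt (FF := nbhs_filter x))/(_ _ e2) := h.
  by apply: filterS => y; rewrite distrC.
have h0 := H i0; have h1 := H i1.
apply: (filterS2 (nbhs_filter x) _ h0 h1) => y y0 y1.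
rewrite -base_pointB; apply: le_lt_trans (normc_le_ReIm _) _.
rewrite /base_point (splitr e); apply: ltrD.
  by move: y0; rewrite -[X in `|X|]/(_ - _) /= !mxE.
by move: y1; rewrite /= !mxE.
Qed.

Section Coordinates.
Variable u : C.
Hypothesis u1 : normc u = 1.

Lemma conjc_unit : u * (u^*)%C = 1.
Proof.
have := congr1 (fun x => x ^+ 2) u1; rewrite sqr_normcE expr1n.
case: u => a b /= ab; apply/eqP; rewrite eq_complex /= mulrN opprK -!expr2 ab.
by rewrite eqxx /=; apply/eqP; ring.
Qed.

Lemma normc_conj : normc (u^*)%C = 1.
Proof. by rewrite -u1; case: u => a b /=; rewrite sqrrN. Qed.

(* Rotating the second variable by [u^-1] turns the fibre circle at the point
   of argument [u] into the graph of a function of its imaginary part. *)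
Definition rotated_coords (p : C2) : 'rV[R]_(3 + 1) :=
  let q := p ord0 ord_max * (u^*)%C in
  row_mx (\row_(k < 3) [:: complex.Re (p ord0 ord0); complex.Im (p ord0 ord0); complex.Im q]`_k)
         (const_mx (complex.Re q)).

Lemma rotated_coordsB p q : rotated_coords p - rotated_coords q = rotated_coords (p - q).
Proof.
have S (k : 'I_2) : (p - q) ord0 k = p ord0 k - q ord0 k.
  by rewrite mxE; congr (_ + _); rewrite mxE.
rewrite /rotated_coords opp_row_mx add_row_mx !S mulrBl.
set w := p ord0 ord_max * _; set w' := q ord0 ord_max * _.
set z := p ord0 ord0; set z' := q ord0 ord0.
congr row_mx.
  apply/rowP => k; rewrite !mxE.
  by have [->|->|->] := ord3P k => /=; case: z z' w w' => ? ? [? ?] [? ?] [? ?].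
by apply/rowP => k; rewrite !mxE; case: w w' => ? ? [? ?].
Qed.

Lemma enorm_rotated_coords p : enorm (rotated_coords p) = cenorm p.
Proof.
rewrite /enorm cenorm2E; congr Num.sqrt; rewrite big_split_ord /=.
rewrite big_ord1 (eq_bigr (fun k : 'I_3 =>
  [:: complex.Re (p ord0 ord0); complex.Im (p ord0 ord0);
      complex.Im (p ord0 ord_max * (u^*)%C)]`_k ^+ 2)); last first.
  by move=> k _; rewrite row_mxEl mxE.
rewrite sum3E row_mxEr mxE /= -sqr_normcE -addrA; congr (_ + _).
rewrite addrC -sqr_normcE normc_mul normc_conj mulr1 //.
Qed.

Lemma rotated_coords_euclidean : euclidean_coordinates rotated_coords.
Proof.
split; last by move=> p q; rewrite rotated_coordsB enorm_rotated_coords.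
pose inv (v : 'rV[R]_(3 + 1)) : C2 :=
  cpair (lsubmx v ord0 i0 +i* lsubmx v ord0 i1)%C
        ((rsubmx v ord0 ord0 +i* lsubmx v ord0 i2)%C * u).
exists inv => [p|v].
  rewrite /inv /rotated_coords row_mxKl row_mxKr !mxE /= -[RHS]cpair_eta.
  congr cpair; first by case: (p ord0 ord0).
  rewrite (_ : (_ +i* _)%C = p ord0 ord_max * (u^*)%C); last by case: (_ * _).
  by rewrite -mulrA [_ * u]mulrC conjc_unit mulr1.
rewrite /rotated_coords /inv cpair0 cpair1 -mulrA conjc_unit mulr1 /=.
rewrite -[RHS]hsubmxK; congr row_mx.
  by apply/rowP => k; rewrite mxE; have [->|->|->] := ord3P k.
by apply/rowP => k; have -> : k = ord0 := ord1 k; rewrite [LHS]mxE.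
Qed.

End Coordinates.

Lemma zclass_base_point (s : R) (S : set C) (g : C -> R) : 0 <= s ->
  zclass (fun z : C => normc z) s S g ->
  zclass (@enorm R 3) s (base_point @^-1` S) (g \o base_point).
Proof.
move=> s0 [M M0 HM]; exists M => // x h /= Sx; rewrite base_pointD base_pointB => Sp Sm.
have [f1 f2] := HM _ _ Sx Sp Sm; have nb := normc_base_point h.
split.
  apply: le_trans f1 _; rewrite ler_wpM2l //.
  by apply: ge0_ler_powR; rewrite ?nnegrE ?normc_ge0 ?enorm_ge0 // divr_ge0.
apply: le_trans f2 _; rewrite ler_wpM2l //.
by apply: ge0_ler_powR; rewrite ?nnegrE ?normc_ge0 ?enorm_ge0.
Qed.

(** After the rotation, with height x > 0 and third base coordinate y, the condition |w| < e^g reads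
    x < sqrt (e^(2 g) - y^2). This graph function is built from [g] by sums and by composition with
    C^{1,1} functions, so it inherits the class of [g]. *)
Lemma hartogs_zygmund_boundary (alpha : R) (g : C -> R) : 0 < alpha < 2 ->
  continuous g -> (forall z, 0 <= g z) ->
  (forall z0, exists2 r : R, 0 < r &
     zclass (fun z : C => normc z) alpha [set z | normc (z - z0) < r] g) ->
  zygmund_boundary alpha (hartogs g).
Proof.
move=> /andP[a0 a2] cg g0 Hg zeta /(boundary_hartogs cg) zetaE.
set z0 := zeta ord0 ord0 in zetaE *; set w0 := zeta ord0 ord_max in zetaE *.
have w00 : 0 < normc w0 by rewrite zetaE expR_gt0.
have [r r0 gz] := Hg z0.
have [r' r'0 gr'] : exists2 r' : R, 0 < r' & forall z, normc (z - z0) < r' -> g z <= g z0 + 1.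
  have : \forall z \near z0, `|g z0 - g z| < 1.
    have h := @cg z0.
    by have /(cvgrPdist_lt (FF := nbhs_filter z0))/(_ _ ltr01) := h.
  move=> /nbhs_cplxP[e e0 eH]; exists e => // z /eH.
  by rewrite ltr_norml => /andP[h _]; lra.
(* [r] gives the regularity of [g], [r'] an upper bound for [g] as required by [exp2_C11], and 1/4
   makes increments inside [U] have norm at most 1, as required by [zclass2_le]. *)
pose rho := Num.min (Num.min r r') (1 / 4).
have rho0 : 0 < rho by rewrite !lt_min r0 r'0 divr_gt0.
have rhor : rho <= r by rewrite !ge_min lexx.
have rhor' : rho <= r' by rewrite !ge_min lexx orbT.
have rho4 : rho <= 1 / 4 by rewrite !ge_min lexx orbT.
pose u : C := w0 * (normc w0)^-1%:C%C.
have u1 : normc u = 1.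
  by rewrite normc_mul normc_real ger0_norm ?invr_ge0 ?normc_ge0 // mulfV // gt_eqF.
have wu : w0 * (u^*)%C = (normc w0)%:C%C.
  have -> : w0 = (normc w0)%:C%C * u.
    by rewrite /u mulrCA -rmorphM mulfV ?gt_eqF // rmorph1 mulr1.
  by rewrite -mulrA conjc_unit // mulr1 normc_mul u1 mulr1 normc_real ger0_norm ?normc_ge0.
pose Q (p : C2) : C := p ord0 ord_max * (u^*)%C.
pose U := [set x : 'rV[R]_3 | normc (base_point x - z0) < rho] `&`
          [set x | `|x ord0 i2| < 1 / 4].
pose F (x : 'rV[R]_3) : R := expR (2 * g (base_point x)) + - x ord0 i2 ^+ 2.
pose f (x : 'rV[R]_3) : R := Num.sqrt (F x).
pose V := [set p : C2 | normc (p ord0 ord0 - z0) < rho] `&`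
          ([set p : C2 | `|complex.Im (Q p)| < 1 / 4] `&` [set p : C2 | 0 < complex.Re (Q p)]).
have cb : continuous (fun x : 'rV[R]_3 => normc (base_point x - z0)).
  move=> x; apply: (continuous_comp (f := base_point) (g := fun z : C => normc (z - z0))).
    exact: base_point_continuous.
  apply: lipschitz_cplx_continuous => z w; apply: le_trans (normc_dist _ _) _.
  by rewrite opprB addrA subrK.
have c2 : continuous (fun x : 'rV[R]_3 => x ord0 i2).
  by move=> x; exact: coord_continuous.
have cg' : continuous (fun x : 'rV[R]_3 => g (base_point x)).
  by move=> x; apply: (continuous_comp (f := base_point)); [exact: base_point_continuous|exact: cg].
have cF : continuous F.
  move=> x; have h1 := cg' x; have h2 := c2 x.
  have hE : expR (2 * g (base_point y)) @[y --> x] --> expR (2 * g (base_point x)).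
    apply: (continuous_comp (f := fun x => 2 * g (base_point x)) (g := @expR R)).
      exact: (cvgM (cvg_cst _) h1).
    exact: continuous_expR.
  have hS : (fun y : 'rV[R]_3 => y ord0 i2 ^+ 2) @ x --> x ord0 i2 ^+ 2.
    apply: (continuous_comp (f := fun x : 'rV[R]_3 => x ord0 i2) (g := fun y : R => y ^+ 2)).
      exact: h2.
    exact: exprn_continuous.
  apply: (continuousD (f := fun y : 'rV[R]_3 => expR (2 * g (base_point y)))
    (g := fun y : 'rV[R]_3 => - y ord0 i2 ^+ 2)); first exact: hE.
  by apply: (continuousN (f := fun y : 'rV[R]_3 => y ord0 i2 ^+ 2)); exact: hS.
have cf : continuous f.
  by move=> x; apply: (continuous_comp (f := F)); [exact: cF|exact: sqrt_continuous].
have Uh x h : U x -> U (x + h) -> enorm h <= 1.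
  move=> [/= x1 x2] [/= y1 y2]; apply: le_trans (enorm3_le h) _.
  have -> : base_point h = (base_point (x + h) - z0) - (base_point x - z0).
    by rewrite base_pointD opprB addrA subrK addrC addKr.
  have -> : h ord0 i2 = (x + h) ord0 i2 - x ord0 i2 by rewrite !mxE addrC addKr.
  have n1 := normcD (base_point (x + h) - z0) (- (base_point x - z0)).
  rewrite normc_opp in n1.
  have n2 := ler_normD ((x + h) ord0 i2) (- x ord0 i2).
  rewrite normrN in n2.
  have := rho4; lra.
have Ug x : U x -> g (base_point x) <= g z0 + 1.
  by move=> [/= x1 _]; apply: gr'; exact: lt_le_trans rhor'.
have U2 x : U x -> `|x ord0 i2| <= 1.
  by move=> [_ /= x2]; apply/ltW/(lt_le_trans x2); rewrite ler_pdivrMr // mul1r ler1n.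
have ze : zclass (@enorm R 3) alpha U (fun x => expR (2 * g (base_point x))).
  have gU : zclass (@enorm R 3) alpha U (g \o base_point).
    apply: zclass_sub (zclass_base_point (ltW a0) gz) => x [/= x1 _].
    exact: lt_le_trans rhor.
  apply: (zclass_comp (psi := fun y => expR (2 * y)) (psi' := fun y => 2 * expR (2 * y))
    (J := [set y | y <= g z0 + 1]) (@enormN 3) _ gU Ug); last first.
    by move=> a b /=; exact: exp2_C11.
  by rewrite mulr_ge0 // expR_ge0.
have zl : zclass (@enorm R 3) alpha U (fun x : 'rV[R]_3 => x ord0 i2).
  apply: zclass2_le Uh _; [exact: enorm_ge0|by rewrite a0 ltW|].
  by apply: zclass_linear => [h|x y|h]; [exact: enorm_ge0|rewrite mxE|exact: coord2_le].
have zs : zclass (@enorm R 3) alpha U (fun x : 'rV[R]_3 => - x ord0 i2 ^+ 2).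
  apply: (zclass_comp (psi := fun y : R => - y ^+ 2) (psi' := fun y => - (2 * y))
    (J := [set y | `|y| <= 1]) (@enormN 3) _ zl U2); last by move=> a b /=; exact: nsqr_C11.
  by [].
(* Nonnegativity of [g] keeps the radicand above 1 - 1/16, away from the singularity of the square
   root. *)
have FU x : U x -> (1 / 2) ^+ 2 <= F x.
  move=> [_ /= x2]; have h : 1 <= expR (2 * g (base_point x)).
    by rewrite -expR0 ler_expR mulr_ge0.
  have : x ord0 i2 ^+ 2 <= (1 / 4) ^+ 2.
    by rewrite -[X in X <= _]real_normK ?num_real // ler_pXn2r ?nnegrE ?divr_ge0 // ltW.
  by rewrite /F; lra.
have zf : zclass (@enorm R 3) alpha U f.
  have zF := zclassD ze zs.
  have c01 : 0 < (1 / 2 : R) <= 1 by apply/andP; split; lra.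
  apply: (zclass_comp (psi := @Num.sqrt R) (psi' := fun y => (2 * Num.sqrt y)^-1)
    (J := [set y | (1 / 2) ^+ 2 <= y]) (@enormN 3) _ zF FU); last first.
    by move=> a b /=; exact: sqrt_C11.
  by rewrite invr_ge0 exprn_ge0 // divr_ge0.
have cQ (h : C -> R) : (forall z w, `|h z - h w| <= normc (z - w)) ->
    continuous (fun p : C2 => h (Q p)).
  move=> hL p; apply: (continuous_comp (f := fun p : C2 => p ord0 ord_max : C)
    (g := fun z : C => h (z * (u^*)%C))); first exact: cspace_coord_continuous.
  apply: lipschitz_cplx_continuous => z w; apply: le_trans (hL _ _) _.
  by rewrite -mulrBl normc_mul normc_conj // mulr1.
have LIm (z w : C) : `|complex.Im z - complex.Im w| <= normc (z - w).
  by have := normr_Im_le (z - w); case: z w => [? ?] [? ?].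
have LRe (z w : C) : `|complex.Re z - complex.Re w| <= normc (z - w).
  by have := normr_Re_le (z - w); case: z w => [? ?] [? ?].
exists (rotated_coords u), V, U, f; split.
- exact: rotated_coords_euclidean.
- split; last first.
    split; first by rewrite /= subrr normc_zero.
    by split; rewrite /= /Q -/w0 wu /= ?normr0 ?divr_gt0.
  apply: openI.
    apply: (open_comp (f := fun p : C2 => normc (p ord0 ord0 - z0))
      (D := [set x | x < rho]));
      last exact: open_lt.
    move=> p _; apply: (continuous_comp (f := fun p : C2 => p ord0 ord0 : C)
      (g := fun z : C => normc (z - z0))); first exact: cspace_coord_continuous.
    apply: lipschitz_cplx_continuous => z w; apply: le_trans (normc_dist _ _) _.
    by rewrite opprB addrA subrK.
  apply: openI.
    apply: (open_comp (f := fun p : C2 => `|complex.Im (Q p)|)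
      (D := [set x | x < 1 / 4]));
      last exact: open_lt.
    move=> p _; apply: (cQ (fun z => `|complex.Im z|)) => z w.
    by apply: le_trans (ler_dist_dist _ _) _; exact: LIm.
  apply: (open_comp (f := fun p : C2 => complex.Re (Q p))
    (D := [set x | 0 < x]));
    last exact: open_gt.
  by move=> p _; apply: (cQ (@complex.Re R)).
- split.
    apply: openI.
      apply: (open_comp (f := fun x : 'rV[R]_3 => normc (base_point x - z0))
        (D := [set x | x < rho]));
        last exact: open_lt.
      by move=> x _; exact: cb.
    apply: (open_comp (f := fun x : 'rV[R]_3 => `|x ord0 i2|)
      (D := [set x | x < 1 / 4]));
      last exact: open_lt.
    move=> x _; apply: (continuous_comp (f := fun x : 'rV[R]_3 => x ord0 i2)); first exact: c2.
    exact: norm_continuous.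
  move=> p [/= p1 [p2 _]]; rewrite /rotated_coords row_mxKl; split => /=.
    by rewrite /base_point !mxE /=; case: (p ord0 ord0) p1.
  by rewrite mxE.
- split; first exact: continuous_subspaceT.
  by have [M _ HM] := zf; exists M => x h Ux Up Um; have [] := HM x h Ux Up Um.
move=> p [_ [_ /= p3]]; rewrite /rotated_coords row_mxKl row_mxKr mxE /hartogs /=.
rewrite /f /F -/(Q p).
have -> : base_point (\row_(k < 3) [:: complex.Re (p ord0 ord0); complex.Im (p ord0 ord0);
    complex.Im (Q p)]`_k) = p ord0 ord0.
  by rewrite /base_point !mxE /=; case: (p ord0 ord0).
rewrite mxE /=.
set X := complex.Re (Q p) in p3 *; set Y := complex.Im (Q p).
have nQ : normc (p ord0 ord_max) ^+ 2 = X ^+ 2 + Y ^+ 2.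
  by rewrite -sqr_normcE normc_mul normc_conj // mulr1.
have e0 := expR_gt0 (g (p ord0 ord0)).
have -> : expR (2 * g (p ord0 ord0)) = expR (g (p ord0 ord0)) ^+ 2.
  by rewrite mulr_natl mulr2n expRD expr2.
set e := expR _ in e0 *.
have n0 := normc_ge0 (p ord0 ord_max).
have -> : (normc (p ord0 ord_max) < e) = (X ^+ 2 < e ^+ 2 - Y ^+ 2).
  by rewrite ltrBrDr -nQ ltr_pXn2r // nnegrE // ltW.
(* [Num.sqrt] is 0 on nonpositive arguments; both sides are then false because [0 < X]. *)
have [h|h] := leP (e ^+ 2 - Y ^+ 2) 0.
  have -> : Num.sqrt (e ^+ 2 + - Y ^+ 2) = 0 by apply/eqP; rewrite sqrtr_eq0.
  by split=> h'; [have := sqr_ge0 X; lra|move: p3; rewrite ltNge ltW].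
by rewrite -[X in X < Num.sqrt _](ger0_norm (ltW p3)) -sqrtr_sqr ltr_sqrt.
Qed.

End HartogsBoundary.

(** * Reduction of the theorem to a function on the plane *)

Section Criterion.
Context {R : realType}.
Local Notation C := R[i]^o.
Local Notation C2 := (Cspace R 2).

Lemma superharmonic_near_open (g : C -> R) : open [set z | superharmonic_near g z].
Proof.
move=> z [r r0 H]; apply/nbhs_cplxP; exists (r / 2); first exact: divr_gt0.
move=> w wz; exists (r / 2); first exact: divr_gt0.
move=> a b ab; apply: H => t t1; rewrite -(subrKA w) (splitr r).
by apply: le_lt_trans (normcD _ _) _; rewrite ltrD // ab.
Qed.

Definition removability_fails (alpha : R) : Prop :=
  exists (Omega F : set C2),
    [/\ domain Omega,
        zygmund_boundary alpha Omega,
        [/\ closed F, F `<=` boundary Omega & (hausdorff (1 + alpha) F < +oo)%E],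
        (forall zeta, (boundary Omega `\` F) zeta ->
           locally_pseudoconvex_at Omega zeta) &
        ~ pseudoconvex Omega].

Lemma hartogs_counterexample (alpha B K : R) (g : C -> R) (z0 : C) (rho : R) :
  0 < alpha < 2 -> continuous g -> (forall z, 0 <= g z) ->
  (forall z0, exists2 r : R, 0 < r &
     zclass (fun z : C => normc z) alpha [set z | normc (z - z0) < r] g) ->
  0 < rho -> g z0 = 0 -> (forall z, normc (z - z0) = rho -> 0 < g z) ->
  (forall z, ~ superharmonic_near g z -> expR (g z) <= B) ->
  (forall d : R, 0 < d -> exists (r : R) (l : seq (C * R)),
     [/\ 0 < r <= d, (size l)%:R * r `^ alpha <= K &
         forall z, ~ superharmonic_near g z -> exists2 c, c \in l &
           normc (z - c.1) <= r /\ `|expR (g z) - c.2| <= r]) ->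
  removability_fails alpha.
Proof.
move=> a02 cg g0 gz rho0 gz0 grho EB cov; have /andP[a0 a2] := a02.
(* Taking exactly the points without local superharmonicity makes [E] closed, as the complement of
   an open set, and gives local pseudoconvexity off [F] at once. *)
pose E := [set z : C | ~ superharmonic_near g z].
pose F := [set p : C2 | E (p ord0 ord0) /\ normc (p ord0 ord_max) = expR (g (p ord0 ord0))].
exists (hartogs g), F; split.
- exact: hartogs_domain.
- exact: hartogs_zygmund_boundary.
- split.
  + rewrite (_ : F = (fun p : C2 => p ord0 ord0 : C) @^-1` E `&`
      (fun p : C2 => expR (g (p ord0 ord0)) - normc (p ord0 ord_max)) @^-1` [set x | x = 0]).
      apply: closedI; apply: closed_comp.
      * by move=> p _; exact: cspace_coord_continuous.
      * by apply: open_closedC; exact: superharmonic_near_open.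
      * by move=> p _; exact: hartogs_gap_continuous.
      * exact: closed_eq.
    apply/seteqP; split=> p [h1 h2]; split=> //; first by rewrite /= h2 subrr.
    by apply/esym/eqP; rewrite -subr_eq0; apply/eqP.
  + by move=> p [_ h]; apply/boundary_hartogs.
  + exact: (hausdorff_graph_lty a0 EB cov).
- move=> zeta [/(boundary_hartogs cg) zetaE nF].
  apply: hartogs_locally_pseudoconvex => //.
  by apply: contrapT => h; apply: nF.
- exact: (hartogs_not_pseudoconvex cg g0 rho0 gz0 grho).
Qed.

End Criterion.

(** * Limits of sequences with geometric increments *)

Section GeometricLimit.
Context {R : realType}.

Lemma geometric_cvg0 (A : R) : (fun n => A * 2^-1 ^+ n) @ \oo --> (0 : R).
Proof.
have := @cvg_geometric R A 2^-1; apply; rewrite ger0_norm ?invr_ge0 //.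
by rewrite invf_lt1 // ltr1n.
Qed.

(** The sequences [u n] plus and minus the geometric tail [2 * A * 2^-1 ^+ n] are monotone, converge
    to the same limit and enclose it at every rank. *)
Lemma geometric_limit (u : nat -> R) (A : R) : 0 <= A ->
  (forall n, `|u n.+1 - u n| <= A * 2^-1 ^+ n) ->
  (u @ \oo --> limn u) /\ forall n, `|limn u - u n| <= 2 * A * 2^-1 ^+ n.
Proof.
move=> A0 Hu.
have step n : 2 * A * 2^-1 ^+ n.+1 = A * 2^-1 ^+ n.
  by rewrite exprS mulrCA !mulrA mulVf ?mul1r.
have Hu' n : u n - A * 2^-1 ^+ n <= u n.+1 <= u n + A * 2^-1 ^+ n.
  by have := Hu n; rewrite ler_distl.
pose w n := u n + 2 * A * 2^-1 ^+ n.
pose y n := u n - 2 * A * 2^-1 ^+ n.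
have wd : nonincreasing_seq w.
  apply/nonincreasing_seqP => n; rewrite /w step.
  by have := Hu' n; lra.
have yi : nondecreasing_seq y.
  apply/nondecreasing_seqP => n; rewrite /y step.
  by have := Hu' n; lra.
have p0 n : 0 <= 2 * A * 2^-1 ^+ n by rewrite !mulr_ge0 ?exprn_ge0 ?invr_ge0.
have yw n : y n <= w n by have := p0 n; rewrite /y /w; lra.
have cw : cvgn w.
  apply: nonincreasing_is_cvgn => //; exists (y 0%N) => _ [n _ <-].
  by apply: le_trans (yw n); exact: yi.
have g0 := @geometric_cvg0 (2 * A).
have uw : u = (fun n => w n - 2 * A * 2^-1 ^+ n) by apply/funext => n; rewrite /w addrK.
have cu : u @ \oo --> limn w.
  by rewrite uw -[X in _ --> X]subr0; exact: cvgB.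
have lE : limn u = limn w by exact: (cvg_lim _ cu).
split; first by rewrite lE.
have cy : y @ \oo --> limn w.
  by rewrite -[X in _ --> X]subr0; exact: cvgB.
move=> n; rewrite lE ler_distl; apply/andP; split.
  have := nondecreasing_cvgn_le yi (cvgP _ cy) n.
  by rewrite (cvg_lim _ cy).
by have := nonincreasing_cvgn_ge wd cw n.
Qed.

End GeometricLimit.

(** * Convex functions with a Cantor set of kinks *)

Section CantorKink.
Context {R : realType}.
Implicit Types (V : R -> R) (x : R).

Definition locally_affine V x := exists r a b : R, 0 < r /\
  forall y, `|y - x| < r -> V y = a * y + b.

(* [kink_function alpha V]: a function equal to [|x|] off [-1, 1], in the
   Zygmund class of exponent [alpha], whose points of nonlinearity form a set
   of finite [(alpha - 1)]-dimensional measure. *)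
Definition kink_function (alpha : R) V :=
  [/\ forall a b, `|V a - V b| <= `|a - b|,
      (exists2 K : R, 0 <= K & forall m d,
        `|V (m + d) + V (m - d) - 2 * V m| <= K * `|d| `^ alpha),
      forall x, 1 <= `|x| -> V x = `|x|,
      forall x, `|x| <= V x &
      exists K : R, forall d : R, 0 < d -> exists (r : R) (l : seq R),
        [/\ 0 < r <= d, (size l)%:R * r `^ (alpha - 1) <= K &
            forall x, ~ locally_affine V x -> exists2 c, c \in l & `|x - c| <= r]].

Lemma norm_second_difference (m d : R) : `| `|m + d| + `|m - d| - 2 * `|m| | <= 2 * `|d|.
Proof.
have h1 := ler_normD (m + d) (m - d).
have h2 := ler_normD m d; have h3 := ler_normB m d.
have : `|m + d + (m - d)| = 2 * `|m|.
  by rewrite (_ : m + d + (m - d) = 2 * m) ?normrM ?(ger0_norm (ler0n R 2)) //; ring.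
by move=> h; rewrite ger0_norm; lra.
Qed.

Lemma norm_locally_affine x : x != 0 -> locally_affine (fun y : R => `|y|) x.
Proof.
move=> x0; exists `|x|, (Num.sg x), 0; split; first by rewrite normr_gt0.
move=> y yx; rewrite addr0; have [xp|xn|xE] := ltrgt0P x; last by rewrite xE eqxx in x0.
  rewrite gtr0_sg // mul1r ger0_norm //.
  by move: yx; rewrite ltr_norml (gtr0_norm xp) => /andP[]; lra.
rewrite ltr0_sg // mulN1r ler0_norm //.
by move: yx; rewrite ltr_norml (ltr0_norm xn) => /andP[]; lra.
Qed.

Lemma kink_function1 : kink_function 1 (fun y : R => `|y|).
Proof.
split => //.
- by move=> a b; exact: ler_dist_dist.
- by exists 2 => // m d; rewrite powRr1 //; exact: norm_second_difference.
- exists 1 => d d0; exists d, [:: 0]; split; rewrite ?d0 ?lexx //.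
    by rewrite subrr powRr0 mulr1.
  move=> x nx; exists 0; first by rewrite inE.
  have [->|x0] := eqVneq x 0; first by rewrite subrr normr0 ltW.
  by case: nx; exact: norm_locally_affine.
Qed.

Section Construction.
Variable lam : R.
Hypothesis lam01 : 0 < lam < 1 / 2.
Let c := 1 - lam.

Let lam0 : 0 < lam. Proof. by case/andP: lam01. Qed.
Let lamh : lam < 1 / 2. Proof. by case/andP: lam01. Qed.

(* The limit is the convolution of [|x|] with the self-similar probability
   measure on the Cantor set of ratio [lam] in [-1, 1]. *)
Fixpoint cantor_kink (n : nat) (x : R) : R :=
  if n is n'.+1 then
    lam / 2 * (cantor_kink n' ((x - c) / lam) + cantor_kink n' ((x + c) / lam))
  else `|x|.

Lemma normr_divl (x : R) : `|x / lam| = `|x| / lam.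
Proof. by rewrite normrM (ger0_norm (_ : 0 <= lam^-1)) // invr_ge0 ltW. Qed.

Lemma half_scale (x y : R) : lam / 2 * (x / lam + y / lam) = (x + y) / 2.
Proof. by field; rewrite gt_eqF. Qed.

(** For such [x] both [x - c] and [x + c] have modulus at least [lam], so the induction applies, and
    both have the sign of [x], so the average of their moduli is the modulus of [x]. *)
Lemma cantor_kink_far n x : 1 <= `|x| -> cantor_kink n x = `|x|.
Proof.
have lh := lamh; have l0 := lam0.
elim: n x => [//|n IH] x x1 /=.
have h1 := ler_normD (x - c) c; have h2 := ler_normD (x + c) (- c).
rewrite subrK in h1; rewrite addrK normrN in h2.
have cE : `|c| = c by rewrite ger0_norm // /c; lra.
have far (y : R) : lam <= `|y| -> 1 <= `|y / lam|.
  by move=> h; rewrite normr_divl ler_pdivlMr // mul1r.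
have cE' : c = 1 - lam by [].
rewrite cE in h1 h2.
have f1 : 1 <= `|(x - c) / lam| by apply: far; lra.
have f2 : 1 <= `|(x + c) / lam| by apply: far; lra.
rewrite !IH // !normr_divl half_scale.
have cl : c <= 1 by rewrite /c; lra.
have [x0|x0] := leP 0 x.
  rewrite ger0_norm // in x1 *.
  have p1 : 0 <= x - c by lra.
  have p2 : 0 <= x + c by lra.
  by rewrite !ger0_norm //; lra.
rewrite ltr0_norm // in x1 *.
have p1 : x - c <= 0 by lra.
have p2 : x + c <= 0 by lra.
by rewrite !ler0_norm //; lra.
Qed.

Lemma cantor_kink_ge n x : `|x| <= cantor_kink n x.
Proof.
elim: n x => [//|n IH] x /=.
apply: le_trans (_ : lam / 2 * (`|(x - c) / lam| + `|(x + c) / lam|) <= _); last first.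
  by rewrite ler_wpM2l ?lerD // divr_ge0 // ltW.
rewrite !normr_divl half_scale ler_pdivlMr //.
have := ler_normD (x - c) (x + c).
by rewrite (_ : x - c + (x + c) = x * 2) ?normrM ?(ger0_norm (ler0n R 2)) //; ring.
Qed.

Lemma cantor_kink_lipschitz n a b : `|cantor_kink n a - cantor_kink n b| <= `|a - b|.
Proof.
elim: n a b => [|n IH] a b /=; first exact: ler_dist_dist.
have l20 : 0 <= lam / 2 by rewrite divr_ge0 // ltW.
have E (p q p' q' : R) : lam / 2 * (p + q) - lam / 2 * (p' + q') =
    lam / 2 * ((p - p') + (q - q')) by ring.
rewrite E normrM ger0_norm //.
apply: le_trans (_ : lam / 2 * (`|a - b| / lam + `|a - b| / lam) <= _); last first.
  by rewrite half_scale; lra.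
rewrite ler_wpM2l // (le_trans (ler_normD _ _)) // lerD //.
  apply: le_trans (IH _ _) _; rewrite -mulrBl normr_divl.
  by rewrite (_ : a - c - (b - c) = a - b) //; ring.
apply: le_trans (IH _ _) _; rewrite -mulrBl normr_divl.
by rewrite (_ : a + c - (b + c) = a - b) //; ring.
Qed.

(** The first averaging raises the modulus by at most [c <= 1]; afterwards the recursion contracts
    differences by the factor [lam], which is below 1/2. *)
Lemma cantor_kink_step n x : `|cantor_kink n.+1 x - cantor_kink n x| <= 1 * 2^-1 ^+ n.
Proof.
have lh := lamh; have l0 := lam0.
rewrite mul1r; elim: n x => [|n IH] x.
  rewrite expr0 /= !normr_divl half_scale.
  have h1 := ler_normD (x - c) (x + c).
  rewrite (_ : x - c + (x + c) = x * 2) ?normrM ?(ger0_norm (ler0n R 2)) in h1; last by ring.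
  have h2 := ler_normD x c; have h3 := ler_normB x c.
  have cE : `|c| = c by rewrite ger0_norm // /c; lra.
  have cl : c <= 1 by rewrite /c; lra.
  by rewrite ger0_norm; lra.
rewrite -[cantor_kink n.+2 x]/(lam / 2 * (cantor_kink n.+1 ((x - c) / lam) +
  cantor_kink n.+1 ((x + c) / lam))).
rewrite -[X in _ - X]/(lam / 2 * (cantor_kink n ((x - c) / lam) +
  cantor_kink n ((x + c) / lam))).
have l20 : 0 <= lam / 2 by rewrite divr_ge0 // ltW.
have E (p q p' q' : R) : lam / 2 * (p + q) - lam / 2 * (p' + q') =
    lam / 2 * ((p - p') + (q - q')) by ring.
rewrite E normrM ger0_norm // exprS.
apply: le_trans (_ : lam / 2 * (2^-1 ^+ n + 2^-1 ^+ n) <= _).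
  by rewrite ler_wpM2l // (le_trans (ler_normD _ _)) // lerD.
rewrite (_ : _ * (_ + _) = lam * 2^-1 ^+ n); last by field.
rewrite ler_wpM2r ?exprn_ge0 ?invr_ge0 //.
by move: lamh; lra.
Qed.

Definition kink x : R := limn (cantor_kink ^~ x).

Lemma kink_cvg x : cantor_kink n x @[n --> \oo] --> kink x.
Proof. by have [] := geometric_limit ler01 (cantor_kink_step ^~ x). Qed.

Lemma kinkE x : kink x = lam / 2 * (kink ((x - c) / lam) + kink ((x + c) / lam)).
Proof.
have h : cantor_kink n.+1 x @[n --> \oo] --> kink x.
  by rewrite (cvg_shiftS (cantor_kink ^~ x)); exact: kink_cvg.
apply: (cvg_unique _ h) => //=; apply: cvgM; first exact: cvg_cst.
by apply: cvgD; exact: kink_cvg.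
Qed.

Lemma kink_far x : 1 <= `|x| -> kink x = `|x|.
Proof.
move=> x1; rewrite /kink (_ : cantor_kink ^~ x = fun=> `|x|); first exact: lim_cst.
by apply/funext => n; exact: cantor_kink_far.
Qed.

Lemma kink_ge x : `|x| <= kink x.
Proof.
apply: (cvgr_to_ge (@kink_cvg x)).
by apply: nearW => n; exact: cantor_kink_ge.
Qed.

Lemma kink_lipschitz a b : `|kink a - kink b| <= `|a - b|.
Proof.
have h : `|cantor_kink n a - cantor_kink n b| @[n --> \oo] --> `|kink a - kink b|.
  by apply: cvg_norm; apply: cvgB; exact: kink_cvg.
apply: (cvgr_to_le h); apply: nearW => n; exact: cantor_kink_lipschitz.
Qed.

Fixpoint kink_centers (n : nat) : seq R :=
  if n is n'.+1 then
    [seq lam * p + c | p <- kink_centers n'] ++ [seq lam * p - c | p <- kink_centers n']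
  else [:: 0].

Lemma size_kink_centers n : size (kink_centers n) = (2 ^ n)%N.
Proof.
by elim: n => [//|n IH]; rewrite /= size_cat !size_map IH addnn -mul2n expnS.
Qed.

Lemma kink_locally_affine_step x :
  locally_affine kink ((x - c) / lam) -> locally_affine kink ((x + c) / lam) ->
  locally_affine kink x.
Proof.
move=> [r [a [b [r0 H]]]] [r' [a' [b' [r'0 H']]]].
exists (lam * Num.min r r'), ((a + a') / 2),
  (lam / 2 * (b + b' - a * c / lam + a' * c / lam)).
split; first by rewrite mulr_gt0 // lt_min r0.
move=> y; rewrite mulrC -ltr_pdivrMr // -normr_divl lt_min => /andP[h h'].
rewrite kinkE H ?H'.
- by field; rewrite gt_eqF.
- by rewrite -mulrBl (_ : y + c - (x + c) = y - x) //; ring.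
- by rewrite -mulrBl (_ : y - c - (x - c) = y - x) //; ring.
Qed.

(** If [kink] is locally affine at both rescaled points it is so at [x]; hence a kink at [x] comes
    from a kink of at least one of the two half-size copies. At generation 0 the kinks lie in
    [-1, 1], because [kink] is the absolute value outside. *)
Lemma kink_centersP n x : ~ locally_affine kink x ->
  exists2 p, p \in kink_centers n & `|x - p| <= lam ^+ n.
Proof.
elim: n x => [|n IH] x nx.
  exists 0; first by rewrite inE.
  rewrite subr0 expr0 leNgt; apply/negP => x1; apply: nx.
  have x0 : x != 0 by rewrite -normr_gt0 (lt_trans _ x1).
  have [r [a [b [r0 H]]]] := norm_locally_affine x0.
  exists (Num.min r (`|x| - 1)), a, b; split; first by rewrite lt_min r0 subr_gt0.
  move=> y; rewrite lt_min => /andP[h1 h2]; rewrite -H // kink_far //.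
  have := ler_normD (x - y) y; rewrite subrK distrC; move: h2; lra.
have scale (y p : R) : `|y / lam - p| <= lam ^+ n -> `|y - lam * p| <= lam ^+ n.+1.
  move=> h; rewrite (_ : y - lam * p = lam * (y / lam - p)); last by field; rewrite gt_eqF.
  by rewrite normrM (gtr0_norm lam0) exprS ler_pM2l.
have [ha|ha] := pselect (locally_affine kink ((x - c) / lam)); last first.
  have [p pin /scale hp] := IH _ ha; exists (lam * p + c).
    by rewrite mem_cat; apply/orP; left; apply/mapP; exists p.
  by rewrite opprD addrA addrAC.
have [hb|hb] := pselect (locally_affine kink ((x + c) / lam)).
  by case: nx; exact: kink_locally_affine_step.
have [p pin /scale hp] := IH _ hb; exists (lam * p - c).
  by rewrite mem_cat; apply/orP; right; apply/mapP; exists p.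
by rewrite opprB addrA.
Qed.

Section Exponent.
Variable alpha : R.
Hypothesis alpha12 : 1 < alpha < 2.
Hypothesis lam_alpha : lam `^ (alpha - 1) = 2^-1.

Let K := 2 * (1 - 2 * lam) `^ (1 - alpha).
Let K0 : 0 <= K. Proof. by rewrite mulr_ge0 // powR_ge0. Qed.

Let alpha1 : 1 < alpha. Proof. by case/andP: alpha12. Qed.

(** This is the exact scaling: [lam_alpha] says lam^alpha = lam / 2, so the weight of one copy
    compensates its dilation. *)
Lemma lam_powR (x : R) : 0 <= x -> lam / 2 * (x / lam) `^ alpha = x `^ alpha.
Proof.
move=> x0; rewrite powRM ?invr_ge0 ?(ltW lam0) //.
have -> : lam^-1 `^ alpha = (lam `^ alpha)^-1.
  by rewrite -(powR_inv1 (ltW lam0)) powRAC -powRrM mulrN1 powRN.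
rewrite -(mulr_powRB1 (ltW lam0)) ?(lt_trans ltr01) // lam_alpha.
by field; rewrite gt_eqF.
Qed.

(** [K] is chosen so that the Lipschitz bound 2 |d| is enough once |d| >= 1 - 2 lam, the half-width
    of the central gap. For smaller [d] the window around [m] meets at most one copy nontrivially:
    the other copy is affine there and drops out, and [lam_powR] reproduces the same [K] for the
    remaining one. The extra term pays for the kink of the absolute value at generation 0 and at
    least halves at each step. *)
Lemma cantor_kink_second_difference n m d :
  `|cantor_kink n (m + d) + cantor_kink n (m - d) - 2 * cantor_kink n m|
     <= K * `|d| `^ alpha + 4 * 2^-1 ^+ n.
Proof.
have lh := lamh; have l0 := lam0.
have gap : 0 < 1 - 2 * lam by lra.
have Lip k y e : `|cantor_kink k (y + e) + cantor_kink k (y - e) - 2 * cantor_kink k y|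
    <= 2 * `|e|.
  rewrite (_ : _ - _ = (cantor_kink k (y + e) - cantor_kink k y) +
     (cantor_kink k (y - e) - cantor_kink k y)); last by ring.
  have h1 := cantor_kink_lipschitz k (y + e) y.
  have h2 := cantor_kink_lipschitz k (y - e) y.
  rewrite addrAC subrr add0r in h1; rewrite addrAC subrr add0r normrN in h2.
  by apply: le_trans (ler_normD _ _) _; lra.
have big k y e : 1 - 2 * lam <= `|e| ->
    `|cantor_kink k (y + e) + cantor_kink k (y - e) - 2 * cantor_kink k y|
    <= K * `|e| `^ alpha.
  move=> he; apply: le_trans (Lip k y e) _; rewrite /K -mulrA ler_wpM2l //.
  have e0 : 0 < `|e| by exact: lt_le_trans he.
  have -> : `|e| `^ alpha = `|e| * `|e| `^ (alpha - 1).
    by rewrite mulr_powRB1 // (lt_trans ltr01).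
  rewrite mulrCA ler_peMr ?(ltW e0) //.
  rewrite (_ : 1 - alpha = - (alpha - 1)); last by ring.
  rewrite powRN mulrC ler_pdivlMr ?powR_gt0 // mul1r.
  by apply: ge0_ler_powR; rewrite ?nnegrE ?(ltW gap) // subr_ge0 ltW.
have lin k y e : `|e| <= `|y| - 1 -> 
    cantor_kink k (y + e) + cantor_kink k (y - e) - 2 * cantor_kink k y = 0.
  move=> h; have e0 := normr_ge0 e.
  have h1 := ler_normD (y + e) (- e); rewrite addrK normrN in h1.
  have h2 := ler_normD (y - e) e; rewrite subrK in h2.
  rewrite !cantor_kink_far; [|lra..].
  have [/andP[e1 e2]] : - `|e| <= e <= `|e| /\ True by split=> //; rewrite -ler_norml.
  have [y0|y0] := leP 0 y.
    rewrite (ger0_norm y0) in h.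
    have q1 : 0 <= y + e by lra.
    have q2 : 0 <= y - e by lra.
    by rewrite (ger0_norm q1) (ger0_norm q2) (ger0_norm y0); lra.
  rewrite (ltr0_norm y0) in h.
  have q1 : y + e <= 0 by lra.
  have q2 : y - e <= 0 by lra.
  by rewrite (ler0_norm q1) (ler0_norm q2) (ltr0_norm y0); lra.
elim: n m d => [|n IH] m d.
  have [h|h] := leP (1 - 2 * lam) `|d|.
    by apply: le_trans (big _ _ _ h) _; rewrite lerDl mulr_ge0 // exprn_ge0 // invr_ge0.
  apply: le_trans (Lip _ _ _) _; rewrite expr0.
  have : 0 <= K * `|d| `^ alpha by rewrite mulr_ge0 ?powR_ge0.
  by move: lam0 h; lra.
have [h|h] := leP (1 - 2 * lam) `|d|.
  by apply: le_trans (big _ _ _ h) _; rewrite lerDl mulr_ge0 // exprn_ge0 // invr_ge0.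
set D := fun y e => cantor_kink n (y + e) + cantor_kink n (y - e) - 2 * cantor_kink n y.
have -> : cantor_kink n.+1 (m + d) + cantor_kink n.+1 (m - d) - 2 * cantor_kink n.+1 m =
    lam / 2 * (D ((m - c) / lam) (d / lam) + D ((m + c) / lam) (d / lam)).
  rewrite /D /= -!mulrDl -!mulrBl.
  rewrite !(addrAC m (- c)) !(addrAC m c).
  by ring.
have l20 : 0 <= lam / 2 by rewrite divr_ge0 // ltW.
have main y : lam / 2 * `|D y (d / lam)| <= K * `|d| `^ alpha + 4 * 2^-1 ^+ n.+1.
  apply: le_trans (ler_wpM2l l20 (IH y (d / lam))) _.
  rewrite mulrDr mulrCA normr_divl lam_powR // lerD2l exprS.
  have p0 : 0 <= 2^-1 ^+ n :> R by rewrite exprn_ge0 // invr_ge0.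
  rewrite [leRHS]mulrA [leLHS]mulrA ler_wpM2r //; move: lamh; lra.
rewrite normrM (ger0_norm l20).
have cE : c = 1 - lam by [].
have [m0|m0] := leP 0 m.
  rewrite [D ((m + c) / lam) _]lin ?addr0 //.
  rewrite !normr_divl -[X in _ - X](divff (lt0r_neq0 lam0)) -mulrBl.
  have q : 0 <= m + c by lra.
  by rewrite ler_wpM2r ?invr_ge0 ?(ltW lam0) // (ger0_norm q); lra.
rewrite [D ((m - c) / lam) _]lin ?add0r //.
rewrite !normr_divl -[X in _ - X](divff (lt0r_neq0 lam0)) -mulrBl.
have q : m - c <= 0 by lra.
by rewrite ler_wpM2r ?invr_ge0 ?(ltW lam0) // (ler0_norm q); lra.
Qed.

Lemma kink_kink_function : kink_function alpha kink.
Proof.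
split.
- exact: kink_lipschitz.
- exists K => // m d.
  have h : `|cantor_kink n (m + d) + cantor_kink n (m - d) - 2 * cantor_kink n m|
      @[n --> \oo] --> `|kink (m + d) + kink (m - d) - 2 * kink m|.
    apply: cvg_norm; apply: cvgB.
      by apply: cvgD; exact: kink_cvg.
    by apply: cvgM; [exact: cvg_cst|exact: kink_cvg].
  have h' : K * `|d| `^ alpha + 4 * 2^-1 ^+ n @[n --> \oo] --> K * `|d| `^ alpha.
    rewrite -[X in _ --> X]addr0; apply: cvgD; first exact: cvg_cst.
    exact: geometric_cvg0.
  apply: (ler_cvg_to h h'); apply: nearW => n; exact: cantor_kink_second_difference.
- exact: kink_far.
- exact: kink_ge.
exists 1 => d d0.
have : lam ^+ n @[n --> \oo] --> (0 : R).
  have := @cvg_geometric R 1 lam; rewrite gtr0_norm // (_ : geometric 1 lam = (fun n => lam ^+ n)).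
    by apply; move: lamh; lra.
  by apply/funext => n; rewrite /geometric /= mul1r.
move=> /cvgrPdist_lt/(_ _ d0)[n _ /(_ n (leqnn n))] /=.
have ln0 : 0 < lam ^+ n by rewrite exprn_gt0.
rewrite sub0r normrN gtr0_norm // => lnd.
exists (lam ^+ n), (kink_centers n); split.
- by rewrite ln0 ltW.
- rewrite size_kink_centers natrX -(powR_mulrn n (ltW lam0)) powRAC lam_alpha.
  by rewrite powR_mulrn ?invr_ge0 // -exprMn divff // expr1n.
- exact: kink_centersP.
Qed.

End Exponent.
End Construction.

Lemma kink_function_exists (alpha : R) : 1 <= alpha < 2 -> exists V, kink_function alpha V.
Proof.
move=> /andP[a1 a2]; move: a1; rewrite le_eqVlt => /predU1P[<-|a1].
  by eexists; exact: kink_function1.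
have b0 : 0 < alpha - 1 by rewrite subr_gt0.
(* The two copies of ratio lam then give dimension alpha - 1. As lam < 1 and alpha - 1 < 1, lam <
   lam^(alpha - 1) = 1/2. *)
pose lam := (2^-1 : R) `^ (alpha - 1)^-1.
have h0 : 0 < 2^-1 :> R by rewrite invr_gt0.
have lam_alpha : lam `^ (alpha - 1) = 2^-1.
  by rewrite /lam -powRrM mulVf ?gt_eqF // powRr1 // ltW.
have lam01 : 0 < lam < 1 / 2.
  rewrite powR_gt0 // mul1r -[X in _ < X]lam_alpha.
  have : lam `^ 1 < lam `^ (alpha - 1); last by rewrite powRr1 // powR_ge0.
  have l0 : 0 < lam by rewrite powR_gt0.
  have l1 : lam < 1.
    have e1 : (1 : R) `^ (alpha - 1)^-1 = 1 by rewrite powR1.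
    rewrite /lam -[X in _ < X]e1.
    by apply: gt0_ltr_powR; rewrite ?nnegrE ?invr_gt0 // ?ltW // invf_lt1 // ltr1n.
  rewrite /powR gt_eqF // ltr_expR ltr_nM2r ?ln_lt0 ?l0 //; lra.
by exists (kink lam); apply: kink_kink_function => //; rewrite a1.
Qed.

End CantorKink.

(** * The radial example for exponents at least 1 *)

Section RadialExample.
Context {R : realType}.
Local Notation C := R[i]^o.
Implicit Types (z w : C).

Lemma normc_lt_of_nonvanishing (a b : C) :
  (forall t : C, normc t <= 1 -> a + t * b != 0) -> normc b < normc a.
Proof.
move=> H; rewrite ltNge; apply/negP => ab.
have [b0|b0] := eqVneq b 0.
  have := H 0; rewrite normc_zero ler01 mul0r addr0 => /(_ isT).
  by rewrite -normc_eq0 eq_le normc_ge0 (le_trans ab) // b0 normc_zero.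
have := H (- (a / b)); rewrite normc_opp normc_mul ComplexField.Normc.normcV.
rewrite ler_pdivrMr ?mul1r ?normc_gt0 // => /(_ ab).
by rewrite mulNr divfK // subrr eqxx.
Qed.

Lemma circle_mean_affine_ln (k l : R) (a b : C) : normc b < normc a ->
  circle_mean (fun t => k * ln (normc (a + expi t * b)) + l) = k * ln (normc a) + l.
Proof.
move=> ba; have cl := ln_circle_continuous ba.
rewrite circle_meanD; last exact: cst_continuous.
  by rewrite circle_meanZ // circle_mean_cst circle_mean_ln_normc.
by move=> t; apply: cvgM; [exact: cvg_cst|exact: cl].
Qed.

Lemma expR_lipschitz (G a b : R) : a <= G -> b <= G ->
  `|expR a - expR b| <= expR G * `|a - b|.
Proof.
wlog ab : a b / b <= a => [H|aG bG].
  by case/orP: (le_total b a) => ?; [|rewrite distrC [X in _ * X]distrC]; eauto.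
rewrite !ger0_norm ?subr_ge0 ?ler_expR //.
apply: le_trans (_ : expR a * (a - b) <= _); last first.
  by rewrite ler_wpM2r ?subr_ge0 // ler_expR.
have := expR_ge1Dx (b - a); rewrite expRB ler_pdivlMr ?expR_gt0 //; lra.
Qed.

Lemma zclass_sqr_normc (z0 : C) (r : R) : 0 <= r ->
  zclass (fun z : C => normc z) 2 [set z | normc (z - z0) < r] (fun z => normc z ^+ 2).
Proof.
move=> r0; pose D := normc z0 + r.
have D0 : 0 <= D by rewrite addr_ge0 // normc_ge0.
have SD z : normc (z - z0) < r -> normc z <= D.
  by move=> h; rewrite -[z](subrK z0) (le_trans (normcD _ _)) // addrC lerD2l ltW.
exists (2 * D + 2); first by rewrite addr_ge0 // mulr_ge0.
move=> x h /= /SD Sx /SD Sp /SD Sm; rewrite divff ?pnatr_eq0 // powRr1 ?normc_ge0 //.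
have p2 : normc h `^ 2 = normc h ^+ 2 by rewrite powR_mulrn ?normc_ge0.
split.
  rewrite subr_sqr normrM mulrC.
  have d := normc_dist (x + h) x; rewrite addrAC subrr add0r in d.
  apply: ler_pM => //; have h1 := normc_ge0 (x + h); have h2 := normc_ge0 x.
  rewrite ger0_norm; lra.
rewrite p2 normc_parallelogram addrAC subrr add0r ger0_norm; last first.
  by rewrite mulr_ge0 // sqr_ge0.
by rewrite ler_wpM2r ?sqr_ge0 // lerDr mulr_ge0.
Qed.

Lemma ln_normc_continuous z : z != 0 -> {for z, continuous (fun w : C => ln (normc w))}.
Proof.
move=> z0; apply: (continuous_comp (f := fun z : C => normc z) (g := @ln R)).
  exact: normc_continuous.
by apply: continuous_ln; rewrite normc_gt0.
Qed.

Section Fixed.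
Variables (alpha : R) (V : R -> R).
Hypothesis alpha12 : 1 <= alpha < 2.
Hypothesis HV : kink_function alpha V.

Let v (t : R) := V t + t.

(** [v] vanishes on all reals at most -1, so the value 0 at the origin extends a function that
    vanishes on the punctured disc of radius [expR (- 1)]. *)
Definition radial_kink z : R := if z == 0 then 0 else v (ln (normc z)).

Let g := radial_kink.

Lemma radial_kink0 z : normc z <= expR (- 1) -> g z = 0.
Proof.
rewrite /g /radial_kink; case: eqVneq => // z0 h; have [_ _ far _ _] := HV.
have l1 : ln (normc z) <= -1 by rewrite -[leRHS]expRK ler_ln ?posrE ?expR_gt0 ?normc_gt0.
by rewrite /v far ler0_norm; lra.
Qed.

Lemma radial_kinkE z : z != 0 -> g z = v (ln (normc z)).
Proof. by rewrite /g /radial_kink => /negPf ->. Qed.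

Lemma radial_kink_ge0 z : 0 <= g z.
Proof.
rewrite /g /radial_kink; case: eqVneq => // _; have [_ _ _ ge _] := HV.
have h1 := ge (ln (normc z)); have h2 := ler_norm (- ln (normc z)).
by rewrite normrN in h2; rewrite /v; lra.
Qed.

Lemma kink_v_lipschitz a b : `|v a - v b| <= 2 * `|a - b|.
Proof.
have [Lip _ _ _ _] := HV; have h := Lip a b.
rewrite (_ : v a - v b = (V a - V b) + (a - b)); last by rewrite /v; ring.
by apply: le_trans (ler_normD _ _) _; lra.
Qed.

Lemma kink_v_continuous : continuous v.
Proof.
move=> x; apply/cvgrPdist_lt => e e0; apply/nbhs_ballP.
exists (e / 2); first exact: divr_gt0.
move=> y; rewrite /ball /= => xy; apply: le_lt_trans (kink_v_lipschitz _ _) _.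
by rewrite mulrC -ltr_pdivlMr.
Qed.

Lemma near_zero_radial_kink z0 : normc z0 < expR (- 1) ->
  forall z, normc (z - z0) < expR (- 1) - normc z0 -> g z = 0.
Proof.
move=> h z hz; apply: radial_kink0; rewrite -[z](subrK z0).
by apply: le_trans (normcD _ _) _; rewrite -lerBrDr ltW.
Qed.

Lemma nonzero_radius z0 : expR (- 1) <= normc z0 ->
  forall z, normc (z - z0) < expR (- 1) / 2 -> expR (- 1) / 2 <= normc z.
Proof.
move=> h z hz; have := normcD (z0 - z) z; rewrite subrK normcBC; lra.
Qed.

Lemma radial_kink_continuous : continuous g.
Proof.
move=> z0; have e0 : 0 < expR (- 1) :> R by exact: expR_gt0.
have [h|h] := ltP (normc z0) (expR (- 1)).
  apply/(cvgrPdist_lt (FF := nbhs_filter z0)) => e ep; apply/nbhs_cplxP.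
  exists (expR (- 1) - normc z0); first by rewrite subr_gt0.
  move=> z hz; rewrite (near_zero_radial_kink h hz) (near_zero_radial_kink h).
    by rewrite subrr normr0.
  by rewrite subrr normc_zero subr_gt0.
have z00 : z0 != 0 by rewrite -normc_gt0 (lt_le_trans e0).
have cont : v (ln (normc z)) @[z --> z0] --> v (ln (normc z0)).
  apply: (continuous_comp (f := fun z : C => ln (normc z)) (g := v)).
    exact: ln_normc_continuous.
  exact: kink_v_continuous.
apply/(cvgrPdist_lt (FF := nbhs_filter z0)) => e ep.
have /(cvgrPdist_lt (FF := nbhs_filter z0))/(_ e ep)/nbhs_cplxP[d d0 dH] := cont.
apply/nbhs_cplxP; exists (Num.min d (expR (- 1) / 2)).
  by rewrite lt_min d0 divr_gt0.
move=> z; rewrite lt_min => /andP[h1 h2]; rewrite !radial_kinkE //; first exact: dH.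
by rewrite -normc_gt0 (lt_le_trans _ (nonzero_radius h h2)) // divr_gt0.
Qed.

(** Near small [z0] the function is 0. Elsewhere log |z|^2 is smooth, obtained from the quadratic
    function |z|^2 by [ln_C11], and the only rough ingredient [V] acts from outside. *)
Lemma radial_kink_zclass z0 : exists2 r : R, 0 < r &
  zclass (fun z : C => normc z) alpha [set z | normc (z - z0) < r] g.
Proof.
have e0 : 0 < expR (- 1) :> R by exact: expR_gt0.
have [h|h] := ltP (normc z0) (expR (- 1)).
  exists (expR (- 1) - normc z0); first by rewrite subr_gt0.
  exists 0 => // x k /= Sx Sp Sm; rewrite !(near_zero_radial_kink h) // mulr0.
  by rewrite addr0 subrr normr0 !mul0r.
have e1 : expR (- 1) <= 1 :> R by rewrite -[leRHS]expR0 ler_expR; lra.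
pose c := (expR (- 1) / 2 : R) ^+ 2.
have h2 : 0 < expR (- 1) / 2 :> R by rewrite divr_gt0.
have c01 : 0 < c <= 1.
  by apply/andP; split; [exact: exprn_gt0|apply: exprn_ile1; lra].
exists (expR (- 1) / 2) => //.
pose S := [set z : C | normc (z - z0) < expR (- 1) / 2].
have Sh x k : S x -> S (x + k) -> normc k <= 1.
  rewrite /S /= => Sx Sp; have := normcD (x + k - z0) (- (x - z0)).
  by rewrite normc_opp (_ : x + k - z0 - (x - z0) = k); [lra|ring].
have Sc x : S x -> c <= normc x ^+ 2.
  by move=> Sx; rewrite /c ler_pXn2r ?nnegrE ?normc_ge0 ?(ltW h2) //; exact: nonzero_radius Sx.
have nN (k : C) : normc (- k) = normc k by exact: normc_opp.
have zq := zclass_sqr_normc z0 (ltW h2).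
have zl : zclass (fun z : C => normc z) 2 S (fun z => ln (normc z ^+ 2)).
  apply: (zclass_comp (psi := @ln R) (psi' := fun y => y^-1) (J := [set y | c <= y])
    nN _ zq Sc); last first.
    by move=> a b /=; exact: ln_C11.
  by rewrite invr_ge0 exprn_ge0 // ltW; case/andP: c01.
have [Lip [K K0 HK] _ _ _] := HV.
have a0 : 0 < alpha by case/andP: alpha12 => + _; apply: lt_le_trans.
have a2 : 0 < alpha <= 2 by rewrite a0 ltW //; case/andP: alpha12.
(* The halving undoes the square inside the logarithm. The linear summand of [v] has zero second
   difference, so the constant [K] of [V] still serves. *)
have zv := @zclass_outer R C (fun z : C => normc z) (fun z => normc_ge0 z) nN alpha S _
  (fun y => v (y / 2)) K a2 K0 Sh zl.
apply: (zclass_eq _ (zv _ _)).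
- move=> x; rewrite inE => Sx; have x0 : 0 < normc x.
    by apply: lt_le_trans (nonzero_radius h Sx).
  by rewrite radial_kinkE -?normc_gt0 // lnXn // (_ : ln (normc x) *+ 2 / 2 = ln (normc x)) //; field.
- move=> a b; apply: le_trans (kink_v_lipschitz _ _) _.
  by rewrite -mulrBl normrM (ger0_norm (_ : 0 <= 2^-1)) ?invr_ge0 // mulrCA mulfV ?mulr1 ?pnatr_eq0.
move=> m d; rewrite !mulrDl mulNr.
rewrite (_ : _ - _ = V (m / 2 + d / 2) + V (m / 2 - d / 2) - 2 * V (m / 2));
  last by rewrite /v; ring.
apply: le_trans (HK _ _) _; rewrite ler_wpM2l //.
apply: ge0_ler_powR; rewrite ?nnegrE ?(ltW a0) //.
by rewrite normrM (ger0_norm (_ : 0 <= 2^-1)) ?invr_ge0 // ler_pdivrMr // ler_peMr // ler1n.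
Qed.

(** Where [V] is affine in log |z|, [g] is an affine function of log |z|, hence harmonic; near the
    origin it is 0. *)
Lemma radial_kink_not_superharmonic z0 : ~ superharmonic_near g z0 ->
  z0 != 0 /\ ~ locally_affine V (ln (normc z0)).
Proof.
move=> ns; have e0 : 0 < expR (- 1) :> R by exact: expR_gt0.
have z00 : z0 != 0.
  apply/eqP => zE; apply: ns; rewrite zE.
  have h : normc (0 : C) < expR (- 1) by rewrite normc_zero.
  exists (expR (- 1) - normc (0 : C)); first by rewrite subr_gt0.
  move=> a b ab; rewrite (_ : (fun t => _) = fun=> 0).
    by rewrite circle_mean_cst radial_kink_ge0.
  apply/funext => t; apply: (near_zero_radial_kink h).
  by apply: ab; rewrite normc_expi.
split=> // -[r [k [l [r0 H]]]]; apply: ns.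
have /(cvgrPdist_lt (FF := nbhs_filter z0))/(_ r r0)/nbhs_cplxP[d d0 dH] :=
  ln_normc_continuous z00.
have n0 : 0 < normc z0 by rewrite normc_gt0.
exists (Num.min d (normc z0)); first by rewrite lt_min d0.
move=> a b ab.
have nz w : normc (w - z0) < Num.min d (normc z0) -> w != 0.
  rewrite lt_min => /andP[_ h]; apply: contraTneq h => ->.
  by rewrite sub0r normc_opp ltxx.
have gE w : normc (w - z0) < Num.min d (normc z0) -> g w = (k + 1) * ln (normc w) + l.
  move=> h; rewrite radial_kinkE ?nz //.
  move: h; rewrite lt_min => /andP[h _].
  by rewrite /v H; [ring|rewrite distrC dH].
have ba : normc b < normc a.
  by apply: normc_lt_of_nonvanishing => t /ab; exact: nz.
have ga : g a = (k + 1) * ln (normc a) + l.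
  by apply: gE; rewrite -[a]addr0 -(mul0r b); apply: ab; rewrite normc_zero.
rewrite ga -(circle_mean_affine_ln _ _ ba).
rewrite (_ : (fun t => _) = (fun t => (k + 1) * ln (normc (a + expi t * b)) + l)) //.
by apply/funext => t; apply: gE; apply: ab; rewrite normc_expi.
Qed.

Lemma not_locally_affine_le1 x : ~ locally_affine V x -> `|x| <= 1.
Proof.
move=> nx; rewrite leNgt; apply/negP => x1; apply: nx.
have [_ _ far _ _] := HV.
have x0 : x != 0 by rewrite -normr_gt0 (lt_trans _ x1).
have [r [a [b [r0 H]]]] := norm_locally_affine x0.
exists (Num.min r (`|x| - 1)), a, b; split; first by rewrite lt_min r0 subr_gt0.
move=> y; rewrite lt_min => /andP[h1 h2]; rewrite -H // far //.
have := ler_normD (x - y) y; rewrite subrK distrC; move: h2; lra.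
Qed.

(** V x <= V 1 + |x - 1| <= 4, and x <= 2. The interval [-2, 2] contains the kinks and the centres
    of their covers by radii at most 1. *)
Lemma kink_v_le x : `|x| <= 2 -> v x <= 6.
Proof.
move=> x2; have [Lip _ far _ _] := HV.
have V1 : V 1 = 1 by rewrite far ?normr1.
have h1 := Lip x 1; rewrite V1 in h1.
have h2 := ler_norm (V x - 1); have h3 := ler_normB x 1; rewrite normr1 in h3.
by have := ler_norm x; rewrite /v; lra.
Qed.

(** Each interval of log-radii is multiplied by an [r]-net of the circle with about [17 / r] points:
    this raises the critical exponent from alpha - 1 to alpha. *)
Lemma radial_kink_cover : exists K : R, forall d : R, 0 < d ->
  exists (r : R) (l : seq (C * R)),
    [/\ 0 < r <= d, (size l)%:R * r `^ alpha <= K &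
        forall z, ~ superharmonic_near g z -> exists2 c, c \in l &
          normc (z - c.1) <= r /\ `|expR (g z) - c.2| <= r].
Proof.
have [Lip _ far _ [K0 HK]] := HV.
have a1 : 1 <= alpha by case/andP: alpha12.
have a0 : 0 < alpha by exact: lt_le_trans a1.
(* It bounds both errors: in position, two terms of at most [expR 2 * r]; in fibre radius, the
   Lipschitz constant 2 of [v] times that of [expR] below 6. *)
pose A : R := 2 * expR 6.
have A0 : 0 < A by rewrite mulr_gt0 // expR_gt0.
exists (A `^ alpha * (K0 * 17)) => d d0.
pose d' := Num.min 1 (d / A).
have d'0 : 0 < d' by rewrite lt_min ltr01 divr_gt0.
have [r [l [/andP[r0 rd'] lK cov]]] := HK _ d'0.
have r1 : r <= 1 by apply: le_trans rd' _; rewrite ge_min lexx.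
have rd : r <= d / A by apply: le_trans rd' _; rewrite ge_min lexx orbT.
have [lc [lc17 ccov]] := @circle_cover R r (introT andP (conj r0 r1)).
exists (A * r), [seq ((expR p)%:C%C * w, expR (v p)) | p <- l, w <- lc]; split.
- by rewrite mulr_gt0 //= mulrC -ler_pdivlMr.
- rewrite size_allpairs powRM ?(ltW r0) ?(ltW A0) // natrM mulrCA ler_wpM2l ?powR_ge0 //.
  rewrite -(mulr_powRB1 (ltW r0) a0).
  rewrite [leLHS](_ : _ = ((size l)%:R * r `^ (alpha - 1)) * ((size lc)%:R * r)); last by ring.
  by rewrite ler_pM // mulr_ge0 // ?powR_ge0 // ltW.
move=> z /radial_kink_not_superharmonic[z0 nx].
have [p pl tp] := cov _ nx; have t1 := not_locally_affine_le1 nx.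
set t := ln (normc z) in nx tp t1.
have n0 : 0 < normc z by rewrite normc_gt0.
have zt : normc z = expR t by rewrite lnK // posrE.
pose u : C := (normc z)^-1%:C%C * z.
have u1 : normc u = 1.
  by rewrite normc_mul normc_real ger0_norm ?invr_ge0 ?normc_ge0 // mulVf // gt_eqF.
have zu : z = (expR t)%:C%C * u.
  by rewrite /u -zt mulrA -rmorphM mulfV ?gt_eqF // rmorph1 mul1r.
have [w [wlc w1 uw]] := ccov _ u1.
exists ((expR p)%:C%C * w, expR (v p)); first by apply/allpairsP; exists (p, w).
have p2 : `|p| <= 2.
  have := ler_normD (p - t) t; rewrite subrK distrC; lra.
have t2 : `|t| <= 2 by lra.
have e6 : expR 2 <= expR 6 :> R by rewrite ler_expR; lra.
have p2' : p <= 2 by apply: le_trans (ler_norm _) p2.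
have t2' : t <= 2 by apply: le_trans (ler_norm _) t2.
have e60 : 0 < expR 6 :> R by exact: expR_gt0.
split=> /=.
  rewrite {1}zu.
  rewrite [X in normc X](_ : _ = (expR t)%:C%C * (u - w) +
    ((expR t)%:C%C - (expR p)%:C%C) * w); last by ring.
  apply: le_trans (normcD _ _) _.
  rewrite !normc_mul normc_realB w1 mulr1 normc_real ger0_norm ?expR_ge0 //.
  rewrite (_ : A * r = expR 6 * r + expR 6 * r); last by rewrite /A; ring.
  rewrite lerD //.
    by rewrite ler_pM ?normc_ge0 ?expR_ge0 // ler_expR; lra.
  apply: le_trans (expR_lipschitz t2' p2') _.
  by rewrite ler_pM ?expR_ge0.
rewrite radial_kinkE // -/t.
apply: le_trans (expR_lipschitz (kink_v_le t2) (kink_v_le p2)) _.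
rewrite (_ : A * r = expR 6 * (2 * r)); last by rewrite /A; ring.
rewrite ler_wpM2l ?(ltW e60) //.
by apply: le_trans (kink_v_lipschitz _ _) _; rewrite ler_pM2l.
Qed.

Lemma radial_kink_le z : ~ superharmonic_near g z -> expR (g z) <= expR 6.
Proof.
move=> /radial_kink_not_superharmonic[z0 /not_locally_affine_le1 t1].
by rewrite ler_expR radial_kinkE // kink_v_le // (le_trans t1) // ler1n.
Qed.

Lemma radial_kink_pos z : normc (z - 0) = expR 1 -> 0 < g z.
Proof.
rewrite subr0 => zE; have [_ _ far _ _] := HV.
have z0 : z != 0 by rewrite -normc_gt0 zE expR_gt0.
by rewrite radial_kinkE // zE expRK /v far ?normr1 // addr_gt0.
Qed.

End Fixed.
End RadialExample.

Lemma counterexample_ge1 (R : realType) (alpha : R) : 1 <= alpha < 2 ->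
  removability_fails alpha.
Proof.
move=> a12; have [V HV] := kink_function_exists a12.
have [K cov] := radial_kink_cover a12 HV.
have a02 : 0 < alpha < 2 by case/andP: a12 => a1 ->; rewrite (lt_le_trans _ a1).
apply: (hartogs_counterexample (B := expR 6) (K := K) (g := radial_kink V) (z0 := 0)
  (rho := expR 1)) => //.
- exact: radial_kink_continuous HV.
- exact: radial_kink_ge0 HV.
- exact: radial_kink_zclass a12 HV.
- by rewrite /radial_kink eqxx.
- exact: radial_kink_pos HV.
- exact: radial_kink_le HV.
Qed.

(** * Harmonicity of log |p| and roots near 1 *)

Section LogPolynomial.
Context {R : realType}.
Local Notation C := R[i]^o.

Lemma circle_mean_ln_prod (c a b : C) (s : seq R[i]) : c != 0 ->
  (forall r, r \in s -> normc b < normc (a - r)) ->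
  continuous (fun t : R => ln (normc (c * \prod_(r <- s) (a + expi t * b - r) : C))) /\
  circle_mean (fun t : R => ln (normc (c * \prod_(r <- s) (a + expi t * b - r) : C))) =
    ln (normc (c * \prod_(r <- s) (a - r) : C)).
Proof.
move=> c0; elim: s => [|x s IH] H.
  rewrite !big_nil !mulr1.
  have -> : (fun t : R => ln (normc (c * \prod_(r <- [::]) (a + expi t * b - r) : C))) =
      fun=> ln (normc c).
    by apply/funext => t; rewrite big_nil mulr1.
  by split; [exact: cst_continuous|exact: circle_mean_cst].
have [r rs|IH1 IH2] := IH; first by apply: H; rewrite inE rs orbT.
have xb : normc b < normc (a - x) by apply: H; rewrite inE eqxx.
have nz (y t : C) : normc t <= 1 -> normc b < normc (a - y) -> a + t * b - y != 0.
  move=> t1 yb; rewrite addrAC -normc_gt0.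
  have := normcD (a - y + t * b) (- (t * b)); rewrite addrK normc_opp normc_mul.
  have : normc t * normc b <= normc b by rewrite ler_piMl ?normc_ge0.
  by move: yb; lra.
have prod0 (t : C) : normc t <= 1 -> c * \prod_(r <- s) (a + t * b - r) != 0.
  move=> t1; rewrite mulf_neq0 // prodf_seq_neq0; apply/allP => r rs /=.
  by apply: nz => //; apply: H; rewrite inE rs orbT.
have E (t : C) : normc t <= 1 ->
    ln (normc (c * \prod_(r <- x :: s) (a + t * b - r) : C)) =
    ln (normc (a - x + t * b)) + ln (normc (c * \prod_(r <- s) (a + t * b - r) : C)).
  move=> t1; rewrite -lnM ?posrE ?normc_gt0 ?prod0 //; last by rewrite addrAC nz.
  by rewrite -normc_mul big_cons mulrCA [a - x + t * b]addrAC.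
have e1 (t : R) : normc (expi t) <= 1 by rewrite normc_expi.
have -> : (fun t : R => ln (normc (c * \prod_(r <- x :: s) (a + expi t * b - r) : C))) =
    (fun t : R => ln (normc (a - x + expi t * b)) +
       ln (normc (c * \prod_(r <- s) (a + expi t * b - r) : C))).
  by apply/funext => t; exact: E.
have cl := ln_circle_continuous xb.
split; first by move=> t; apply: cvgD; [exact: cl|exact: IH1].
rewrite circle_meanD // IH2 circle_mean_ln_normc //.
have := E 0; rewrite normc_zero mul0r !addr0 => /(_ ler01) ->; congr (_ + _).
Qed.

(** Factor [p] into linear terms: no root lies in the closed disc, so the mean value property of log
    |z| applies to each factor. *)
Lemma circle_mean_ln_poly (p : {poly R[i]}) (a b : C) :
  (forall t : C, normc t <= 1 -> p.[a + t * b] != 0) ->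
  continuous (fun t : R => ln (normc (p.[a + expi t * b] : C))) /\
  circle_mean (fun t : R => ln (normc (p.[a + expi t * b] : C))) = ln (normc (p.[a] : C)).
Proof.
move=> H; have [s pE] := closed_field_poly_normal p.
have pa (x : C) : p.[x] = lead_coef p * \prod_(r <- s) (x - r).
  rewrite {1}pE hornerZ horner_prod; congr (_ * _); apply: eq_bigr => r _.
  by rewrite hornerXsubC.
have l0 : lead_coef p != 0.
  rewrite lead_coef_eq0; apply/eqP => p0.
  by have := H 0; rewrite p0 horner0 eqxx normc_zero ler01 => /(_ isT).
have rb r : r \in s -> normc b < normc (a - r : C).
  move=> rs; apply: normc_lt_of_nonvanishing => t t1.
  apply: contraNneq (H t t1) => h; rewrite pa (big_rem r) //=.
  by rewrite addrAC h mul0r mulr0.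
have -> : (fun t : R => ln (normc (p.[a + expi t * b] : C))) =
    (fun t : R => ln (normc (lead_coef p * \prod_(r <- s) (a + expi t * b - r) : C))).
  by apply/funext => t; rewrite pa.
rewrite pa; exact: circle_mean_ln_prod.
Qed.

(** Take [j] successive square roots, each time the one closer to 1. For y^2 = x one has |x - 1| =
    |y - 1| |y + 1| with |y + 1| >= 2 - |y - 1|, so distances to 1 nearly halve. The exact shape t /
    (2^j (1 - t) + t) of the bound absorbs the defect, so that no constant accumulates with [j]. *)
Lemma pow2_root_near (j : nat) (s : C) : normc (s - 1) < 1 ->
  exists2 x : C, x ^+ (2 ^ j) = s &
    normc (x - 1) * ((2 ^ j)%:R * (1 - normc (s - 1)) + normc (s - 1)) <= normc (s - 1).
Proof.
set t := normc (s - 1) => t1; have t0 : 0 <= t by exact: normc_ge0.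
elim: j => [|j [x xE xt]].
  by exists s; rewrite ?expr1 // mul1r subrK mulr1.
set u := normc (x - 1) in xt; set K := (2 ^ j)%:R * (1 - t) in xt.
have u0 : 0 <= u by exact: normc_ge0.
have K1 : 1 - t <= K.
  rewrite /K ler_peMl ?subr_ge0 ?(ltW t1) //.
  by rewrite -[1]/(1%:R) ler_nat expn_gt0.
have [y [y2 yy]] : exists y : C, y ^+ 2 = x /\ normc (y - 1) <= normc (y + 1).
  pose y0 : C := sqrtc x; have y0E : y0 ^+ 2 = x by exact: sqr_sqrtc.
  have [h|h] := leP (normc (y0 - 1)) (normc (y0 + 1)); first by exists y0.
  exists (- y0); rewrite sqrrN; split=> //.
  by rewrite -normc_opp opprD !opprK -[X in _ <= X]normc_opp opprD opprK ltW.
exists y; first by rewrite expnS exprM y2.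
set v := normc (y - 1) in yy *.
have v0 : 0 <= v by exact: normc_ge0.
have uE : u = v * normc (y + 1).
  rewrite /u -y2 -normc_mul; congr normc; ring.
have v2 : 2 - v <= normc (y + 1).
  have := normcD (y + 1) (- (y - 1)); rewrite normc_opp -/v.
  rewrite (_ : y + 1 - (y - 1) = 2%:R%:C%C); last first.
    by rewrite rmorph_nat; ring.
  by rewrite normc_real normr_nat; lra.
have ut : u <= t.
  have : u * 1 <= u * (K + t) by rewrite ler_wpM2l //; lra.
  by lra.
have v1 : v <= 1.
  rewrite leNgt; apply/negP => v1; have : v * v <= u by rewrite uE ler_wpM2l.
  have : 1 * 1 < v * v by apply: ltr_pM.
  by lra.
have vu : v * (2 - v) <= u by rewrite uE ler_wpM2l.
have Kt : 0 <= K + t by lra.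
have m1 : v * (2 - v) * (K + t) <= t by apply: le_trans xt; rewrite ler_wpM2r.
have m2 : v * (K + t) <= t.
  apply: le_trans m1; rewrite ler_wpM2r // ler_peMr //; lra.
have -> : (2 ^ j.+1)%:R * (1 - t) = 2 * K by rewrite expnS natrM mulrA.
apply: le_trans m1; rewrite -mulrA ler_wpM2l //.
have : (2 - v) * (K + t) - (2 * K + t) = t - v * (K + t) by ring.
by lra.
Qed.

Lemma holder_continuous (K alpha : R) (g : C -> R) : 0 <= K -> 0 < alpha ->
  (forall z w, `|g z - g w| <= K * normc (z - w) `^ alpha) -> continuous g.
Proof.
move=> K0 a0 H z; apply/(cvgrPdist_lt (FF := nbhs_filter z)) => e e0.
have K1 : 0 < K + 1 by rewrite ltr_wpDl.
have q0 : 0 < e / (K + 1) by rewrite divr_gt0.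
apply/nbhs_cplxP; exists ((e / (K + 1)) `^ alpha^-1); first exact: powR_gt0.
move=> w wz; apply: le_lt_trans (H _ _) _; rewrite normcBC.
have h : normc (w - z) `^ alpha < e / (K + 1).
  have := gt0_ltr_powR a0 _ _ wz; rewrite !nnegrE normc_ge0 powR_ge0 => /(_ isT isT).
  by rewrite -powRrM mulVf ?gt_eqF // powRr1 // ltW.
apply: le_lt_trans (_ : (K + 1) * normc (w - z) `^ alpha < _).
  by rewrite ler_wpM2r ?powR_ge0 // lerDl.
by rewrite mulrC -ltr_pdivlMr.
Qed.

End LogPolynomial.

Lemma ln3_le2 (R : realType) : ln 3 <= 2 :> R.
Proof.
rewrite -[leRHS]expRK ler_ln ?posrE ?expR_gt0 //.
have := expR_ge1Dx (2 : R); lra.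
Qed.

(** * Green functions of nonautonomous Julia sets, for exponents below 1 *)

Section JuliaGreen.
Context {R : realType}.
Local Notation C := R[i]^o.
Implicit Types (z w : C).

Variables (alpha B : R) (n : nat -> nat) (A : nat -> R).
Hypothesis alpha01 : 0 < alpha < 1.
Hypothesis B1 : 1 <= B.
Hypothesis n2 : forall k, (2 <= n k)%N.
Hypothesis n_pow2 : forall k, exists j, n k = (2 ^ j)%N.
(** This growth limits the distortion at level [k] to [expR] of a multiple of [2^-1 ^+ k], and
    leaves room for inverse branches on the disc of radius [expR B]. The last hypothesis [nB] lets
    one constant [B] bound the distance to log^+ at all levels. *)
Hypothesis A_ge : forall k, 16 * expR B * 4 ^+ k.+1 <= A k.
Hypothesis nA : forall k, ((n k)%:R * A k) `^ alpha = (n k)%:R.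
Hypothesis nB : forall k, B + ln (3 * A k) <= B * (n k)%:R.

Definition mx1 z : R := Num.max 1 (normc z).

(* [1] is a fixed point, and near the zero set of the Green functions
   [julia_map k] expands distances by a factor close to [n k * A k]; by
   [nA], [n k] inverse branches then make the exponent [alpha] critical. *)
Definition julia_map k z : C := (A k)%:C%C * (z ^+ n k - 1) + 1.

(** log^+ of the composite of [m] maps, divided by its degree. The starting level [k] is a parameter
    because the inductions peel off the first map. *)
Fixpoint green (m k : nat) z : R :=
  if m is m'.+1 then (n k)%:R^-1 * green m' k.+1 (julia_map k z) else ln (mx1 z).

Let a0 : 0 < alpha. Proof. by case/andP: alpha01. Qed.
Let a1 : alpha < 1. Proof. by case/andP: alpha01. Qed.

Lemma n_ge2 k : 2 <= (n k)%:R :> R. Proof. by rewrite ler_nat. Qed.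

Lemma n_gt0 k : 0 < (n k)%:R :> R. Proof. by apply: lt_le_trans (n_ge2 k). Qed.

Lemma A_ge4 k : 4 ^+ k.+1 <= A k.
Proof.
apply: le_trans (A_ge k); rewrite ler_peMl ?exprn_ge0 //.
have := expR_ge1Dx B; have := B1; lra.
Qed.

Lemma A_ge1 k : 1 <= A k.
Proof. by apply: le_trans (A_ge4 k); rewrite exprn_ege1 // ler1n. Qed.

Lemma A_gt0 k : 0 < A k. Proof. exact: lt_le_trans (A_ge1 k). Qed.

Lemma mx1_ge1 z : 1 <= mx1 z. Proof. by rewrite /mx1 le_max lexx. Qed.

Lemma mx1_gt0 z : 0 < mx1 z. Proof. exact: lt_le_trans (mx1_ge1 z). Qed.

Lemma normc_le_mx1 z : normc z <= mx1 z. Proof. by rewrite /mx1 le_max lexx orbT. Qed.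

Lemma mx1_le_add z w : mx1 w <= mx1 z + normc (z - w).
Proof.
have h := normcD (z - (z - w)) (z - w); rewrite subKr addrC subrK in h.
rewrite {1}/mx1 ge_max; apply/andP; split.
  by apply: le_trans (mx1_ge1 z) _; rewrite lerDl normc_ge0.
have := normcD z (w - z); rewrite addrC subrK (normcBC w) => h'.
by apply: le_trans h' _; rewrite lerD2r normc_le_mx1.
Qed.

Lemma mx1_julia_le k z : mx1 (julia_map k z) <= 3 * A k * mx1 z ^+ n k.
Proof.
have M1 : 1 <= mx1 z ^+ n k by rewrite exprn_ege1 ?mx1_ge1.
have hA := A_ge1 k.
have hz : normc z ^+ n k <= mx1 z ^+ n k.
  by apply: lerXn2r; rewrite ?nnegrE ?normc_ge0 ?(ltW (mx1_gt0 _)) ?normc_le_mx1.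
have AM : A k <= A k * mx1 z ^+ n k by rewrite ler_peMr // ltW // A_gt0.
rewrite {1}/mx1 ge_max; apply/andP; split; first by lra.
apply: le_trans (normcD _ _) _; rewrite normc_one normc_mul normc_real gtr0_norm ?A_gt0 //.
have h : normc (z ^+ n k - 1) <= mx1 z ^+ n k + 1.
  by apply: le_trans (normcD _ _) _; rewrite normc_opp normc_one lerD2r normcX.
have : A k * normc (z ^+ n k - 1) <= A k * (mx1 z ^+ n k + 1).
  by rewrite ler_pM2l // A_gt0.
by rewrite mulrDr mulr1; lra.
Qed.

Lemma mx1_julia_ge k z : A k * mx1 z ^+ n k <= (2 + A k) * mx1 (julia_map k z).
Proof.
have hA := A_ge1 k; have hm := mx1_ge1 (julia_map k z).
have Am : A k <= A k * mx1 (julia_map k z) by rewrite ler_peMr // ltW // A_gt0.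
have [z1|z1] := leP (normc z) 1.
  by rewrite {1}/mx1 (max_idPl z1) expr1n mulr1 mulrDl; lra.
rewrite {1}/mx1 (max_idPr (ltW z1)).
have h1 := normcD (z ^+ n k - 1) 1; rewrite subrK normcX normc_one in h1.
have h2 := normcD (julia_map k z) (- 1).
rewrite normc_opp normc_one {1}/julia_map addrK normc_mul normc_real gtr0_norm ?A_gt0 // in h2.
have h3 := normc_le_mx1 (julia_map k z).
have : A k * normc z ^+ n k <= A k * (normc (z ^+ n k - 1) + 1) by rewrite ler_pM2l // A_gt0.
by rewrite mulrDr mulr1 mulrDl; lra.
Qed.

Lemma ln_mx1_julia k z :
  `|ln (mx1 (julia_map k z)) - (n k)%:R * ln (mx1 z)| <= ln (3 * A k).
Proof.
have hA := A_gt0 k; have hA1 := A_ge1 k.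
have m0 := mx1_gt0 z; have w0 := mx1_gt0 (julia_map k z).
have p0 : 0 < mx1 z ^+ n k by rewrite exprn_gt0.
have lE : (n k)%:R * ln (mx1 z) = ln (mx1 z ^+ n k) by rewrite lnXn // mulr_natl.
rewrite lE ler_distl; apply/andP; split; last first.
  rewrite addrC -lnM ?posrE ?mulr_gt0 // ler_ln ?posrE ?mulr_gt0 //.
  exact: mx1_julia_le.
rewrite lerBlDr -lnM ?posrE ?mulr_gt0 // ler_ln ?posrE ?mulr_gt0 //.
have h := mx1_julia_ge k z.
rewrite -(ler_pM2l hA) (le_trans h) //.
have : (2 + A k) * mx1 (julia_map k z) <= (A k * (3 * A k)) * mx1 (julia_map k z).
  by rewrite ler_pM2r //; nra.
by lra.
Qed.

Lemma green_bound m k z : `|green m k z - ln (mx1 z)| <= B.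
Proof.
elim: m k z => [|m IH] k z; first by rewrite /= subrr normr0 (le_trans ler01).
have n0 := n_gt0 k.
rewrite /= (_ : _ - _ = (n k)%:R^-1 * ((green m k.+1 (julia_map k z) - ln (mx1 (julia_map k z)))
  + (ln (mx1 (julia_map k z)) - (n k)%:R * ln (mx1 z)))); last by field; rewrite gt_eqF.
rewrite normrM gtr0_norm ?invr_gt0 // mulrC ler_pdivrMr //.
apply: le_trans (ler_normD _ _) _; apply: le_trans (nB k).
by rewrite lerD // ln_mx1_julia.
Qed.

(** Unlike the uniform bound [B], this one keeps the division by [n k], which the Hoelder estimate
    at large relative distance requires. *)
Lemma greenS_bound m k z :
  `|green m.+1 k z - ln (mx1 z)| <= (B + ln (3 * A k)) / (n k)%:R.
Proof.
have n0 := n_gt0 k.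
rewrite /= (_ : _ - _ = (n k)%:R^-1 * ((green m k.+1 (julia_map k z) - ln (mx1 (julia_map k z)))
  + (ln (mx1 (julia_map k z)) - (n k)%:R * ln (mx1 z)))); last by field; rewrite gt_eqF.
rewrite normrM gtr0_norm ?invr_gt0 // mulrC ler_wpM2r ?invr_ge0 ?(ltW n0) //.
by apply: le_trans (ler_normD _ _) _; rewrite lerD ?green_bound ?ln_mx1_julia.
Qed.

Lemma green_ge0 m k z : 0 <= green m k z.
Proof.
elim: m k z => [|m IH] k z /=; first by rewrite ln_ge0 // mx1_ge1.
by rewrite mulr_ge0 // invr_ge0 ltW // n_gt0.
Qed.

Lemma green_step m k z : `|green m.+1 k z - green m k z| <= B * 2^-1 ^+ m.
Proof.
elim: m k z => [|m IH] k z; first by rewrite expr0 mulr1 green_bound.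
rewrite -[green m.+2 k z]/((n k)%:R^-1 * green m.+1 k.+1 (julia_map k z)).
rewrite -[X in _ - X]/((n k)%:R^-1 * green m k.+1 (julia_map k z)).
rewrite -mulrBr normrM gtr0_norm ?invr_gt0 ?n_gt0 // exprS mulrCA.
have i0 : 0 <= (n k)%:R^-1 :> R by rewrite invr_ge0 ltW // n_gt0.
apply: le_trans (ler_wpM2l i0 (IH k.+1 _)) _.
rewrite ler_wpM2r ?mulr_ge0 ?exprn_ge0 ?invr_ge0 ?(le_trans ler01 B1) //.
by rewrite lef_pV2 ?posrE ?n_gt0 // n_ge2.
Qed.

Lemma green_fixed m k : green m k 1 = 0.
Proof.
elim: m k => [|m IH] k /=; first by rewrite /mx1 normc_one maxxx ln1.
by rewrite /julia_map expr1n subrr mulr0 add0r IH mulr0.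
Qed.

(** The first summand is the Hoelder constant of log^+; the second pays, at each of two points, for
    replacing the Green function by log^+ as in [julia_gap]. *)
Definition holder_exponent_const : R := alpha^-1 + 2 * (B + 2 + 2 / alpha).

Let D := holder_exponent_const.

(** alpha ln (1 + x) <= ln (1 + x^alpha) <= x^alpha, the first step by subadditivity of the power.
    That follows from 1 = 1 / (1 + x) + x / (1 + x), since numbers in ]0, 1] grow when raised to a
    power alpha < 1. *)
Lemma ln1D_powR (x : R) : 0 <= x -> ln (1 + x) <= alpha^-1 * x `^ alpha.
Proof.
move=> x0; have p0 := powR_ge0 x alpha.
rewrite mulrC ler_pdivlMr // mulrC -ln_powR.
apply: le_trans (le_ln1Dx (_ : -1 < x `^ alpha)); last by apply: lt_le_trans p0; rewrite ltrN10.
rewrite ler_ln ?posrE ?powR_gt0 ?ltr_wpDr //.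
have [->|xn] := eqVneq x 0.
  by rewrite addr0 powR0 ?gt_eqF // addr0 powR1.
have xp : 0 < x by rewrite lt_def xn.
rewrite /powR gt_eqF ?(gt_eqF xp) ?ltr_wpDr //.
have y0 : 0 < 1 + x by rewrite ltr_wpDr.
have i0 : 0 < (1 + x)^-1 by rewrite invr_gt0.
have p1 : (1 + x)^-1 <= ((1 + x)^-1) `^ alpha.
  by apply: ger1_powR; rewrite ?(ltW a1) // i0 invf_le1 // lerDl.
have x1 : x / (1 + x) <= (x / (1 + x)) `^ alpha.
  apply: ger1_powR; rewrite ?(ltW a1) // divr_gt0 //= ler_pdivrMr // mul1r lerDr //.
have sum : 1 <= ((1 + x)^-1) `^ alpha + (x / (1 + x)) `^ alpha.
  rewrite [leLHS](_ : 1 = (1 + x)^-1 + x / (1 + x)); last by field; rewrite gt_eqF.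
  exact: lerD.
have e1 : expR (alpha * ln (1 + x)) = (1 + x) `^ alpha by rewrite /powR gt_eqF.
have e2 : expR (alpha * ln x) = x `^ alpha by rewrite /powR gt_eqF.
rewrite e1 e2; have := ler_wpM2l (powR_ge0 (1 + x) alpha) sum.
rewrite mulr1 mulrDr -!powRM ?invr_ge0 ?divr_ge0 ?(ltW y0) ?(ltW i0) //.
by rewrite mulfV ?gt_eqF // powR1 mulrCA mulfV ?gt_eqF // mulr1.
Qed.

Lemma ln_mx1_holder z w (x : R) : 0 <= x ->
  normc (z - w) <= x * mx1 z -> normc (z - w) <= x * mx1 w ->
  `|ln (mx1 z) - ln (mx1 w)| <= alpha^-1 * x `^ alpha.
Proof.
move=> x0 h1 h2; apply: le_trans (ln1D_powR x0).
have x1 : 0 < 1 + x by rewrite ltr_wpDr.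
have z0 := mx1_gt0 z; have w0 := mx1_gt0 w.
have l1 := mx1_le_add z w; have l2 := mx1_le_add w z; rewrite normcBC in l2.
rewrite ler_distl; apply/andP; split.
  rewrite lerBlDr -lnM ?posrE // ler_ln ?posrE ?mulr_gt0 //; lra.
rewrite -lnM ?posrE // ler_ln ?posrE ?mulr_gt0 //; lra.
Qed.

Lemma subrXX_le z w (M : R) (j : nat) : normc z <= M -> normc w <= M ->
  normc (z ^+ j - w ^+ j) <= j%:R * normc (z - w) * M ^+ j.-1.
Proof.
move=> zM wM; have M0 : 0 <= M by exact: le_trans (normc_ge0 z) zM.
elim: j => [|j IH]; first by rewrite !expr0 subrr normc_zero mul0r mul0r.
rewrite (_ : z ^+ j.+1 - w ^+ j.+1 = (z - w) * z ^+ j + w * (z ^+ j - w ^+ j)); last first.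
  by rewrite !exprS; ring.
apply: le_trans (normcD _ _) _; rewrite !normc_mul normcX /=.
have h1 : normc z ^+ j <= M ^+ j by apply: lerXn2r; rewrite ?nnegrE ?normc_ge0.
have h2 : normc w * normc (z ^+ j - w ^+ j) <= j%:R * normc (z - w) * M ^+ j.
  case: j IH h1 => [|j] IH h1; first by rewrite !expr0 subrr normc_zero mulr0 mul0r mul0r.
  apply: le_trans (ler_pM (normc_ge0 _) (normc_ge0 _) wM IH) _.
  by rewrite /= mulrCA -exprS.
have h3 : normc (z - w) * normc z ^+ j <= normc (z - w) * M ^+ j.
  by rewrite ler_wpM2l ?normc_ge0.
rewrite -[j.+1%:R]natr1 (_ : (j%:R + 1) * normc (z - w) * M ^+ j =
  normc (z - w) * M ^+ j + j%:R * normc (z - w) * M ^+ j); last by ring.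
exact: lerD.
Qed.

(** Distances are measured relative to [mx1]: far from the origin the derivative grows like |z|^(n -
    1), but the growth of the image cancels this and leaves the factor n A. The correction is one
    factor [expR (2^-1 ^+ k.+1)] from (1 + x)^n <= e^(n x) and another from (2 + A) / A. *)
Lemma julia_map_dist k z w (x : R) : 0 <= x -> (n k)%:R * x <= 2^-1 ^+ k.+1 ->
  normc (z - w) <= x * mx1 z -> normc (z - w) <= x * mx1 w ->
  normc (julia_map k z - julia_map k w) <=
    (n k)%:R * A k * x * expR (2^-1 ^+ k) * mx1 (julia_map k z).
Proof.
move=> x0 nx h1 h2.
have Ak := A_gt0 k; have n0 := n_gt0 k.
have z0 := mx1_gt0 z; have w0 := mx1_gt0 w.
pose M := mx1 z * (1 + x).
have zM : normc z <= M.
  by apply: le_trans (normc_le_mx1 z) _; rewrite ler_peMr ?(ltW z0) // lerDl.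
have wM : normc w <= M.
  apply: le_trans (normc_le_mx1 w) _; apply: le_trans (mx1_le_add z w) _.
  by rewrite /M mulrDr mulr1 lerD2l mulrC.
have M0 : 0 <= M by exact: le_trans (normc_ge0 z) zM.
have xM : normc (z - w) * M ^+ (n k).-1 <= x * (mx1 z ^+ n k * expR (2^-1 ^+ k.+1)).
  apply: le_trans (_ : x * M * M ^+ (n k).-1 <= _).
    rewrite ler_wpM2r ?exprn_ge0 //; apply: le_trans h1 _.
    by rewrite ler_wpM2l // ler_peMr ?(ltW z0) // lerDl.
  rewrite -mulrA -exprS prednK ?(leq_trans _ (n2 k)) // ler_wpM2l //.
  rewrite /M exprMn ler_wpM2l ?exprn_ge0 ?(ltW z0) //.
  apply: le_trans (_ : expR x ^+ n k <= _).
    by apply: lerXn2r; rewrite ?nnegrE ?addr_ge0 ?expR_ge0 // expR_ge1Dx.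
  by rewrite -expRM_natl ler_expR.
rewrite /julia_map opprD addrACA subrr addr0 -mulrBr opprB addrA subrK.
rewrite normc_mul normc_real gtr0_norm //.
apply: le_trans (_ : A k * ((n k)%:R * (x * (mx1 z ^+ n k * expR (2^-1 ^+ k.+1)))) <= _).
  rewrite ler_pM2l //; apply: le_trans (subrXX_le (n k) zM wM) _.
  by rewrite -mulrA ler_pM2l.
have hm := mx1_julia_ge k z; rewrite /julia_map in hm.
set J := mx1 (_ + 1) in hm *.
have J0 : 0 < J by exact: mx1_gt0.
rewrite (_ : A k * _ = ((n k)%:R * x * expR (2^-1 ^+ k.+1)) * (A k * mx1 z ^+ n k)); last by ring.
apply: le_trans (_ : ((n k)%:R * x * expR (2^-1 ^+ k.+1)) * ((2 + A k) * J) <= _).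
  by rewrite ler_wpM2l ?mulr_ge0 ?expR_ge0 ?(ltW n0).
have e : expR (2^-1 ^+ k) = expR (2^-1 ^+ k.+1) * expR (2^-1 ^+ k.+1) :> R.
  by rewrite -expRD exprS; congr expR; field.
have A2 : 2 + A k <= A k * expR (2^-1 ^+ k.+1).
  have : 1 + 2^-1 ^+ k.+1 <= expR (2^-1 ^+ k.+1) :> R by exact: expR_ge1Dx.
  have : 2 <= A k * 2^-1 ^+ k.+1.
    have h4 : 2 ^+ k.+1 * 2 ^+ k.+1 <= A k by rewrite -exprMn (le_trans _ (A_ge4 k)) // -natrM.
    apply: le_trans (_ : 2 ^+ k.+1 * 2 ^+ k.+1 * 2^-1 ^+ k.+1 <= _).
      rewrite -mulrA -exprMn mulfV ?pnatr_eq0 // expr1n mulr1 exprS ler_peMr //.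
      by rewrite exprn_ege1 // ler1n.
    by rewrite ler_wpM2r // exprn_ge0 // invr_ge0.
  move=> p1 p2; have := ler_wpM2l (ltW Ak) p2; rewrite mulrDr mulr1; lra.
rewrite (_ : (n k)%:R * A k * x * expR (2^-1 ^+ k) * J =
   ((n k)%:R * x * expR (2^-1 ^+ k.+1)) * (A k * expR (2^-1 ^+ k.+1) * J)); last first.
  by rewrite e; ring.
rewrite ler_wpM2l ?mulr_ge0 ?expR_ge0 ?(ltW n0) //.
by rewrite ler_pM2r.
Qed.

(** At the threshold relative distance e / n, with e = 2^-(k+1), the error of replacing the Green
    function by log^+ is already of order alpha. Since n = (n A)^alpha by [nA], (e / n)^alpha equals
    (A e)^alpha / n, and the logarithm of A is dominated by a power of A e. *)
Lemma julia_gap k : (B + ln (3 * A k)) / (n k)%:R <=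
  (B + 2 + 2 / alpha) * (2^-1 ^+ k.+1 / (n k)%:R) `^ alpha.
Proof.
have Ak := A_gt0 k; have n0 := n_gt0 k; have A1 := A_ge1 k.
set e : R := 2^-1 ^+ k.+1.
have e0 : 0 < e by rewrite exprn_gt0 // invr_gt0.
have na0 : 0 < (n k)%:R `^ alpha :> R by rewrite powR_gt0.
have Aa0 : 0 < A k `^ alpha by rewrite powR_gt0.
have nE : (n k)%:R = (n k)%:R `^ alpha * A k `^ alpha :> R.
  by rewrite -powRM ?nA ?ltW.
have -> : (e / (n k)%:R) `^ alpha = e `^ alpha / (n k)%:R `^ alpha.
  rewrite powRM ?invr_ge0 ?(ltW n0) ?(ltW e0) //; congr (_ * _).
  by rewrite -(powR_inv1 (ltW n0)) powRAC -powRrM mulrN1 powRN.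
(* Compare through sqrt (A k): it is at least [2 ^+ k.+1], hence at most [A k * e], and ln A <= (2 /
   alpha) (sqrt A)^alpha. *)
have key : B + ln (3 * A k) <= (B + 2 + 2 / alpha) * (A k * e) `^ alpha.
  have s1 : 1 <= Num.sqrt (A k) by rewrite -sqrtr1 ler_wsqrtr.
  have sA : Num.sqrt (A k) <= A k * e.
    have h4 : 2 ^+ k.+1 <= Num.sqrt (A k).
      rewrite -(ger0_norm (_ : 0 <= 2 ^+ k.+1 :> R)) ?exprn_ge0 // -sqrtr_sqr ler_wsqrtr //.
      by rewrite -exprM mulnC exprM (_ : 2 ^+ 2 = 4 :> R) ?A_ge4 // -natrX.
    rewrite -{2}[A k]sqr_sqrtr ?(ltW Ak) // expr2 -mulrA ler_peMr ?sqrtr_ge0 //.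
    rewrite (_ : 1 = 2 ^+ k.+1 * e); last by rewrite /e -exprMn mulfV ?pnatr_eq0 // expr1n.
    by rewrite ler_pM2r.
  have s0 : 0 < Num.sqrt (A k) by exact: lt_le_trans s1.
  have sp1 : 1 <= Num.sqrt (A k) `^ alpha.
    rewrite -[leLHS](_ : 1 `^ alpha = 1); last by rewrite powR1.
    by apply: ge0_ler_powR; rewrite ?nnegrE ?(ltW a0) ?sqrtr_ge0.
  have sp2 : Num.sqrt (A k) `^ alpha <= (A k * e) `^ alpha.
    by apply: ge0_ler_powR; rewrite ?nnegrE ?(ltW a0) ?sqrtr_ge0 ?mulr_ge0 ?(ltW Ak) ?(ltW e0).
  have lnA : ln (A k) <= 2 / alpha * Num.sqrt (A k) `^ alpha.
    have -> : ln (A k) = 2 / alpha * ln (Num.sqrt (A k) `^ alpha).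
      rewrite ln_powR -{1}[A k]sqr_sqrtr ?(ltW Ak) // lnXn // -mulr_natl.
      by field; rewrite gt_eqF.
    rewrite ler_wpM2l ?divr_ge0 ?(ltW a0) //.
    have := expR_ge1Dx (ln (Num.sqrt (A k) `^ alpha)).
    rewrite lnK ?posrE ?powR_gt0 //; lra.
  have ln3 := @ln3_le2 R.
  rewrite lnM ?posrE //.
  have i0 : 0 <= 2 / alpha by rewrite divr_ge0 ?(ltW a0).
  apply: le_trans (_ : (B + 2 + 2 / alpha) * Num.sqrt (A k) `^ alpha <= _).
    have hB := B1.
    have : (B + 2) * 1 <= (B + 2) * Num.sqrt (A k) `^ alpha by rewrite ler_wpM2l //; lra.
    by rewrite mulrDl; lra.
  by rewrite ler_wpM2l //; have := B1; lra.
rewrite ler_pdivrMr // {2}nE.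
rewrite [leRHS](_ : _ = (B + 2 + 2 / alpha) * (A k `^ alpha * e `^ alpha)); last first.
  by field; rewrite !gt_eqF.
by rewrite -powRM ?(ltW Ak) ?(ltW e0).
Qed.

(** Above the threshold of [julia_gap] compare both values with log^+. Below it apply one map:
    x^alpha is multiplied by at most (n A)^alpha e^(2^-k) = n e^(2^-k), and the factor n cancels
    against the division by the degree. The factor [expR (2 * 2^-1 ^+ k)] in the claim is designed
    to absorb all later distortions, as 2 * 2^-k = 2 * 2^-(k+1) + 2^-k. *)
Lemma green_holder m k z w (x : R) : 0 <= x ->
  normc (z - w) <= x * mx1 z -> normc (z - w) <= x * mx1 w ->
  `|green m k z - green m k w| <= D * expR (2 * 2^-1 ^+ k) * x `^ alpha.
Proof.
have B0 : 0 <= B by apply: le_trans B1.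
have q0 : 0 <= B + 2 + 2 / alpha by rewrite !addr_ge0 // divr_ge0 // ltW.
have D1 : alpha^-1 <= D by rewrite /D /holder_exponent_const lerDl mulr_ge0.
have D0 : 0 <= D by apply: le_trans D1; rewrite invr_ge0 ltW.
have E1 j : 1 <= expR (2 * 2^-1 ^+ j) :> R.
  by rewrite -expR0 ler_expR mulr_ge0 // exprn_ge0 // invr_ge0.
have DE j (y : R) : 0 <= y -> D * y <= D * expR (2 * 2^-1 ^+ j) * y.
  by move=> y0; rewrite -mulrA ler_wpM2l // ler_peMl.
elim: m k z w x => [|m IH] k z w x x0 h1 h2.
  apply: le_trans (ln_mx1_holder x0 h1 h2) _; apply: le_trans (DE k _ (powR_ge0 _ _)).
  by rewrite ler_wpM2r ?powR_ge0.
have n0 := n_gt0 k; have Ak := A_gt0 k.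
have [big|small] := leP (2^-1 ^+ k.+1 / (n k)%:R) x.
  have g1 := greenS_bound m k z; have g2 := greenS_bound m k w.
  have l := ln_mx1_holder x0 h1 h2.
  have gap : (B + ln (3 * A k)) / (n k)%:R <= (B + 2 + 2 / alpha) * x `^ alpha.
    apply: le_trans (julia_gap k) _; rewrite ler_wpM2l //.
    have p : 0 <= 2^-1 ^+ k.+1 / (n k)%:R :> R.
      by rewrite divr_ge0 ?(ltW n0) ?exprn_ge0 ?invr_ge0.
    by apply: ge0_ler_powR; rewrite ?nnegrE ?(ltW a0).
  apply: le_trans (DE k _ (powR_ge0 _ _)).
  rewrite (_ : green m.+1 k z - green m.+1 k w = (green m.+1 k z - ln (mx1 z)) +
    (ln (mx1 z) - ln (mx1 w)) + - (green m.+1 k w - ln (mx1 w))); last by ring.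
  apply: le_trans (ler_normD _ _) _; rewrite normrN.
  apply: le_trans (lerD (ler_normD _ _) (lexx _)) _.
  by rewrite /D /holder_exponent_const mulrDl -mulrA mulr_natl mulr2n; lra.
have nx : (n k)%:R * x <= 2^-1 ^+ k.+1 by rewrite mulrC -ler_pdivlMr // ltW.
pose y := (n k)%:R * A k * x * expR (2^-1 ^+ k).
have y0 : 0 <= y by rewrite !mulr_ge0 ?expR_ge0 ?(ltW n0) ?(ltW Ak).
have j1 := julia_map_dist x0 nx h1 h2.
have j2 : normc (julia_map k z - julia_map k w) <= y * mx1 (julia_map k w).
  by rewrite normcBC; apply: julia_map_dist; rewrite // normcBC.
rewrite /= -mulrBr normrM gtr0_norm ?invr_gt0 // mulrC ler_pdivrMr //.
apply: le_trans (IH k.+1 _ _ y y0 j1 j2) _.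
have -> : y `^ alpha = (n k)%:R * x `^ alpha * expR (2^-1 ^+ k) `^ alpha.
  rewrite /y powRM ?expR_ge0 ?mulr_ge0 ?(ltW n0) ?(ltW Ak) //.
  by rewrite powRM ?mulr_ge0 ?(ltW n0) ?(ltW Ak) // nA.
have e1 : expR (2^-1 ^+ k) `^ alpha <= expR (2^-1 ^+ k) :> R.
  apply: ler1_powR; last exact: ltW.
  by rewrite -[leLHS]expR0 ler_expR exprn_ge0 // invr_ge0.
have e2 : expR (2 * 2^-1 ^+ k) = expR (2 * 2^-1 ^+ k.+1) * expR (2^-1 ^+ k) :> R.
  by rewrite -expRD exprS; congr expR; field.
rewrite e2.
rewrite (_ : D * (expR (2 * 2^-1 ^+ k.+1) * expR (2^-1 ^+ k)) * x `^ alpha * (n k)%:R =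
   (D * expR (2 * 2^-1 ^+ k.+1) * ((n k)%:R * x `^ alpha)) * expR (2^-1 ^+ k)); last by ring.
rewrite [leLHS]mulrA ler_wpM2l //.
by rewrite !mulr_ge0 ?expR_ge0 ?powR_ge0 // ltW.
Qed.

Definition julia_green k z : R := limn (fun m => green m k z).

Lemma julia_green_limit k z :
  (green m k z @[m --> \oo] --> julia_green k z) /\
  forall m, `|julia_green k z - green m k z| <= 2 * B * 2^-1 ^+ m.
Proof.
apply: (geometric_limit (le_trans ler01 B1)) => m; exact: green_step.
Qed.

Lemma julia_greenE k z : julia_green k z = (n k)%:R^-1 * julia_green k.+1 (julia_map k z).
Proof.
have [c1 _] := julia_green_limit k z.
have [c2 _] := julia_green_limit k.+1 (julia_map k z).
have h : green m.+1 k z @[m --> \oo] --> julia_green k z.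
  by rewrite (cvg_shiftS (fun m => green m k z)).
apply: (cvg_unique _ h) => //=; apply: cvgM; [exact: cvg_cst|exact: c2].
Qed.

Lemma julia_green_ge0 k z : 0 <= julia_green k z.
Proof.
have [c _] := julia_green_limit k z.
by apply: (cvgr_to_ge c); apply: nearW => m; exact: green_ge0.
Qed.

Lemma julia_green_bound k z : `|julia_green k z - ln (mx1 z)| <= B.
Proof.
have [c _] := julia_green_limit k z.
have h : `|green m k z - ln (mx1 z)| @[m --> \oo] --> `|julia_green k z - ln (mx1 z)|.
  by apply: cvg_norm; apply: cvgB; [exact: c|exact: cvg_cst].
by apply: (cvgr_to_le h); apply: nearW => m; exact: green_bound.
Qed.

Lemma julia_green_fixed k : julia_green k 1 = 0.
Proof.
rewrite /julia_green (_ : (fun m => _) = fun=> 0); first exact: lim_cst.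
by apply/funext => m; exact: green_fixed.
Qed.

Lemma julia_green_holder z w :
  `|julia_green 0 z - julia_green 0 w| <= D * expR 2 * normc (z - w) `^ alpha.
Proof.
have [c1 _] := julia_green_limit 0 z; have [c2 _] := julia_green_limit 0 w.
have h : `|green m 0 z - green m 0 w| @[m --> \oo] --> `|julia_green 0 z - julia_green 0 w|.
  by apply: cvg_norm; apply: cvgB; [exact: c1|exact: c2].
apply: (cvgr_to_le h); apply: nearW => m.
have := @green_holder m 0 z w (normc (z - w)) (normc_ge0 _); rewrite expr0 mulr1.
by apply; rewrite ler_peMr ?normc_ge0 // mx1_ge1.
Qed.

Lemma julia_green_zero k z : julia_green k z = 0 ->
  normc z <= expR B /\ julia_green k.+1 (julia_map k z) = 0.
Proof.
move=> h; split; last first.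
  have := julia_greenE k z; rewrite h => /esym/eqP.
  by rewrite mulf_eq0 invr_eq0 gt_eqF ?n_gt0 //= => /eqP.
have := julia_green_bound k z; rewrite h sub0r normrN => lB.
apply: le_trans (normc_le_mx1 z) _.
rewrite -[leLHS]lnK ?posrE ?mx1_gt0 // ler_expR.
by apply: le_trans lB; exact: ler_norm.
Qed.

(** * Degrees, scales and polynomials of the composed maps *)

Fixpoint level (m k : nat) : nat :=
  if m is m'.+1 then (n k * level m' k.+1)%N else 1.

Fixpoint level_radius (m k : nat) : R :=
  if m is m'.+1 then level_radius m' k.+1 / ((n k)%:R * A k) else 1.

Fixpoint julia_iter (m k : nat) z : C :=
  if m is m'.+1 then julia_iter m' k.+1 (julia_map k z) else z.

Fixpoint julia_poly (m k : nat) : {poly R[i]} :=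
  if m is m'.+1 then
    julia_poly m' k.+1 \Po ((A k)%:C%C *: ('X^(n k) - 1) + 1)
  else 'X.

Lemma level_gt0 m k : (0 < level m k)%N.
Proof.
elim: m k => [|m IH] k //=; rewrite muln_gt0 IH andbT.
exact: leq_trans (n2 k).
Qed.

Lemma level_radius_gt0 m k : 0 < level_radius m k.
Proof.
elim: m k => [|m IH] k //=.
by rewrite divr_gt0 ?mulr_gt0 ?n_gt0 ?A_gt0.
Qed.

Lemma level_radius_le m k : level_radius m k <= 2^-1 ^+ m.
Proof.
elim: m k => [|m IH] k //=; rewrite exprS mulrC.
have h : ((n k)%:R * A k)^-1 <= 2^-1.
  rewrite lef_pV2 ?posrE ?mulr_gt0 ?n_gt0 ?A_gt0 //.
  by apply: le_trans (n_ge2 k) _; rewrite ler_peMr ?A_ge1 // ltW // n_gt0.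
by apply: ler_pM => //; rewrite ?(ltW (level_radius_gt0 _ _)) // invr_ge0 mulr_ge0 // ltW // A_gt0.
Qed.

Lemma level_radius_powR m k : level_radius m k `^ alpha = (level m k)%:R^-1.
Proof.
elim: m k => [|m IH] k /=; first by rewrite powR1 invr1.
have p0 : 0 < (n k)%:R * A k by rewrite mulr_gt0 ?n_gt0 ?A_gt0.
rewrite powRM ?invr_ge0 ?(ltW p0) ?(ltW (level_radius_gt0 _ _)) // IH.
by rewrite -(powR_inv1 (ltW p0)) powRAC nA powR_inv1 ?ler0n // natrM invfM mulrC.
Qed.

Lemma green_iter m k z : green m k z = (level m k)%:R^-1 * ln (mx1 (julia_iter m k z)).
Proof.
elim: m k z => [|m IH] k z /=; first by rewrite invr1 mul1r.
by rewrite IH natrM invfM mulrA.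
Qed.

Lemma horner_julia_poly m k z : (julia_poly m k).[z] = julia_iter m k z.
Proof.
elim: m k z => [|m IH] k z /=; first by rewrite hornerX.
by rewrite horner_comp -IH !(hornerD, hornerZ, hornerXn, hornerN, hornerC).
Qed.

Lemma size_julia_poly m k : (size (julia_poly m k)).-1 = level m k.
Proof.
elim: m k => [|m IH] k /=; first by rewrite size_polyX.
have A0 : (A k)%:C%C != 0 :> R[i] by rewrite fmorph_eq0 gt_eqF ?A_gt0.
have n0 : (0 < n k)%N by apply: leq_trans (n2 k).
have s1 : size ((A k)%:C%C *: ('X^(n k) - 1 : {poly R[i]})) = (n k).+1.
  by rewrite size_scale // -[1]/(1%:P) size_XnsubC.
by rewrite size_comp_poly IH size_polyDl s1 ?size_poly1 //= mulnC.
Qed.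

Lemma julia_green_continuous : continuous (julia_green 0).
Proof.
apply: (@holder_continuous R (D * expR 2) alpha) => //; last exact: julia_green_holder.
have hB := B1; have i0 : 0 < alpha^-1 by rewrite invr_gt0.
have : 0 <= 2 / alpha by rewrite mulr_ge0 // ltW.
by move=> ?; rewrite mulr_ge0 ?expR_ge0 // /D /holder_exponent_const; lra.
Qed.

(** On a disc where the limit stays positive, a late approximant is positive too, so there its log^+
    is the logarithm of the modulus of a nonvanishing polynomial, which is harmonic. Uniform
    convergence transfers the mean value inequality with an arbitrarily small error. *)
Lemma julia_green_superharmonic z0 : 0 < julia_green 0 z0 ->
  superharmonic_near (julia_green 0) z0.
Proof.
move=> g0; pose e := julia_green 0 z0 / 2.
have e0 : 0 < e by rewrite divr_gt0.
have /(cvgrPdist_lt (FF := nbhs_filter z0)) /(_ _ e0) := @julia_green_continuous z0.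
move=> /nbhs_cplxP[r r0 hr]; exists r => // a b H.
have ge (t : C) : normc t <= 1 -> e < julia_green 0 (a + t * b).
  by move=> t1; have := hr _ (H t t1); rewrite ltr_distl => /andP[_]; rewrite /e; lra.
have E1 (t : R) : normc (expi t) <= 1 by rewrite normc_expi.
apply/ler_addgt0Pr => d d0.
(* The approximation error [c] is incurred twice, in the mean and at the centre, so [2 * c < d] is
   needed; the bound by [e] keeps the approximant positive on the disc. *)
have [m [m1 m2]] : exists m, 4 * B * 2^-1 ^+ m < d /\ 4 * B * 2^-1 ^+ m < e.
  have := geometric_cvg0 (4 * B); move/cvgrPdist_lt.
  move=> /(_ (Num.min d e)); rewrite lt_min d0 e0 => /(_ isT) [m _ /(_ m (leqnn m))].
  rewrite /= sub0r normrN => h; exists m.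
  by apply/andP; rewrite -lt_min; apply: le_lt_trans h; exact: ler_norm.
have q0 : 0 < 2^-1 ^+ m :> R by rewrite exprn_gt0 // invr_gt0.
pose c := 2 * B * 2^-1 ^+ m.
have cE : 4 * B * 2^-1 ^+ m = 2 * c by rewrite /c; ring.
have c0 : 0 < c by rewrite /c !mulr_gt0 // (lt_le_trans ltr01 B1).
rewrite cE in m1 m2.
have lv0 : 0 < (level m 0)%:R :> R by rewrite ltr0n level_gt0.
have close z : `|julia_green 0 z - green m 0 z| <= c by have [_] := julia_green_limit 0 z; exact.
have gE (t : C) : normc t <= 1 ->
    0 < ln (mx1 (julia_iter m 0 (a + t * b))) .
  move=> t1; have := close (a + t * b); rewrite ler_distl green_iter => /andP[_ h].
  have := ge t t1 => h2.
  have : 0 < (level m 0)%:R^-1 * ln (mx1 (julia_iter m 0 (a + t * b))) by lra.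
  by rewrite pmulr_rgt0 // invr_gt0.
have big (t : C) : normc t <= 1 -> 1 < normc (julia_iter m 0 (a + t * b)).
  move=> t1; rewrite ltNge; apply/negP => h; have := gE t t1.
  by rewrite /mx1 (max_idPl h) ln1 ltxx.
have mxE (t : C) : normc t <= 1 ->
    green m 0 (a + t * b) = (level m 0)%:R^-1 * ln (normc ((julia_poly m 0).[a + t * b] : C)).
  by move=> t1; rewrite green_iter /mx1 (max_idPr (ltW (big t t1))) horner_julia_poly.
have [|cP mP] := @circle_mean_ln_poly R (julia_poly m 0) a b.
  move=> t t1; rewrite horner_julia_poly -normc_gt0; exact: lt_trans (big t t1).
have cZ : continuous (fun t : R => (level m 0)%:R^-1 *
    ln (normc ((julia_poly m 0).[a + expi t * b] : C))).
  by move=> t; apply: cvgM; [exact: cvg_cst|exact: cP].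
have cc := @cst_continuous R R c.
have cg : continuous (fun t : R => julia_green 0 (a + expi t * b)).
  move=> t; apply: (@cvg_comp _ _ _ (fun t : R => a + expi t * b : C) (julia_green 0)).
    exact: cplx_circle_continuous.
  exact: julia_green_continuous.
apply: le_trans (le_circle_mean cg _ (_ : forall t : R, julia_green 0 (a + expi t * b) <=
    c + (level m 0)%:R^-1 * ln (normc ((julia_poly m 0).[a + expi t * b] : C)))) _.
- by move=> t; apply: cvgD; [exact: cvg_cst|exact: cZ].
- move=> t; rewrite -mxE ?E1 //.
  by have := close (a + expi t * b); rewrite ler_distl => /andP[_]; rewrite [leRHS]addrC.
rewrite circle_meanD // circle_mean_cst circle_meanZ // mP.
have := mxE 0; rewrite normc_zero mul0r addr0 => /(_ ler01) <-.
have := close a; rewrite ler_distl => /andP[h _]; lra.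
Qed.

Lemma expR_B_ge2 : 2 <= expR B.
Proof. by have := expR_ge1Dx B; have := B1; lra. Qed.

(* For [A k] large, [z ^+ n k] is close to 1, and [xi] is [z] times the root of
   order [n k] close to 1 of the ratio of the two values of [z ^+ n k]. *)
Lemma julia_inverse_branch k z (xi' : C) (d : R) :
  normc (julia_map k z) <= expR B -> normc xi' <= expR B ->
  normc (julia_map k z - xi') <= d ->
  exists xi : C, [/\ julia_map k xi = xi', normc xi <= expR B &
    normc (z - xi) <= expR (2^-1 ^+ k.+1) * d / ((n k)%:R * A k)].
Proof.
set b := expR B; set w := julia_map k z => wb xb wd.
have b2 : 2 <= b by exact: expR_B_ge2.
have Ak := A_gt0 k; have n0 := n_gt0 k.
set q : R := 2^-1 ^+ k.+1.
have q0 : 0 < q by rewrite exprn_gt0 // invr_gt0.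
have q1 : q <= 2^-1.
  by rewrite /q exprS ler_piMr ?invr_ge0 // exprn_ile1 ?invr_ge0 // invf_le1 // ler1n.
have ba : 16 * b <= A k * q.
  apply: le_trans (_ : 16 * b * 4 ^+ k.+1 * q <= _); last by rewrite ler_pM2r // A_ge.
  rewrite -[leRHS]mulrA ler_peMr //; first by rewrite mulr_ge0 // (le_trans _ b2).
  rewrite /q -exprMn exprn_ege1 //; lra.
have aC : (A k)%:C%C != 0 :> C by rewrite fmorph_eq0 gt_eqF.
set y := z ^+ n k; pose y0 : C := (xi' - 1) / (A k)%:C%C + 1.
have yE : y - 1 = (w - 1) / (A k)%:C%C by rewrite /w /julia_map addrK mulrC mulKf.
have near1 (u : C) : normc u <= b -> A k * normc ((u - 1) / (A k)%:C%C : C) <= b + 1.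
  move=> ub; rewrite -{1}(gtr0_norm Ak) -normc_real -normc_mul mulrC mulfVK //.
  by apply: le_trans (normcD _ _) _; rewrite normc_opp normc_one lerD2r.
(* As b >= 2, b + 1 <= (3 / 2) b, and [ba] bounds b by A q / 16. *)
have y1 : normc (y - 1) <= 3 / 32 * q.
  rewrite -(ler_pM2l Ak) yE; apply: le_trans (near1 _ wb) _; lra.
have y01 : normc (y0 - 1) <= 3 / 32 * q.
  rewrite -(ler_pM2l Ak) /y0 addrK; apply: le_trans (near1 _ xb) _; lra.
have ylow : 1 - q / 8 <= normc y.
  have := normcD y (1 - y); rewrite addrC subrK normc_one (normcBC 1); lra.
have yp : 0 < normc y by lra.
have yn0 : y != 0 by rewrite -normc_gt0.
pose s := y0 / y.
have sE : s * y = y0 by rewrite /s divfK.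
have syE : (s - 1) * y = (xi' - w) / (A k)%:C%C.
  rewrite mulrBl sE mul1r (_ : y0 - y = (y0 - 1) - (y - 1)); last by ring.
  rewrite yE /y0 addrK -mulrBl; congr (_ / _); ring.
have sy : normc (s - 1) * normc y * A k = normc (w - xi').
  rewrite -normc_mul syE (normcBC w) -[in RHS](divfK aC (xi' - w)) [in RHS]normc_mul.
  by rewrite normc_real gtr0_norm.
set t := normc (s - 1) in sy *.
have t0 : 0 <= t by exact: normc_ge0.
have tq : t <= q / 4.
  rewrite -(ler_pM2r yp) -normc_mul mulrBl sE mul1r.
  have := normcD (y0 - 1) (- (y - 1)).
  rewrite normc_opp (_ : y0 - 1 - (y - 1) = y0 - y); last by ring.
  have : q / 4 * (1 - q / 8) <= q / 4 * normc y by rewrite ler_wpM2l // divr_ge0 // ltW.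
  have : q * q <= 2^-1 * q by rewrite ler_pM2r.
  by move: y1 y01; lra.
have [j nj] := n_pow2 k.
have [|sg sgE] := @pow2_root_near R j s; first by rewrite -/t; lra.
rewrite -nj in sgE *; rewrite -/t => sgt.
have xiE : (sg * z) ^+ n k = y0 by rewrite exprMn sgE sE.
exists (sg * z); split.
- by rewrite /julia_map xiE /y0 addrK mulrC divfK // subrK.
(* A point of modulus above [b >= 2] would have [n k]-th power of modulus above 2, but [y0] is close
   to 1. *)
- rewrite leNgt; apply/negP => hb.
  have big : 2 < normc (sg * z) by exact: le_lt_trans b2 hb.
  have : normc y0 <= 2.
    by have := normcD (y0 - 1) 1; rewrite subrK normc_one; lra.
  rewrite -xiE normcX leNgt => /negP; apply.
  apply: lt_le_trans big _; apply: ler_eXnr; last by lra.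
  exact: leq_trans (n2 k).
have zy : normc z * (1 - q / 8) <= normc y.
  have [z1|z1] := leP (normc z) 1.
    by apply: le_trans ylow; rewrite ler_piMl //; lra.
  apply: le_trans (_ : normc z * 1 <= _); first by rewrite ler_wpM2l ?normc_ge0 //; lra.
  rewrite mulr1 /y normcX ler_eXnr ?(ltW z1) //; exact: leq_trans (n2 k).
have dE : normc (z - sg * z) = normc (sg - 1) * normc z.
  by rewrite normcBC -normc_mul mulrBl mul1r.
set x := normc (sg - 1) in sgt dE; have x0 : 0 <= x by exact: normc_ge0.
rewrite ler_pdivlMr ?mulr_gt0 // dE.
have z0 := normc_ge0 z.
have P0 : 0 <= x * normc z * ((n k)%:R * A k) by rewrite !mulr_ge0 // ltW.
have main : x * normc z * ((n k)%:R * A k) * ((1 - t) * (1 - q / 8)) <= d.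
  apply: le_trans wd; rewrite -sy.
  have h1 : x * ((n k)%:R * (1 - t)) <= t.
    by apply: le_trans sgt; rewrite ler_wpM2l // lerDl.
  have h2 : x * ((n k)%:R * (1 - t)) * (normc z * (1 - q / 8)) <= t * normc y.
    apply: ler_pM => //; rewrite !mulr_ge0 // ?(ltW n0) //; lra.
  rewrite (_ : x * normc z * ((n k)%:R * A k) * ((1 - t) * (1 - q / 8)) =
    x * ((n k)%:R * (1 - t)) * (normc z * (1 - q / 8)) * A k); last by ring.
  by rewrite ler_pM2r.
have e1 : 1 + q <= expR q by exact: expR_ge1Dx.
(* One factor [expR q] absorbs both the loss [1 - t] from the root and the loss [1 - q / 8] from the
   modulus of [y], thanks to [t <= q / 4] and [q <= 1 / 2]. *)
have e2 : 1 <= expR q * ((1 - t) * (1 - q / 8)).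
  have : (1 + q) * ((1 - q / 4) * (1 - q / 8)) <= expR q * ((1 - t) * (1 - q / 8)).
    apply: ler_pM => //; [by lra|by apply: mulr_ge0; lra|].
    by rewrite ler_wpM2r //; lra.
  apply: le_trans; nra.
apply: le_trans (_ : x * normc z * ((n k)%:R * A k) * (expR q * ((1 - t) * (1 - q / 8))) <= _).
  by rewrite ler_peMr.
by rewrite mulrCA ler_pM2l // expR_gt0.
Qed.

(** Zeros of the Green functions have orbits inside the disc of radius [expR B], so [0] can be
    pulled back along the orbit of [z] by inverse branches. Each pullback contracts by n A up to
    [expR (2^-1 ^+ k.+1)]; the same factor from the induction completes [expR (2^-1 ^+ k)]. *)
Lemma julia_zero_near_preimage m k z : julia_green k z = 0 ->
  exists xi : C, [/\ julia_iter m k xi = 0, normc xi <= expR B &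
    normc (z - xi) <= expR B * expR (2^-1 ^+ k) * level_radius m k].
Proof.
have B0 := expR_ge0 B.
elim: m k z => [|m IH] k z /julia_green_zero[zb gw].
  exists 0; split; [by []|by rewrite normc_zero|].
  rewrite subr0 -[level_radius 0 k]/(1 : R) mulr1; apply: le_trans zb _.
  by rewrite ler_peMr // -[leLHS]expR0 ler_expR exprn_ge0 // invr_ge0.
have [xi' [xi0 xib xid]] := IH k.+1 _ gw.
have [wb _] := julia_green_zero gw.
have [xi [h1 h2 h3]] := julia_inverse_branch wb xib xid.
exists xi; split=> //=; first by rewrite h1.
apply: le_trans h3 _; rewrite !mulrA.
rewrite ler_wpM2r ?invr_ge0 ?mulr_ge0 ?(ltW (n_gt0 _)) ?(ltW (A_gt0 _)) //.
rewrite ler_wpM2r ?(ltW (level_radius_gt0 _ _)) //.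
have E : expR (2^-1 ^+ k) = expR (2^-1 ^+ k.+1) * expR (2^-1 ^+ k.+1) :> R.
  by rewrite -expRD exprS; congr expR; field.
rewrite E [leLHS](_ : _ = expR B * (expR (2^-1 ^+ k.+1) * expR (2^-1 ^+ k.+1))) //.
by ring.
Qed.

(** Below exponent 1 Hoelder continuity bounds both differences; in a disc of radius 1/2 increments
    are at most 1, so the exponent alpha / 2 asked of first differences is the weaker one. *)
Lemma julia_green_zclass z0 : exists2 r : R, 0 < r &
  zclass (fun z : C => normc z) alpha [set z | normc (z - z0) < r] (julia_green 0).
Proof.
exists 2^-1; first by rewrite invr_gt0.
have [K K0 holder] : exists2 K, 0 <= K & forall z w,
    `|julia_green 0 z - julia_green 0 w| <= K * normc (z - w) `^ alpha.
  exists (D * expR 2); last exact: julia_green_holder.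
  have := julia_green_holder 1 0; rewrite subr0 normc_one powR1 mulr1; exact: le_trans.
exists (2 * K) => [|x h xr xhr _]; first by rewrite mulr_ge0.
have hr : normc h <= 1.
  have := normcD (x + h - z0) (- (x - z0)); rewrite normc_opp opprB addrA subrK addrAC subrr add0r.
  by move: xr xhr => /=; lra.
have h1 : `|julia_green 0 (x + h) - julia_green 0 x| <= K * normc h `^ alpha.
  by apply: le_trans (holder _ _) _; rewrite addrAC subrr add0r.
have h2 : `|julia_green 0 (x - h) - julia_green 0 x| <= K * normc h `^ alpha.
  by apply: le_trans (holder _ _) _; rewrite addrAC subrr add0r normc_opp.
have p0 := powR_ge0 (normc h) alpha.
split.
  apply: le_trans h1 _.
  have : normc h `^ alpha <= normc h `^ (alpha / 2).
    apply: powR_le_1; rewrite ?normc_ge0 //; first by rewrite divr_gt0.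
    by rewrite ler_pdivrMr // ler_peMr ?(ltW a0) // ler1n.
  move=> /(ler_wpM2l K0) h3.
  by have := mulr_ge0 K0 p0; lra.
rewrite (_ : _ - _ = (julia_green 0 (x + h) - julia_green 0 x) +
  (julia_green 0 (x - h) - julia_green 0 x)); last by ring.
apply: le_trans (ler_normD _ _) _; lra.
Qed.

(** The exceptional set lies in the zero set of the Green function, where all fibres have radius 1.
    The roots of the composed polynomial, as many as its degree, are centres of a cover, and degree
    times the alpha-th power of [level_radius] is exactly 1. *)
Lemma julia_counterexample :
  removability_fails alpha.
Proof.
have lB : 0 < expR B by exact: expR_gt0.
have zero z : ~ superharmonic_near (julia_green 0) z -> julia_green 0 z = 0.
  move=> ns; apply/eqP; rewrite eq_le julia_green_ge0 andbT leNgt.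
  by apply/negP => /julia_green_superharmonic.
have K0 : 0 < expR B * expR 1 by rewrite mulr_gt0 ?expR_gt0.
(* The point 1 is fixed by every map, hence a zero. On the circle of radius [expR B + 2] around it
   |z| exceeds [expR B], so log^+ exceeds its distance [B] to the Green function. *)
apply: (@hartogs_counterexample R alpha 1 ((expR B * expR 1) `^ alpha)
  (julia_green 0) 1 (expR B + 2)).
- by rewrite a0 (lt_trans a1) // ltr1n.
- exact: julia_green_continuous.
- exact: julia_green_ge0.
- exact: julia_green_zclass.
- by rewrite addr_gt0.
- exact: julia_green_fixed.
- move=> z zE; have := julia_green_bound 0 z; rewrite ler_distl => /andP[h _].
  have zb : expR B < mx1 z.
    apply: lt_le_trans (normc_le_mx1 z).
    by have := normcD z (- 1); rewrite normc_opp normc_one zE; lra.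
  have : B < ln (mx1 z) by rewrite -ltr_expR lnK // posrE mx1_gt0.
  by lra.
- by move=> z /zero ->; rewrite expR0.
move=> d d0.
have [m md] : exists m, expR B * expR 1 * 2^-1 ^+ m < d.
  have := geometric_cvg0 (expR B * expR 1); move/cvgrPdist_lt.
  move=> /(_ _ d0) [m _ /(_ m (leqnn m))].
  rewrite /= sub0r normrN => h; exists m.
  by apply: le_lt_trans h; exact: ler_norm.
have lv0 := level_gt0 m 0.
have p0 : julia_poly m 0 != 0.
  by apply: contraTneq lv0 => h; rewrite -size_julia_poly h size_poly0.
have [s sE] := closed_field_poly_normal (julia_poly m 0).
have ss : size s = level m 0.
  rewrite -size_julia_poly {1}sE size_scale ?lead_coef_eq0 //.
  by rewrite size_prod_XsubC.
exists (expR B * expR 1 * level_radius m 0), [seq (x, 1) | x <- s]; split.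
- rewrite mulr_gt0 ?level_radius_gt0 //=; apply: le_trans (ltW md).
  by rewrite ler_pM2l // level_radius_le.
- rewrite size_map ss powRM ?(ltW K0) ?(ltW (level_radius_gt0 _ _)) // level_radius_powR.
  by rewrite mulrCA mulfV ?mulr1 // pnatr_eq0 -lt0n.
move=> z /zero gz; have [xi [xi0 _ zxi]] := julia_zero_near_preimage m gz.
exists (xi, 1); last first.
  rewrite gz expR0 subrr normr0; split; first by move: zxi; rewrite expr0.
  by rewrite mulr_ge0 // ltW // level_radius_gt0.
apply/mapP; exists xi => //.
have : root (julia_poly m 0) xi by rewrite /root horner_julia_poly xi0.
by rewrite sE rootZ ?lead_coef_eq0 // root_prod_XsubC.
Qed.

End JuliaGreen.

(** * Choice of the polynomial parameters *)

Section SmallExponents.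
Context {R : realType}.

Lemma counterexample_lt1 (alpha : R) : 0 < alpha < 1 ->
  removability_fails alpha.
Proof.
move=> a01; have /andP[a0 a1] := a01.
(* With A = n^beta the product n A is n^(1 / alpha), as [nA] demands. [B] equals 2 beta + 2, which
   is what the last hypothesis needs. *)
pose beta := (1 - alpha) / alpha; pose B := 2 / alpha.
have b0 : 0 < beta by rewrite divr_gt0 // subr_gt0.
have B2 : 2 <= B by rewrite /B ler_pdivlMr // ler_piMr // ltW.
have Bbeta : B = 2 * beta + 2 by rewrite /B /beta; field; rewrite gt_eqF.
have e0 : 0 < expR B by exact: expR_gt0.
have e1 : 1 <= expR B by apply: le_trans (expR_ge1Dx B); rewrite lerDl (le_trans _ B2).
(* With n_k = 2^(L (k + 1)) this yields A_k >= (64 e^B)^(k + 1), and 64 = 16 * 4 splits off the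
   factor 4^(k + 1). *)
have [L L0 Lb] : exists2 L, (0 < L)%N & 64 * expR B <= (2 ^ L)%:R `^ beta.
  pose y := (64 * expR B) `^ beta^-1.
  exists (Num.truncn y).+1 => //.
  rewrite [leLHS](_ : _ = y `^ beta); last first.
    by rewrite /y -powRrM mulVf ?gt_eqF // powRr1 // mulr_ge0 // ltW.
  apply: ge0_ler_powR; rewrite ?nnegrE ?(ltW b0) ?powR_ge0 //.
  apply: le_trans (ltW (truncnS_gt y)) _; rewrite ler_nat.
  exact: ltnW (ltn_expl _ _).
pose n k := (2 ^ (L * k.+1))%N.
pose A k : R := (n k)%:R `^ beta.
have n2 k : (2 <= n k)%N by rewrite /n -[X in (X <= _)%N]expn1 leq_exp2l // muln_gt0 L0.
have np k : 0 < (n k)%:R :> R by rewrite ltr0n; apply: leq_trans (n2 k).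
apply: (@julia_counterexample R alpha B n A a01) => [|//|k|k|k|k].
- by apply: le_trans B2; rewrite ler1n.
- by exists (L * k.+1)%N.
- have pw (u : R) j : 0 <= u -> (u ^+ j) `^ beta = (u `^ beta) ^+ j.
    by move=> u0; rewrite -(powR_mulrn j u0) -(powR_mulrn j (powR_ge0 u beta)) powRAC.
  rewrite /A /n expnM natrX pw ?ler0n //.
  apply: le_trans (_ : (64 * expR B) ^+ k.+1 <= _); last first.
    by apply: lerXn2r; rewrite ?nnegrE ?powR_ge0 ?mulr_ge0 ?(ltW e0).
  rewrite (_ : 64 * expR B = 16 * expR B * 4) ?exprMn; last by ring.
  rewrite ler_pM2r ?exprn_gt0 // -exprMn; apply: ler_eXnr => //.
  by apply: mulr_ege1; rewrite // ler1n.
- have -> : (n k)%:R * A k = (n k)%:R `^ alpha^-1.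
    rewrite /A -{1}[(n k)%:R](powRr1 (ltW (np k))) -powRD; last by rewrite (gt_eqF (np k)) implybT.
    by congr (_ `^ _); rewrite /beta; field; rewrite gt_eqF.
  by rewrite -powRrM mulVf ?gt_eqF // powRr1 // ltW.
(* It remains to bound ln 3 + beta ln x by B (x - 1) for x >= 2: use ln x <= x - 1 for the term in
   beta, and ln 3 <= 2 <= 2 (x - 1) for the other. *)
have : 2 <= (n k)%:R :> R by rewrite ler_nat.
rewrite /A; move: (n k)%:R => x x2 {n2 np A}.
have x0 : 0 < x by exact: lt_le_trans x2.
have ln3 := @ln3_le2 R.
have lnx : ln x <= x - 1 by have := expR_ge1Dx (ln x); rewrite lnK ?posrE //; lra.
rewrite lnM ?posrE ?powR_gt0 // ln_powR.
have := ler_wpM2l (ltW b0) lnx.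
have : beta * 2 <= beta * x by rewrite ler_pM2l.
rewrite Bbeta; lra.
Qed.

End SmallExponents.

Theorem proposition5p2 (R : realType) (alpha : R) (halpha : 0 < alpha < 2) :
  exists (Omega F : set (Cspace R 2)),
    [/\ domain Omega,
        zygmund_boundary alpha Omega,
        [/\ closed F, F `<=` boundary Omega & (hausdorff (1 + alpha) F < +oo)%E],
        (forall zeta, (boundary Omega `\` F) zeta ->
           locally_pseudoconvex_at Omega zeta) &
        ~ pseudoconvex Omega].
Proof.
have /andP[a0 a2] := halpha; have [a1|a1] := ltP alpha 1.
  by apply: counterexample_lt1; rewrite a0.
by apply: counterexample_ge1; rewrite a1.
Qed.
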